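(* Let $f:[a,b]\to[a,b]$ be a map in the class $\mathcal{CPMM}$, with partition set $P$ and transition matrix $T=T(f,P)$, and fix a real number $\lambda>1$. Assume that $f$ is topologically mixing. Then the following are equivalent: (1) $f$ is conjugate via a homeomorphism $\psi$ to some map $g\in\mathcal{CPMM}$ of constant slope $\lambda$; (2) $T$ has a nonnegative eigenvector $v=(v_I)\in\mathbb{R}^{\mathcal{B}(P)}$ with eigenvalue $\lambda$.
   Context: The extended real line $[-\infty,\infty]=\mathbb{R}\cup\{-\infty,\infty\}$ carries the order topology; intervals $[a,b]$ with $-\infty\le a<b\le\infty$ are subintervals of it. Class $\mathcal{CPMM}$: a continuous map $f:[a,b]\to[a,b]$, where $-\infty\le a<b\le\infty$ (the interval depends on $f$ and may have infinite length), belongs to $\mathcal{CPMM}$ (countably piecewise monotone and Markov) with partition set $P$ if $P\subset[a,b]$ is a closed countable set with $a,b\in P$, $f(P)\subset P$, and $f$ is monotone on each connected component of $[a,b]\setminus P$. The components of $[a,b]\setminus P$ are called $P$-basic intervals (they are open intervals contained in $\mathbb{R}$), and $\mathcal{B}(P)$ is the set of all $P$-basic intervals. Constant slope: a map in $\mathcal{CPMM}$ with partition set $P$ has constant slope $\lambda$ if its restriction to each $P$-basic interval is affine with slope of absolute value $\lambda$. (For $g$, this is with respect to a partition set of $g$.) Transition matrix: $T=T(f,P)$ has rows and columns indexed by $\mathcal{B}(P)$, with $T(I,J)=1$ if $f(I)\supseteq J$ and $T(I,J)=0$ otherwise. A nonnegative eigenvector of $T$ with eigenvalue $\lambda$ is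 a nonzero $v=(v_I)_{I\in\mathcal{B}(P)}$ with real entries $v_I\ge 0$ such that $\sum_{J\in\mathcal{B}(P)}T(I,J)v_J=\lambda v_I$ (in particular the sum converges) for every $I\in\mathcal{B}(P)$. No summability of $v$ is required. Conjugate via $\psi$: $f:[a,b]\to[a,b]$ is conjugate to $g:[c,d]\to[c,d]$ via $\psi$ if $\psi:[a,b]\to[c,d]$ is a homeomorphism with $\psi\circ f=g\circ\psi$; here $[c,d]\subset[-\infty,\infty]$ may be any interval with $-\infty\le c<d\le\infty$. Topologically mixing: for every pair of nonempty open sets $U,V$ there exists $n_0\in\mathbb{N}$ such that $f^n(U)\cap V\neq\emptyset$ for all $n\ge n_0$. *)

(* Defs.v *)
From HB Require Import structures.
From mathcomp Require Import all_boot all_order all_algebra.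
From mathcomp Require Import all_classical all_reals all_analysis.

Set Implicit Arguments.
Unset Strict Implicit.
Unset Printing Implicit Defensive.

Import Order.TTheory GRing.Theory Num.Theory.

Local Open Scope classical_set_scope.
Local Open Scope ring_scope.

(* A map of an interval [a, b] of the extended real line is represented by a
   total function on \bar R; every notion below depends only on its values on
   [a, b]. *)

Definition basic_intervals (R : realType) (a b : \bar R) (P : set (\bar R)) :
    set (set (\bar R)) :=
  [set connected_component (`[a, b] `\` P) x | x in `[a, b] `\` P].

Definition monotone_on (R : realType) (f : \bar R -> \bar R)
    (I : set (\bar R)) : Prop :=
  (forall x y, I x -> I y -> (x <= y)%E -> (f x <= f y)%E) \/
  (forall x y, I x -> I y -> (x <= y)%E -> (f y <= f x)%E).

Record cpmm (R : realType) (a b : \bar R) (f : \bar R -> \bar R)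
    (P : set (\bar R)) : Prop := Cpmm {
  cpmm_lt : (a < b)%E ;
  cpmm_fun : set_fun `[a, b] `[a, b] f ;
  cpmm_continuous : {within `[a, b], continuous f} ;
  cpmm_sub : P `<=` `[a, b] ;
  cpmm_closed : closed P ;
  cpmm_countable : countable P ;
  cpmm_left : P a ;
  cpmm_right : P b ;
  cpmm_markov : f @` P `<=` P ;
  cpmm_monotone : forall I, basic_intervals a b P I -> monotone_on f I }.

(* Basic intervals contain no infinite point (an infinite point of [a, b] is an
   endpoint, hence in P), so it is enough to quantify over real x. *)
Definition constant_slope (R : realType) (a b : \bar R) (g : \bar R -> \bar R)
    (P : set (\bar R)) (lam : R) : Prop :=
  forall I, basic_intervals a b P I ->
    exists s m : R, `|s| = lam /\
      forall x : R, I x%:E -> g x%:E = (s * x + m)%:E.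

Definition transition_matrix (R : realType) (f : \bar R -> \bar R)
    (I J : set (\bar R)) : R :=
  if `[< J `<=` f @` I >] then 1 else 0.

(* The vector v is indexed by basic_intervals a b P; its values at other sets
   are irrelevant. As all terms are nonnegative, \esum is the unordered sum in
   [0, +oo], and equality with a real number expresses convergence. *)
Definition nonneg_eigenvector (R : realType) (a b : \bar R)
    (f : \bar R -> \bar R) (P : set (\bar R)) (lam : R)
    (v : set (\bar R) -> R) : Prop :=
  [/\ forall I, basic_intervals a b P I -> 0 <= v I,
      exists2 I, basic_intervals a b P I & v I != 0 &
      forall I, basic_intervals a b P I ->
        \esum_(J in basic_intervals a b P) (transition_matrix f I J * v J)%:E
        = (lam * v I)%:E].

Definition homeomorphism_between (S T : topologicalType) (A : set S)
    (B : set T) (psi : S -> T) : Prop :=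
  [/\ set_bij A B psi,
      {within A, continuous psi} &
      exists2 phi : T -> S, {within B, continuous phi} &
        forall x, A x -> phi (psi x) = x].

Definition conjugate_via (R : realType) (a b : \bar R) (f : \bar R -> \bar R)
    (c d : \bar R) (g psi : \bar R -> \bar R) : Prop :=
  homeomorphism_between `[a, b] `[c, d] psi /\
  forall x, x \in `[a, b] -> psi (f x) = g (psi x).

(* U `&` A and V `&` A are arbitrary relatively open subsets of A. *)
Definition topologically_mixing (T : topologicalType) (A : set T)
    (f : T -> T) : Prop :=
  forall U V : set T, open U -> open V ->
    U `&` A !=set0 -> V `&` A !=set0 ->
    exists n0 : nat, forall n : nat, (n0 <= n)%N ->
      (iter n f @` (U `&` A)) `&` (V `&` A) !=set0.

(* Main.v *)
(* From (1) to (2), v_I is the length of psi(I): g stretches lengths by lam on its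
   basic intervals, and the countable partition sets are null. Mixing spreads
   finiteness from a small interval, whose image under psi is bounded, to all I.

   From (2) to (1), let m be the limit of the weights m_0(A), the sum of v_J over
   the basic J contained in A, and m_(n+1)(A) = lam^-1 sum_I m_n(f(A cap I)). Then
   m(f A) = lam m(A) when A lies in a basic interval, and psi(x) = m(]o, x[), with
   a minus sign to the left of o, is the conjugacy, provided that m is additive on
   adjacent intervals and has no one-sided atoms. A failure of either is multiplied
   by lam under f, so it follows an orbit and yields basic intervals J_n with
   f(J_n) containing J_(n+1) and v_(J_n) >= c lam^n. As m is finite on compact
   subsets of ]a, b[, the J_n escape to an end of [a, b] that is fixed by h = f^2.
   By mixing, h maps points arbitrarily close to this end far back inside. Since m
   is expanded at most by lam^2 under h, each such fold costs a fixed amount of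
   lam^(-2n) m(]o, J_2n[), which is nonnegative: a contradiction. *)

Require Import Defs.
From mathcomp Require Import all_boot all_order all_algebra.
From mathcomp Require Import all_classical all_reals all_analysis.
From mathcomp Require Import ring lra.

Set Implicit Arguments.
Unset Strict Implicit.
Unset Printing Implicit Defensive.

Import Order.TTheory GRing.Theory Num.Theory.
Import numFieldNormedType.Exports.

Local Open Scope classical_set_scope.
Local Open Scope ring_scope.

(** * Intervals of the extended real line *)

Section ereal_topology.
Context {R : realType}.
Implicit Types (x y z t p q : \bar R) (A B : set (\bar R)).
Local Open Scope ereal_scope.

(** The eigenvector need not be summable, so there is no total mass to normalise, and [psi] may take
    infinite values at both ends. The levels m_n count from inside: a basic interval cut by an end
    of A counts for nothing at level 0 and is resolved only by further steps. Two facts shape the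
    proof. The eigenvalue equation makes all levels agree on basic intervals, so m_n increases with
    n. Counting from inside is superadditive, so only the opposite inequality at one cut point is in
    doubt; there the excess is at most lam^-n times the weight of the basic interval that contains
    the n-th image of the point, which is the origin of the paths with weights above c lam^n.
    Likewise an atom must sit in a germ contained in one basic interval, since a convergent sum over
    infinitely many intervals has small tails. The square of f occurs because f may exchange the two
    ends of [a, b]. *)

Definition ioo p q : set (\bar R) := [set x | p < x < q].
Definition icc p q : set (\bar R) := [set x | p <= x <= q].

Lemma set_itvoo p q : `]p, q[%classic = ioo p q.
Proof. by apply/seteqP; split=> x /=; rewrite in_itv. Qed.

Lemma set_itvcc p q : `[p, q]%classic = icc p q.
Proof. by apply/seteqP; split=> x /=; rewrite in_itv. Qed.

Lemma ereal_dense x y : x < y -> exists z, x < z < y.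
Proof.
case: x => [r| |]; case: y => [s| |]; rewrite ?ltxx // => xy.
- exists ((r + s) / 2)%:E; rewrite !lte_fin; rewrite lte_fin in xy.
  by rewrite midf_lt// midf_lt.
- by exists (r + 1)%:E; rewrite lte_fin ltrDl ltr01 ltry.
- by exists (s - 1)%:E; rewrite lte_fin gtrDl ltrN10 ltNyr.
- by exists 0; rewrite ltNy0 lt0y.
Qed.

Lemma fin_between x y z : x < z -> z < y -> z \is a fin_num.
Proof.
by case: z => [r| |] // xz zy; [rewrite ltNge leey in zy|rewrite ltNge leNye in xz].
Qed.

Lemma ioo_open p q : open (ioo p q).
Proof. by rewrite -set_itvoo; exact: itv_open. Qed.

Lemma ioo_connected p q : connected (ioo p q).
Proof.
have -> : ioo p q = EFin @` [set r | p < r%:E < q].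
  apply/seteqP; split => [x|x [r /= pr <-//]].
  case: x => [r| |] /=; first by exists r.
  - by rewrite /ioo /= [_ < q]ltNge leey andbF.
  - by rewrite /ioo /= ltNge leNye.
apply: connected_continuous_connected.
  apply/connected_intervalP => x y /= /andP[px xq] /andP[py yq] z /andP[xz zy].
  by rewrite (lt_le_trans px) ?(le_lt_trans _ yq)// lee_fin.
by apply: continuous_subspaceT => r; move=> A.
Qed.

Lemma nbhs_right x y B : x < y -> nbhs x B ->
  exists2 w, x < w <= y & forall z, x <= z < w -> B z.
Proof.
move=> xy; rewrite itv_nbhsE /= => -[[l u] [io xi] iB].
move: xi; rewrite itv_boundlr => /andP[lx xu].
case: u => [bu u|bu] in io xu iB *.
  have e := itv_open_ends_rside io; rewrite e in io xu iB.
  exists (Order.min u y).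
    by rewrite lt_min xy ge_min lexx orbT !andbT; move: xu.
  move=> z /andP[xz]; rewrite lt_min => /andP[zu _].
  apply: iB; rewrite /= itv_boundlr; apply/andP; split.
    by apply: (le_trans lx); rewrite bnd_simp.
  by rewrite bnd_simp.
exists y; first by rewrite xy lexx.
move=> z /andP[xz zy]; apply: iB; rewrite /= itv_boundlr; apply/andP; split.
  by apply: (le_trans lx); rewrite bnd_simp.
by rewrite (itv_open_ends_rinfty io).
Qed.

Lemma nbhs_left x y B : y < x -> nbhs x B ->
  exists2 w, y <= w < x & forall z, w < z <= x -> B z.
Proof.
move=> xy; rewrite itv_nbhsE /= => -[[l u] [io xi] iB].
move: xi; rewrite itv_boundlr => /andP[lx xu].
case: l => [bu l|bu] in io lx iB *.
  have e := itv_open_ends_lside io; rewrite e in io lx iB.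
  exists (Order.max l y).
    by rewrite gt_max xy le_max lexx orbT !andbT; move: lx.
  move=> z /andP[]; rewrite gt_max => /andP[zu _] xz.
  apply: iB; rewrite /= itv_boundlr; apply/andP; split; first by rewrite bnd_simp.
  by apply: (le_trans _ xu); rewrite bnd_simp.
exists y; first by rewrite xy lexx.
move=> z /andP[yz zx]; apply: iB; rewrite /= itv_boundlr; apply/andP; split.
  by rewrite (itv_open_ends_linfty io).
by apply: (le_trans _ xu); rewrite bnd_simp.
Qed.

Lemma icc_connected p q : connected (icc p q).
Proof.
have [pq|qp] := leP p q; last first.
  have -> : icc p q = set0.
    by apply/seteqP; split => x //= /andP[/le_trans h /h]; rewrite leNgt qp.
  exact: connected0.
have [pq'|qp'] := eqVneq p q.
  have -> : icc p q = [set p].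
    by apply/seteqP; split => x /=; rewrite /icc /= -pq' -eq_le eq_sym => /eqP.
  exact: connected1.
have {qp' pq} pq : p < q by rewrite lt_neqAle qp'.
suff -> : icc p q = closure (ioo p q) by exact/connected_closure/ioo_connected.
apply/seteqP; split; last by rewrite -set_itvoo -set_itvcc; exact: itv_closure.
move=> x /= /andP[px xq] B Bx.
have [xq'|qx] := ltP x q.
  have [w /andP[xw wq] wB] := nbhs_right xq' Bx.
  have [z /andP[xz zw]] := ereal_dense xw; exists z; split.
    by rewrite /ioo /= (le_lt_trans px xz) (lt_le_trans zw wq).
  by apply: wB; rewrite ltW.
have px' : p < x by apply: lt_le_trans qx.
have [w /andP[pw wx] wB] := nbhs_left px' Bx.
have [z /andP[wz zx]] := ereal_dense wx; exists z; split.
  by rewrite /ioo /= (le_lt_trans pw wz) (lt_le_trans zx xq).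
by apply: wB; rewrite wz ltW.
Qed.

Lemma connected_mid A x y t : connected A -> A x -> A y -> x <= t <= y -> A t.
Proof.
move=> cA Ax Ay /andP[xt ty]; apply: contrapT => At.
have xt' : x < t by rewrite lt_neqAle xt andbT; apply: contra_notN At => /eqP <-.
have ty' : t < y by rewrite lt_neqAle ty andbT; apply: contra_notN At => /eqP ->.
have AE : A `&` [set z | z < t] = A.
  apply: cA; first by exists x.
  - by exists [set z | z < t] => //; exact: open_ereal_lt_ereal.
  - exists [set z | z <= t]; first exact: closed_ereal_ge_ereal.
    apply/seteqP; split => z [Az /= zt]; split => //; first exact: ltW.
    by rewrite lt_neqAle zt andbT; apply: contra_notN At => /eqP <-.
by have : A y := Ay; rewrite -AE => -[_ /=]; rewrite ltNge ty.
Qed.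

Lemma ereal_ivt (a b : \bar R) (f : \bar R -> \bar R) x y t :
  {within `[a, b], continuous f} -> a <= x -> x <= y -> y <= b ->
  (f x <= t <= f y) || (f y <= t <= f x) -> exists2 z, x <= z <= y & f z = t.
Proof.
rewrite set_itvcc => cf ax xy yb tf.
have : (f @` icc x y) t.
  have cI : connected (f @` icc x y).
    apply: connected_continuous_connected; first exact: icc_connected.
    apply: continuous_subspaceW cf => z /= /andP[xz zy].
    by rewrite /icc /= (le_trans ax)// (le_trans _ yb).
  case/orP: tf => tf.
  - apply: (connected_mid cI _ _ tf).
      by exists x => //; rewrite /icc /= lexx.
    by exists y => //; rewrite /icc /= lexx xy.
  - apply: (connected_mid cI _ _ tf).
      by exists y => //; rewrite /icc /= lexx xy.
    by exists x => //; rewrite /icc /= lexx.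
by case=> z; exists z.
Qed.

(* The basic intervals are the ]p, q[ with [gap P p q]. *)
Definition gap (P : set (\bar R)) p q :=
  [/\ P p, P q, p < q & forall x, p < x < q -> ~ P x].

(** The two ends are the supremum of [P] below [x] and the infimum of [P] above it; both belong to
    [P] because [P] is closed. *)
Lemma gap_around (a b : \bar R) (P : set (\bar R)) x :
  closed P -> P a -> P b -> a <= x <= b -> ~ P x ->
  exists p q, [/\ gap P p q, p < x < q & a <= p /\ q <= b].
Proof.
move=> cP Pa Pb /andP[ax xb] Px.
pose A := P `&` [set y | y <= x]; pose B := P `&` [set y | x <= y].
have PA : A (ereal_sup A).
  apply: (@itv_closed_supremums _ _ A); first by exists a.
    by apply: closedI => //; exact: closed_ereal_ge_ereal.
  split; first by apply: ereal_sup_ubound.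
  by move=> y yA; apply: ge_ereal_sup.
have PB : B (ereal_inf B).
  apply: (@itv_closed_infimums _ _ B); first by exists b.
    by apply: closedI => //; exact: closed_ereal_le_ereal.
  split; first by apply: ereal_inf_lbound.
  by move=> y yA; apply: le_ereal_inf_tmp.
have px : ereal_sup A < x.
  case: PA => PA pA; rewrite lt_neqAle pA andbT.
  by apply: contra_notN Px => /eqP <-.
have xq : x < ereal_inf B.
  case: PB => PB pB; rewrite lt_neqAle pB andbT.
  by apply: contra_notN Px => /eqP ->.
exists (ereal_sup A), (ereal_inf B); split.
- split; [by case: PA|by case: PB|exact: lt_trans xq|].
  move=> z /andP[pz zq] Pz; have [zx|xz] := leP z x.
    by move: pz; rewrite ltNge => /negP; apply; apply: ereal_sup_ubound.
  by move: zq; rewrite ltNge => /negP; apply; apply: ereal_inf_lbound; split => //=; rewrite ltW.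
- by rewrite px.
- by split; [apply: ereal_sup_ubound|apply: ereal_inf_lbound].
Qed.

Lemma gap_component (a b : \bar R) (P : set (\bar R)) p q x :
  P `<=` icc a b -> gap P p q -> p < x < q ->
  connected_component (icc a b `\` P) x = ioo p q.
Proof.
move=> Pab [Pp Pq pq g] xpq; apply/seteqP; split; last first.
  apply: connected_component_max => //; last exact: ioo_connected.
  move=> y ypq; split; last exact: g.
  have /andP[ap _] := Pab _ Pp; have /andP[_ qb] := Pab _ Pq.
  by case/andP: ypq => py yq; rewrite /icc /= (le_trans ap (ltW py)) (le_trans (ltW yq)).
move=> y [C [Cx CP cC] Cy]; case/andP: xpq => px xq; apply/andP; split.
- rewrite ltNge; apply/negP => yp.
  have /CP[] // : C p by apply: (connected_mid cC Cy Cx); apply/andP; split => //; exact: ltW.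
- rewrite ltNge; apply/negP => qy.
  have /CP[] // : C q by apply: (connected_mid cC Cx Cy); apply/andP; split => //; exact: ltW.
Qed.

Lemma basic_intervalsP (a b : \bar R) (P : set (\bar R)) I :
  P `<=` `[a, b] -> closed P -> P a -> P b ->
  basic_intervals a b P I <-> exists p q, gap P p q /\ I = ioo p q.
Proof.
rewrite /basic_intervals set_itvcc => Pab cP Pa Pb; split.
  move=> [x [xab Px] <-].
  have [p [q [g xpq _]]] := gap_around cP Pa Pb xab Px.
  by exists p, q; split => //; apply: gap_component.
move=> [p [q [g ->]]]; have [Pp Pq pq gg] := g.
have [x xpq] := ereal_dense pq; exists x; last exact: gap_component.
split; last exact: gg.
have /andP[ap _] := Pab _ Pp; have /andP[_ qb] := Pab _ Pq.
by case/andP: xpq => py yq; rewrite /icc /= (le_trans ap (ltW py)) (le_trans (ltW yq)).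
Qed.

Lemma within_right (a b : \bar R) (f : \bar R -> \bar R) x B :
  {within icc a b, continuous f} -> a <= x < b -> nbhs (f x) B ->
  exists2 w, x < w <= b & forall z, x <= z < w -> B (f z).
Proof.
move=> /subspace_continuousP cf /andP[ax xb] /cf.
have xab : icc a b x by rewrite /icc /= ax ltW.
move=> /(_ xab) /(nbhs_right xb)[w /andP[xw wb] wB]; exists w; rewrite ?xw//.
move=> z /andP[xz zw]; apply: wB; rewrite ?xz//.
by rewrite /icc /= (le_trans ax xz) (le_trans (ltW zw)).
Qed.

Lemma within_left (a b : \bar R) (f : \bar R -> \bar R) x B :
  {within icc a b, continuous f} -> a < x <= b -> nbhs (f x) B ->
  exists2 w, a <= w < x & forall z, w < z <= x -> B (f z).
Proof.
move=> /subspace_continuousP cf /andP[ax xb] /cf.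
have xab : icc a b x by rewrite /icc /= xb ltW.
move=> /(_ xab) /(nbhs_left ax)[w /andP[aw wx] wB]; exists w; rewrite ?aw//.
move=> z /andP[wz zx]; apply: wB; rewrite ?zx ?andbT//.
by rewrite /icc /= (le_trans zx xb) (le_trans aw (ltW wz)).
Qed.

Lemma ereal_nbhs_gt x t : t < x -> nbhs x [set y | t < y].
Proof. by move=> tx; apply: open_nbhs_nbhs; split => //; exact: open_ereal_gt_ereal. Qed.

Lemma ereal_nbhs_lt x t : x < t -> nbhs x [set y | y < t].
Proof. by move=> tx; apply: open_nbhs_nbhs; split => //; exact: open_ereal_lt_ereal. Qed.

(** Surjectivity forbids jumps: on each side where there is room, a neighbourhood of [psi x]
    contains all values up to some [psi v], and monotonicity does the rest. Used for the conjugacy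
    and for its inverse. *)
Lemma incr_surj_continuous (a b c d : \bar R) (psi : \bar R -> \bar R) :
  {in icc a b &, {homo psi : x y / x < y}} ->
  (forall x, icc a b x -> icc c d (psi x)) ->
  (forall y, icc c d y -> exists2 x, icc a b x & psi x = y) ->
  {within icc a b, continuous psi}.
Proof.
move=> inc im sur; apply/subspace_continuousP => x xab B Bx.
have incE u v : icc a b u -> icc a b v -> psi u < psi v -> u < v.
  move=> uab vab uv; rewrite ltNge le_eqVlt; apply/negP => /orP[/eqP e|vu].
    by rewrite e ltxx in uv.
  by have := lt_trans uv (inc _ _ (mem_set vab) (mem_set uab) vu); rewrite ltxx.
have inc' u v : icc a b u -> icc a b v -> u <= v -> psi u <= psi v.
  move=> uab vab; rewrite le_eqVlt => /orP[/eqP -> //|uv].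
  by rewrite ltW// inc// mem_set.
have Hr : exists2 N : set (\bar R), nbhs x N &
    forall z, N z -> icc a b z -> x <= z -> B (psi z).
  have [xb|bx] := ltP x b; last first.
    exists setT; first exact: filterT.
    move=> z _ /andP[_ zb] xz; suff -> : z = x by exact: nbhs_singleton.
    by apply/eqP; rewrite eq_le xz (le_trans zb bx).
  have bab : icc a b b by case/andP: xab => ax _; rewrite /icc /= lexx (le_trans ax (ltW xb)).
  have pxb : psi x < psi b by apply: inc => //; exact: mem_set.
  have [w /andP[xw wb] wB] := nbhs_right pxb Bx.
  have [|v vab vw] := sur w.
    have /andP[cx _] := im _ xab; have /andP[_ bd] := im _ bab.
    by rewrite /icc /= (le_trans cx (ltW xw)) (le_trans wb bd).
  exists [set z | z < v]; first by apply: ereal_nbhs_lt; apply: incE; rewrite ?vw.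
  move=> z /= zv zab xz; apply: wB; rewrite inc'//= -vw inc// mem_set//.
have Hl : exists2 N : set (\bar R), nbhs x N &
    forall z, N z -> icc a b z -> z <= x -> B (psi z).
  have [xb|bx] := ltP a x; last first.
    exists setT; first exact: filterT.
    move=> z _ /andP[zb _] xz; suff -> : z = x by exact: nbhs_singleton.
    by apply/eqP; rewrite eq_le xz (le_trans bx zb).
  have bab : icc a b a by case/andP: xab => _ ax; rewrite /icc /= lexx (le_trans (ltW xb) ax).
  have pxb : psi a < psi x by apply: inc => //; exact: mem_set.
  have [w /andP[xw wb] wB] := nbhs_left pxb Bx.
  have [|v vab vw] := sur w.
    have /andP[_ cx] := im _ xab; have /andP[bd _] := im _ bab.
    by rewrite /icc /= (le_trans (ltW wb) cx) (le_trans bd xw).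
  exists [set z | v < z]; first by apply: ereal_nbhs_gt; apply: incE; rewrite ?vw.
  move=> z /= zv zab xz; apply: wB; rewrite inc' ?andbT//= -vw inc// mem_set//.
case: Hr Hl => N1 n1 H1 [N2 n2 H2].
apply: filterS (filterI n1 n2) => z [/H1 h1 /H2 h2] zab /=.
by have [/h2|/ltW/h1] := leP z x; apply.
Qed.

End ereal_topology.

(** * Mixing maps and their basic intervals *)

Section mixing_maps.
Context {R : realType} {a b : \bar R} {f : \bar R -> \bar R} {P : set (\bar R)}.
Hypothesis hf : cpmm a b f P.
Hypothesis hmix : topologically_mixing `[a, b] f.
Implicit Types (x y z t p q u w : \bar R) (A B I J : set (\bar R)).
Local Open Scope ereal_scope.

Lemma icc_ioo u w x y : icc u w x -> icc u w y -> ioo x y `<=` icc u w.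
Proof.
move=> /andP[ux _] /andP[_ yw] z /andP[xz zy].
by rewrite /icc /= (le_trans ux (ltW xz)) (le_trans (ltW zy) yw).
Qed.

Lemma icc_iccW u w x y : icc u w x -> icc u w y -> icc x y `<=` icc u w.
Proof.
move=> /andP[ux _] /andP[_ yw] z /andP[xz zy].
by rewrite /icc /= (le_trans ux xz) (le_trans zy yw).
Qed.

Lemma cpmm_icc x : icc a b x -> icc a b (f x).
Proof. by have := cpmm_fun hf; rewrite set_itvcc; apply. Qed.

Lemma cpmm_iter_icc n x : icc a b x -> icc a b (iter n f x).
Proof. by move=> xab; elim: n => //= n; apply: cpmm_icc. Qed.

Lemma cpmm_within : {within icc a b, continuous f}.
Proof. by have := cpmm_continuous hf; rewrite set_itvcc. Qed.

Lemma cpmm_P_icc x : P x -> icc a b x.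
Proof. by move/(cpmm_sub hf); rewrite set_itvcc. Qed.

Lemma cpmm_P x : P x -> P (f x).
Proof. by move=> Px; apply: (cpmm_markov hf); exists x. Qed.

Lemma cpmm_P_iter n x : P x -> P (iter n f x).
Proof. by move=> Px; elim: n => //= n; apply: cpmm_P. Qed.

Lemma icc_a : icc a b a.
Proof. exact: cpmm_P_icc (cpmm_left hf). Qed.

Lemma icc_b : icc a b b.
Proof. exact: cpmm_P_icc (cpmm_right hf). Qed.

Lemma ioo_icc x : ioo a b x -> icc a b x.
Proof. exact: icc_ioo icc_a icc_b x. Qed.

Lemma image_iter_connected n A : A `<=` icc a b -> connected A ->
  connected (iter n f @` A).
Proof.
move=> Aab cA; elim: n => [|n IH] /=; first by rewrite image_id.
rewrite (_ : _ @` _ = f @` (iter n f @` A)); last by rewrite -image_comp.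
apply: connected_continuous_connected => //.
apply: continuous_subspaceW cpmm_within => _ [z Az <-].
exact/cpmm_iter_icc/Aab.
Qed.

Lemma mixing_ioo x y u w : icc a b x -> icc a b y -> x < y ->
  icc a b u -> icc a b w -> u < w ->
  exists n0, forall n, (n0 <= n)%N -> exists2 z, ioo x y z & ioo u w (iter n f z).
Proof.
move=> xab yab xy uab wab uw.
have nonempty p q : icc a b p -> icc a b q -> p < q -> ioo p q `&` `[a, b] !=set0.
  move=> pab qab pq; have [z zpq] := ereal_dense pq; exists z; split => //.
  by rewrite set_itvcc; exact: icc_ioo zpq.
have [n0 n0P] := hmix (@ioo_open R x y) (@ioo_open R u w)
  (nonempty _ _ xab yab xy) (nonempty _ _ uab wab uw).
exists n0 => n /n0P [_ [[z [zxy _] <-] [uwz _]]].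
by exists z.
Qed.

(** Two applications of mixing put points of the image on either side of [[u, w]], in []a, u[] and
    in []w, b[], and the image is connected. *)
Lemma mixing_cover x y u w : icc a b x -> icc a b y -> x < y ->
  a < u -> u <= w -> w < b ->
  exists n0, forall n, (n0 <= n)%N -> forall t, u <= t <= w ->
  exists2 z, ioo x y z & iter n f z = t.
Proof.
move=> xab yab xy au uw wb.
have uab : icc a b u by rewrite /icc /= (ltW au) (le_trans uw (ltW wb)).
have wab : icc a b w by rewrite /icc /= (ltW wb) (le_trans (ltW au) uw).
have [n1 n1P] := mixing_ioo xab yab xy icc_a uab au.
have [n2 n2P] := mixing_ioo xab yab xy wab icc_b wb.
exists (maxn n1 n2) => n; rewrite geq_max.
move=> /andP[/n1P[z1 z1xy /andP[_ z1u]] /n2P[z2 z2xy /andP[wz2 _]]] t /andP[ut tw].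
have cA : connected (iter n f @` ioo x y).
  by apply: image_iter_connected; [exact: icc_ioo|exact: ioo_connected].
suff [z] : (iter n f @` ioo x y) t by exists z.
apply: (connected_mid cA (x := iter n f z1) (y := iter n f z2)).
- by exists z1.
- by exists z2.
- by rewrite (le_trans (ltW z1u) ut) (le_trans tw (ltW wz2)).
Qed.

(** Were [f] constant here, each later image would be a single point, while mixing makes it meet
    both []a, t[] and []t, b[]. *)
Lemma mixing_not_const x y k : icc a b x -> icc a b y -> x < y ->
  ~ (forall z, ioo x y z -> f z = k).
Proof.
move=> xab yab xy fk.
have [t /andP[at_ tb]] := ereal_dense (cpmm_lt hf).
have tab : icc a b t by apply: ioo_icc; rewrite /ioo /= at_.
have [n1 n1P] := mixing_ioo xab yab xy icc_a tab at_.
have [n2 n2P] := mixing_ioo xab yab xy tab icc_b tb.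
have [|z1 /fk z1E] := n1P (maxn n1 n2).+1; first by rewrite leqW// leq_maxl.
have [|z2 /fk z2E] := n2P (maxn n1 n2).+1; first by rewrite leqW// leq_maxr.
rewrite !iterSr z1E z2E => /andP[+ _] /andP[_].
by move=> h1 h2; have := lt_trans h1 h2; rewrite ltxx.
Qed.

(* Only the second iterate is used because f may exchange the two sides of a point. *)
Lemma mixing_inv2 (S : set (\bar R)) x y u w :
  (forall z, icc a b z -> S z -> S (f (f z))) ->
  icc a b x -> icc a b y -> x < y -> ioo x y `<=` S ->
  icc a b u -> icc a b w -> u < w -> ioo u w `<=` ~` S -> False.
Proof.
move=> inv xab yab xy xyS uab wab uw uwS.
have [n nP] := mixing_ioo xab yab xy uab wab uw.
have [|z zxy /uwS] := nP n.*2; first by rewrite -addnn leq_addr.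
apply.
have zab : icc a b z by exact: icc_ioo zxy.
elim: n {nP} => [|n IH]; first exact: xyS.
by rewrite doubleS /=; apply: inv => //; exact: cpmm_iter_icc.
Qed.

Lemma mono_closure (g : \bar R -> \bar R) p q : {within icc p q, continuous g} ->
  (forall x y, ioo p q x -> ioo p q y -> x <= y -> g x <= g y) ->
  forall x y, p <= x -> x <= y -> y <= q -> g x <= g y.
Proof.
move=> cg mg.
have left_ y : ioo p q y -> g p <= g y.
  move=> /andP[py yq]; rewrite leNgt; apply/negP => h.
  have [|w /andP[pw wq] wB] := within_right (x := p) cg _ (ereal_nbhs_gt h).
    by rewrite lexx (lt_trans py yq).
  have [z /andP[pz]] : exists z, p < z < Order.min w y.
    by apply: ereal_dense; rewrite lt_min pw py.
  rewrite lt_min => /andP[zw zy].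
  have /= := wB z; rewrite (ltW pz) zw => /(_ isT); rewrite ltNge mg ?ltW//.
    by rewrite /ioo /= pz (lt_trans zy yq).
  by rewrite /ioo /= py.
have right_ y : ioo p q y -> g y <= g q.
  move=> /andP[py yq]; rewrite leNgt; apply/negP => h.
  have [|w /andP[pw wq] wB] := within_left (x := q) cg _ (ereal_nbhs_lt h).
    by rewrite lexx (lt_trans py yq).
  have [z /andP[]] : exists z, Order.max w y < z < q.
    by apply: ereal_dense; rewrite gt_max wq yq.
  rewrite gt_max => /andP[wz yz] zq.
  have /= := wB z; rewrite (ltW zq) wz => /(_ isT); rewrite ltNge mg ?ltW//.
    by rewrite /ioo /= py.
  by rewrite /ioo /= zq (lt_trans py yz).
move=> x y px xy yq.
have [->//|nxy] := eqVneq x y.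
have {nxy}xy : x < y by rewrite lt_neqAle nxy.
have [<-|np] := eqVneq p x.
  have [->|nq] := eqVneq y q; last by apply: left_; rewrite /ioo /= (le_lt_trans px xy) lt_neqAle nq.
  have pq : p < q by rewrite (le_lt_trans px) ?(lt_le_trans xy).
  have [z zpq] := ereal_dense pq.
  by rewrite (le_trans (left_ _ zpq)) ?right_.
have {np} px' : p < x by rewrite lt_neqAle np.
have [->|nq] := eqVneq y q; first by apply: right_; rewrite /ioo /= px' (lt_le_trans xy).
have yq' : y < q by rewrite lt_neqAle nq.
by apply: mg; rewrite /ioo /= ?px' ?yq' ?(lt_trans xy)// ?(lt_trans px')// ltW.
Qed.

Lemma gap_icc p q : gap P p q -> icc a b p /\ icc a b q.
Proof. by case=> Pp Pq _ _; split; exact: cpmm_P_icc. Qed.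

Lemma gap_basic p q : gap P p q -> basic_intervals a b P (ioo p q).
Proof.
move=> g; apply/(basic_intervalsP (ioo p q) (cpmm_sub hf) (cpmm_closed hf) (cpmm_left hf) (cpmm_right hf)).
by exists p, q.
Qed.

Lemma basic_gap I : basic_intervals a b P I -> exists p q, gap P p q /\ I = ioo p q.
Proof.
by move/(basic_intervalsP I (cpmm_sub hf) (cpmm_closed hf) (cpmm_left hf) (cpmm_right hf)).
Qed.

(** Mixing rules out intervals of constancy, so monotone means strictly monotone; continuity adds
    the two endpoints. The boolean is true when [f] increases. *)
Lemma gap_mono p q : gap P p q -> exists s : bool,
  forall x y, p <= x -> x < y -> y <= q -> if s then f x < f y else f y < f x.
Proof.
move=> g; have [pab qab] := gap_icc g.
have cf : {within icc p q, continuous f}.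
  by apply: continuous_subspaceW cpmm_within; exact: icc_iccW.
have strict x y : p <= x -> x < y -> y <= q ->
    ~ (forall z, x <= z -> z <= y -> f z = f x).
  move=> px xy yq h; have /andP[ap _] := pab; have /andP[_ qb] := qab.
  apply: (@mixing_not_const x y (f x)) => //.
  - by apply: (icc_iccW pab qab); rewrite /icc /= px (le_trans (ltW xy) yq).
  - by apply: (icc_iccW pab qab); rewrite /icc /= yq (le_trans px (ltW xy)).
  - by move=> z /andP[xz zy]; apply: h; exact: ltW.
have [mono|mono] := cpmm_monotone hf (gap_basic g).
- have h := mono_closure cf mono.
  exists true => x y px xy yq; rewrite lt_neqAle h ?(ltW xy)// ?andbT.
  apply/eqP => e; apply: (strict x y) => // z xz zy.
  by apply/eqP; rewrite eq_le {1}e !h// ?(le_trans px xz)// (le_trans zy yq).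
- have cg : {within icc p q, continuous (fun x => - f x)}.
    by move=> x; apply: continuous_comp; [exact: cf|exact: oppe_continuous].
  have h' : forall x y, p <= x -> x <= y -> y <= q -> - f x <= - f y.
    by apply: (mono_closure cg) => x y xpq ypq xy; rewrite leeN2; exact: mono.
  have h x y : p <= x -> x <= y -> y <= q -> f y <= f x.
    by move=> px xy yq; rewrite -leeN2 h'.
  exists false => x y px xy yq; rewrite lt_neqAle h ?(ltW xy)// ?andbT.
  apply/eqP => e; apply: (strict x y) => // z xz zy.
  apply/eqP; rewrite eq_le h//; last exact: le_trans yq.
  by rewrite -e h// (le_trans px).
Qed.

Lemma gap_inj p q x y : gap P p q -> p <= x <= q -> p <= y <= q -> f x = f y -> x = y.
Proof.
move=> /gap_mono[s h] /andP[px xq] /andP[py yq] e.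
case: (ltgtP x y) => // xy.
- by have := h _ _ px xy yq; rewrite e; case: s {h}; rewrite ltxx.
- by have := h _ _ py xy xq; rewrite e; case: s {h}; rewrite ltxx.
Qed.

Lemma gap_image p q u w : gap P p q -> p <= u -> u < w -> w <= q ->
  f @` ioo u w = ioo (Order.min (f u) (f w)) (Order.max (f u) (f w)).
Proof.
move=> g pu uw wq; have [pab qab] := gap_icc g; have [s h] := gap_mono g.
apply/seteqP; split => [_ [z /andP[uz zw] <-]|t].
  have := h _ _ pu uz (le_trans (ltW zw) wq).
  have := h _ _ (le_trans pu (ltW uz)) zw wq.
  by rewrite /ioo /= lt_max gt_min; case: s {h} => -> ->; rewrite ?orbT.
rewrite /ioo /= => /andP[lt_ tl].
have [z /andP[uz zw] zt] : exists2 z, u <= z <= w & f z = t.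
  have /andP[au _] : icc a b u by apply: (icc_iccW pab qab); rewrite /icc /= pu (le_trans (ltW uw)).
  have /andP[_ wb] : icc a b w by apply: (icc_iccW pab qab); rewrite /icc /= wq (le_trans pu (ltW uw)).
  apply: (ereal_ivt (cpmm_continuous hf)) => //; first exact: ltW.
  by move: lt_ tl; case: (leP (f u) (f w)) => _ h1 h2; rewrite (ltW h1) (ltW h2) ?orbT.
exists z => //; rewrite /ioo /=; move: lt_ tl; rewrite -zt.
by case: (leP (f u) (f w)) => _ h1 h2; rewrite !lt_neqAle uz zw !andbT; apply/andP; split;
  apply: contraTneq isT => e; move: h1 h2; rewrite e ltxx.
Qed.

Lemma basic_in x : icc a b x -> ~ P x -> exists2 I, basic_intervals a b P I & I x.
Proof.
move=> xab Px; have [p [q [g xpq _]]] := gap_around (cpmm_closed hf) (cpmm_left hf) (cpmm_right hf) xab Px.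
by exists (ioo p q) => //; exact: gap_basic.
Qed.

(** Neither [e] nor [e'] can lie inside []p, q[]. In this form the Markov structure enters most
    arguments below: an interval with ends in [P] cannot cut a basic interval. *)
Lemma gap_sat p q e e' x : gap P p q -> P e -> P e' -> ioo p q x -> ioo e e' x ->
  e <= p /\ q <= e'.
Proof.
move=> [Pp Pq pq g] Pe Pe' /andP[px xq] /andP[ex xe'].
split; rewrite leNgt; apply/negP => h.
- by apply: (g e) => //; rewrite h (lt_trans ex xq).
- by apply: (g e') => //; rewrite h (lt_trans px xe').
Qed.

Lemma basic_disj I J x : basic_intervals a b P I -> basic_intervals a b P J ->
  I x -> J x -> I = J.
Proof.
move=> /basic_gap[p [q [g ->]]] /basic_gap[p' [q' [g' ->]]] Ix Jx.
have [Pp Pq _ _] := g; have [Pp' Pq' _ _] := g'.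
have [h1 h2] := gap_sat g Pp' Pq' Ix Jx; have [h3 h4] := gap_sat g' Pp Pq Jx Ix.
by rewrite (@le_anti _ _ p p') ?h1 ?h3// (@le_anti _ _ q q') ?h2 ?h4.
Qed.

Lemma basic_icc I x : basic_intervals a b P I -> I x -> icc a b x.
Proof.
move=> /basic_gap[p [q [g ->]]]; have [pab qab] := gap_icc g; exact: icc_ioo.
Qed.

Lemma basic_notP I x : basic_intervals a b P I -> I x -> ~ P x.
Proof. by move=> /basic_gap[p [q [[_ _ _ g] ->]]] /g. Qed.

Lemma basic_nonempty I : basic_intervals a b P I -> I !=set0.
Proof. by move=> /basic_gap[p [q [[_ _ pq g] ->]]]; have [x] := ereal_dense pq; exists x. Qed.

Lemma basic_inj I x y : basic_intervals a b P I -> I x -> I y -> f x = f y -> x = y.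
Proof.
move=> /basic_gap[p [q [g ->]]] /andP[/ltW px /ltW xq] /andP[/ltW py /ltW yq].
by apply: (gap_inj g); rewrite ?px ?py.
Qed.

(** The image of [I] is an open interval whose ends are images of points of [P], hence in [P]: it
    cannot cut [J]. *)
Lemma basic_image_sat I J x : basic_intervals a b P I -> basic_intervals a b P J ->
  I x -> J (f x) -> J `<=` f @` I.
Proof.
move=> /basic_gap[p [q [g ->]]] /basic_gap[p' [q' [g' ->]]] Ix Jfx.
have [Pp Pq pq _] := g; have [Pp' Pq' _ _] := g'.
have : (f @` ioo p q) (f x) by exists x.
rewrite (gap_image g) ?lexx// => h.
have Pmin : P (Order.min (f p) (f q)) by case: leP => _; exact: cpmm_P.
have Pmax : P (Order.max (f p) (f q)) by case: leP => _; exact: cpmm_P.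
have [h1 h2] := gap_sat g' Pmin Pmax Jfx h.
by move=> y /andP[p'y yq']; rewrite /ioo /= (le_lt_trans h1 p'y) (lt_le_trans yq' h2).
Qed.

(** Otherwise [f] is strictly monotone on the whole of [[a, b]], so its second iterate is increasing
    and leaves one side of any interior point invariant, against mixing. *)
Lemma P_interior : exists2 p, P p & a < p < b.
Proof.
apply: contrapT => nP.
have g : gap P a b.
  split; [exact: cpmm_left hf|exact: cpmm_right hf|exact: cpmm_lt hf|].
  by move=> x xab Px; apply: nP; exists x.
have [s h] := gap_mono g.
have ff x y : icc a b x -> icc a b y -> x <= y -> f (f x) <= f (f y).
  move=> xab yab; rewrite le_eqVlt => /orP[/eqP -> //|xy].
  have /andP[ax _] := xab; have /andP[_ yb] := yab.
  have /andP[afx fxb] := cpmm_icc xab; have /andP[afy fyb] := cpmm_icc yab.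
  have := h _ _ ax xy yb.
  by case: s h => h /h => [/(_ afx fyb)|/(_ afy fxb)] /ltW.
have [t tab] := ereal_dense (cpmm_lt hf).
have tab' := ioo_icc tab; case/andP: tab => at_ tb.
have [ht|/ltW ht] := leP t (f (f t)).
- apply: (@mixing_inv2 (icc t b) t b a t) => //; try exact: icc_a; try exact: icc_b.
  + move=> z zab /andP[tz zb]; rewrite /icc /= (le_trans ht) ?ff//.
    by have /andP[_ ->] := cpmm_iter_icc 2 zab.
  + by apply: icc_ioo; rewrite /icc /= lexx ?(ltW tb) ?(ltW at_).
  + by move=> z /andP[_ zt] /andP[tz _]; have := lt_le_trans zt tz; rewrite ltxx.
- apply: (@mixing_inv2 (icc a t) a t t b) => //; try exact: icc_a; try exact: icc_b.
  + move=> z zab /andP[az zt]; rewrite /icc /= (le_trans _ ht) ?ff// andbT.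
    by have /andP[-> _] := cpmm_iter_icc 2 zab.
  + by apply: icc_ioo; rewrite /icc /= lexx ?(ltW tb) ?(ltW at_).
  + by move=> z /andP[tz _] /andP[_ zt]; have := lt_le_trans tz zt; rewrite ltxx.
Qed.

(** A countable set is Lebesgue null, and an interval is not. *)
Lemma P_nowhere x y : x < y -> exists2 z, ioo x y z & ~ P z.
Proof.
move=> xy; apply: contrapT => nz.
have [z1 /andP[xz1 z1y]] := ereal_dense xy.
have [z2 /andP[z12 z2y]] := ereal_dense z1y.
have z1E : z1 = (fine z1)%:E by rewrite fineK// (fin_between xz1 z1y).
have z2E : z2 = (fine z2)%:E by rewrite fineK// (fin_between z12 z2y).
have cP : countable [set r | P r%:E].
  apply: (@sub_countable _ _ _ P _ (cpmm_countable hf)).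
  apply: (card_le_trans _ (card_image_le (@fine R) P)).
  by apply: subset_card_le => r Pr; exists r%:E.
have : (lebesgue_measure (`]fine z1, fine z2[%classic : set R) <= lebesgue_measure [set r | P r%:E])%E.
  apply: le_measure; rewrite ?inE//.
    by apply: countable_measurable => // t; exact: measurable_set1.
  move=> r /=; rewrite in_itv /= => /andP[rz1 rz2]; apply: contrapT => Pr; apply: nz.
  exists r%:E => //; rewrite /ioo /= (lt_trans xz1) ?(lt_trans _ z2y)//.
    by rewrite z2E lte_fin.
  by rewrite z1E lte_fin.
rewrite (countable_lebesgue_measure0 cP) => h.
have eJ := @lebesgue_measure_itv R (Interval (BRight (fine z1)) (BLeft (fine z2))).
have : (fine z2)%:E - (fine z1)%:E <= 0.
  suff -> : (fine z2)%:E - (fine z1)%:E =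
      lebesgue_measure [set` Interval (BRight (fine z1)) (BLeft (fine z2))] by exact: h.
  by rewrite eJ /= lte_fin -lte_fin -z1E -z2E z12.
rewrite -EFinB lee_fin subr_le0 => {}h.
by move: z12; rewrite z1E z2E lte_fin ltNge h.
Qed.

Lemma Piter_dense x y : icc a b x -> icc a b y -> x < y ->
  exists2 z, ioo x y z & exists n, P (iter n f z).
Proof.
move=> xab yab xy; have [p Pp /andP[ap pb]] := P_interior.
have [n /(_ n (leqnn _) p)[|z zxy zp]] := mixing_cover xab yab xy ap (lexx p) pb.
  by rewrite lexx.
by exists z => //; exists n; rewrite zp.
Qed.

(** A late iterate sends some point of the interval to a point [e] outside [P]; since [P] is forward
    invariant, the orbit was outside [P] at time [n] as well. *)
Lemma Piter_nowhere n x y : icc a b x -> icc a b y -> x < y ->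
  exists2 z, ioo x y z & ~ P (iter n f z).
Proof.
move=> xab yab xy.
have [e eP] := P_nowhere (cpmm_lt hf); move=> Pe.
have [N NP] := mixing_cover xab yab xy (proj1 (andP eP)) (lexx e) (proj2 (andP eP)).
have [|z zxy zE] := NP (maxn n N) (leq_maxr _ _) e; first by rewrite lexx.
exists z => // /(cpmm_P_iter (maxn n N - n)).
by rewrite -iterD subnK ?leq_maxl// zE.
Qed.

End mixing_maps.

(** * The mass defined by an eigenvector *)

Section esum_complements.
Context {R : realType} {T : choiceType}.
Implicit Types (D : set T) (F : T -> \bar R).
Local Open Scope ereal_scope.

Lemma esum_le_seq D F y :
  (forall s : seq T, uniq s -> (forall i, i \in s -> D i) -> \sum_(i <- s) F i <= y) ->
  \esum_(i in D) F i <= y.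
Proof.
move=> h; apply: ge_ereal_sup => _ [X [finX XD] <-].
rewrite fsbig_finite//; apply: h; first exact: finmap.fset_uniq.
by move=> i; rewrite in_fset_set// inE => /XD.
Qed.

Lemma esum_single D F i : D i -> 0 <= F i -> (forall j, D j -> j <> i -> F j = 0) ->
  \esum_(j in D) F j = F i.
Proof.
move=> Di Fi0 F0.
rewrite -(esum_set1 Fi0) (esum_mkcond D) (esum_mkcond [set i]).
apply: eq_esum => j _; case: ifPn; rewrite ?inE => Dj; case: ifPn; rewrite ?inE//= => ji.
  by apply: F0 => // e; move: ji; rewrite e mem_set.
by move: Dj; rewrite ji mem_set.
Qed.

Lemma ge0_esumZl D F (r : R) : (0 <= r)%R -> (forall i, D i -> 0 <= F i) ->
  \esum_(i in D) (r%:E * F i) = r%:E * \esum_(i in D) F i.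
Proof.
move=> r0 F0; rewrite /esum -ereal_supZl//; last first.
  by apply/set0P; exists (\sum_(x \in set0) F x); exists set0 => //; exact: fsets_set0.
congr ereal_sup; apply/seteqP.
have e X : finite_set X -> X `<=` D -> r%:E * (\sum_(x \in X) F x) = \sum_(x \in X) (r%:E * F x).
  move=> fX XD; rewrite !fsbig_finite//= big_seq [in RHS]big_seq ge0_sume_distrr// => i.
  by rewrite in_fset_set// inE => /XD; exact: F0.
split => [_ [X [fX XD] <-]|_ [_ [X [fX XD] <-] <-]].
  by exists (\sum_(x \in X) F x); [exists X|exact: e].
by exists X => //; rewrite e.
Qed.

Lemma esum_ge_term D F i : (forall j, D j -> 0 <= F j) -> D i -> F i <= \esum_(j in D) F j.
Proof.
move=> F0 Di; apply: esum_ge; exists [set i].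
  by split; [exact: finite_set1|move=> _ ->].
by rewrite fsbig_set1.
Qed.

End esum_complements.

(** * The levels of the mass and their limit *)

Section mass.
Context {R : realType} {a b : \bar R} {f : \bar R -> \bar R} {P : set (\bar R)}.
Hypothesis hf : cpmm a b f P.
Hypothesis hmix : topologically_mixing `[a, b] f.
Variables (lam : R) (v : set (\bar R) -> R).
Hypothesis hlam : (1 < lam)%R.
Hypothesis hv : nonneg_eigenvector a b f P lam v.
Implicit Types (x y z t p q u w : \bar R) (A I J : set (\bar R)).
Local Open Scope ereal_scope.
Local Notation B := (basic_intervals a b P).

Let lam0 : (0 < lam)%R. Proof. exact: lt_trans hlam. Qed.
Let lamV0 : (0 <= lam^-1)%R. Proof. by rewrite invr_ge0 ltW. Qed.

Let v0 I : B I -> (0 <= v I)%R.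
Proof. by case: hv => h _ _; exact: h. Qed.

(* [lmass n A] is lam^-n times the total weight of the basic intervals J, counted
   once for each branch of f^n that maps a subinterval of A onto J. *)
Fixpoint lmass n A : \bar R :=
  if n is n'.+1 then lam^-1%:E * \esum_(I in B) lmass n' (f @` (A `&` I))
  else \esum_(I in B) (if `[< I `<=` A >] then (v I)%:E else 0).

(** The levels are nondecreasing in [n] by [lmassS], so this supremum is their limit. *)
Definition mass A : \bar R := ereal_sup (range (lmass^~ A)).

Lemma lmass_ge0 n A : 0 <= lmass n A.
Proof.
elim: n A => [|n IH] A /=.
  by apply: esum_ge0 => I BI; case: ifPn => // _; rewrite lee_fin v0.
by rewrite mule_ge0 ?lee_fin//; apply: esum_ge0.
Qed.
Local Hint Resolve lmass_ge0 : core.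

Lemma lmass_set0 n : lmass n set0 = 0.
Proof.
elim: n => [|n IH] /=.
  apply: esum1 => I BI; case: ifPn => // /asboolP I0.
  by have [x /I0] := basic_nonempty hf BI.
by rewrite esum1 ?mule0// => I BI; rewrite set0I image_set0.
Qed.

Lemma le_lmass n A A' : A `<=` A' -> lmass n A <= lmass n A'.
Proof.
elim: n A A' => [|n IH] A A' AA' /=.
  apply: le_esum => I BI; case: ifPn => [/asboolP h|_].
    by rewrite ifT//; apply/asboolP; exact: subset_trans AA'.
  by case: ifPn => // _; rewrite lee_fin v0.
apply: lee_wpmul2l; first by rewrite lee_fin.
by apply: le_esum => I BI; apply: IH; apply: image_subset; exact: setSI.
Qed.

Lemma lmass_step n I A : B I -> A `<=` I -> lmass n.+1 A = lam^-1%:E * lmass n (f @` A).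
Proof.
move=> BI AI /=; congr (_ * _); rewrite (esum_single (i := I))//.
  by congr (lmass n (f @` _)); apply/setIidPl.
move=> J BJ JI; rewrite (_ : A `&` J = set0) ?image_set0 ?lmass_set0//.
apply/seteqP; split => // x [/AI Ix Jx]; apply: JI.
exact: (basic_disj hf BJ BI Jx Ix).
Qed.

Lemma lmass0_basic I : B I -> lmass 0 I = (v I)%:E.
Proof.
move=> BI /=; rewrite (esum_single (i := I))//; first by rewrite ifT//; exact/asboolP.
- by case: ifPn => // _; rewrite lee_fin v0.
- move=> J BJ JI; case: ifPn => // /asboolP h; have [x Jx] := basic_nonempty hf BJ.
  by case: JI; exact: (basic_disj hf BJ BI Jx (h _ Jx)).
Qed.

Lemma lmass_decomp n A : lmass n A = \esum_(I in B) lmass n (A `&` I).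
Proof.
case: n => [|n].
  rewrite {1}/lmass; apply: eq_esum => I BI.
  case: ifPn => [/asboolP h|/asboolP h].
    by rewrite (_ : A `&` I = I) ?lmass0_basic//; apply/setIidPr.
  rewrite /= esum1// => J BJ; case: ifPn => // /asboolP hJ.
  have [x Jx] := basic_nonempty hf BJ; have [_ Ix] := hJ _ Jx.
  by case: h; rewrite -(basic_disj hf BJ BI Jx Ix); move=> y /hJ[].
rewrite {1}[lmass]lock /= -lock /= -ge0_esumZl//.
apply: eq_esum => I BI; exact: (esym (lmass_step n BI (@subIsetr _ A I))).
Qed.

(** By the Markov property the image of [J] contains a basic interval or misses it, so one more
    level amounts to one use of the eigenvalue equation. *)
Lemma lmass_basic n J : B J -> lmass n J = (v J)%:E.
Proof.
elim: n J => [|n IH] J BJ; first exact: lmass0_basic.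
rewrite (lmass_step n BJ)// lmass_decomp.
transitivity (lam^-1%:E * (lam * v J)%:E); last first.
  by rewrite -EFinM mulrA mulVf ?mul1r// gt_eqF.
have [_ _ <-] := hv => //; congr (_ * _); apply: eq_esum => I BI.
rewrite /transition_matrix; case: ifPn => [/asboolP h|/asboolP h].
  by rewrite mul1r (_ : _ `&` I = I) ?IH//; exact/setIidPr.
rewrite mul0r (_ : _ `&` I = set0) ?lmass_set0//.
apply/seteqP; split => // _ [[x Jx <-] Ifx]; apply: h.
exact: (basic_image_sat hf hmix BJ BI Jx Ifx).
Qed.

Lemma lmassS n A : lmass n A <= lmass n.+1 A.
Proof.
elim: n A => [|n IH] A.
  rewrite (lmass_decomp 1); apply: le_esum => I BI.
  case: ifPn => [/asboolP h|_]; last exact: lmass_ge0.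
  by rewrite (_ : A `&` I = I) ?lmass_basic//; exact/setIidPr.
rewrite /=; apply: lee_wpmul2l; first by rewrite lee_fin.
by apply: le_esum => I BI; exact: IH.
Qed.

Lemma lmass_nd A : nondecreasing_seq (lmass^~ A).
Proof. by apply/nondecreasing_seqP => n; exact: lmassS. Qed.

Lemma le_lmass_mass n A : lmass n A <= mass A.
Proof. by apply: ereal_sup_ubound; exists n. Qed.

Lemma mass_le A y : (forall n, lmass n A <= y) -> mass A <= y.
Proof. by move=> h; apply: ge_ereal_sup => _ [n _ <-]. Qed.

Lemma mass_ge0 A : 0 <= mass A.
Proof. by apply: le_trans (le_lmass_mass 0 A); exact: lmass_ge0. Qed.

Lemma mass_set0 : mass set0 = 0.
Proof.
apply/eqP; rewrite eq_le mass_ge0 andbT; apply: mass_le => n.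
by rewrite lmass_set0.
Qed.

Lemma le_mass A A' : A `<=` A' -> mass A <= mass A'.
Proof.
move=> AA'; apply: mass_le => n; apply: le_trans (le_lmass_mass n A').
exact: le_lmass.
Qed.

Lemma mass_basic J : B J -> mass J = (v J)%:E.
Proof.
move=> BJ; apply/eqP; rewrite eq_le; apply/andP; split.
  by apply: mass_le => n; rewrite lmass_basic.
by rewrite -(lmass_basic 0 BJ) le_lmass_mass.
Qed.

(** On a subset of a basic interval [lmass_step] is exact; the shift of level in it disappears in
    the supremum, by [lmassS]. *)
Lemma mass_image I A : B I -> A `<=` I -> mass (f @` A) = lam%:E * mass A.
Proof.
move=> BI AI; apply/eqP; rewrite eq_le; apply/andP; split.
  apply: mass_le => n; rewrite -lee_pdivrMl// -(lmass_step n BI AI).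
  exact: le_lmass_mass.
rewrite -lee_pdivlMl//; apply: mass_le => n; apply: le_trans (lmassS n A) _.
rewrite (lmass_step n BI AI); apply: lee_wpmul2l; first by rewrite lee_fin.
exact: le_lmass_mass.
Qed.

(** A basic interval cut between [A1] and [A2] may count for [A] alone, so only an inequality holds
    level by level. Disjointness survives a step because [f] is injective on each basic interval. *)
Lemma lmass_super n A1 A2 A : A1 `<=` A -> A2 `<=` A -> A1 `&` A2 = set0 ->
  lmass n A1 + lmass n A2 <= lmass n A.
Proof.
elim: n A1 A2 A => [|n IH] A1 A2 A A1A A2A A12.
  rewrite /= -esumD; last 2 first.
  - by move=> I BI; case: ifPn => // _; rewrite lee_fin v0.
  - by move=> I BI; case: ifPn => // _; rewrite lee_fin v0.
  apply: le_esum => I BI.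
  have [h1|h1] := pselect (I `<=` A1).
    rewrite (asboolT h1) asboolF ?adde0 ?asboolT//; first exact: subset_trans A1A.
    move=> h2; have [x Ix] := basic_nonempty hf BI.
    have : (A1 `&` A2) x by split; [exact: h1|exact: h2].
    by rewrite A12.
  rewrite (asboolF h1) add0e; have [h2|h2] := pselect (I `<=` A2).
    by rewrite !asboolT//; exact: subset_trans A2A.
  by rewrite (asboolF h2); case: ifPn => // _; rewrite lee_fin v0.
rewrite /= -muleDr//; last by apply: ge0_adde_def; rewrite inE esum_ge0.
apply: lee_wpmul2l; first by rewrite lee_fin.
rewrite -esumD//; apply: le_esum => I BI; apply: IH.
- by apply: image_subset; exact: setSI.
- by apply: image_subset; exact: setSI.
- apply/seteqP; split => // _ [[x [A1x Ix] <-] [y [A2y Iy] /(basic_inj hf hmix BI)]] e.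
  have : (A1 `&` A2) x by split => //; rewrite -e.
  by rewrite A12.
Qed.

Lemma mass_super A1 A2 A : A1 `<=` A -> A2 `<=` A -> A1 `&` A2 = set0 ->
  mass A1 + mass A2 <= mass A.
Proof.
move=> A1A A2A A12.
have c A' : lmass^~ A' @ \oo --> mass A' := ereal_nondecreasing_cvgn (lmass_nd A').
have c12 : (fun n => lmass n A1 + lmass n A2) @ \oo --> mass A1 + mass A2.
  apply: cvgeD => //; apply: ge0_adde_def; rewrite inE; exact: mass_ge0.
apply: (cvge_le _ c12).
apply: nearW => n; apply: le_trans (le_lmass_mass n A); exact: lmass_super.
Qed.

Lemma mass_super_seq A (s : seq (set (\bar R))) :
  uniq s -> (forall I, I \in s -> B I) ->
  \sum_(I <- s) mass (A `&` I) <= mass (A `&` \bigcup_(I in [set` s]) I).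
Proof.
elim: s => [|I s IH]; first by rewrite big_nil mass_ge0.
move=> /= /andP[Is us] sB; rewrite big_cons.
have sB' i : i \in s -> B i by move=> is_; apply: sB; rewrite in_cons is_ orbT.
have {}IH := IH us sB'.
apply: le_trans (leeD2l _ IH) _; apply: mass_super.
- by apply: setIS => x Ix; exists I => //=; rewrite mem_head.
- by apply: setIS => x [J /= Js Jx]; exists J => //=; rewrite in_cons Js orbT.
- apply/seteqP; split => // x [[_ Ix] [_ [J /= Js Jx]]].
  have BI : B I by apply: sB; rewrite mem_head.
  have BJ := sB' _ Js.
  by rewrite (basic_disj hf BI BJ Ix Jx) Js in Is.
Qed.

(** One inequality holds at each level by [lmass_decomp]; the other is superadditivity over finite
    families of basic intervals. *)
Lemma mass_decomp A : mass A = \esum_(I in B) mass (A `&` I).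
Proof.
apply/eqP; rewrite eq_le; apply/andP; split.
  apply: mass_le => n; rewrite lmass_decomp; apply: le_esum => I BI.
  exact: le_lmass_mass.
apply: esum_le_seq => s us sB; apply: (le_trans (mass_super_seq _ us sB)).
by apply: le_mass => x [].
Qed.

End mass.

(** * Finiteness of the mass and its defect of additivity *)

Lemma esum_exchange (R : realType) (S T : choiceType) (D : set S) (E : set T)
    (F : S -> T -> \bar R) : (forall i j, 0 <= F i j)%E ->
  (\esum_(i in D) \esum_(j in E) F i j = \esum_(j in E) \esum_(i in D) F i j)%E.
Proof.
move=> F0; rewrite (@esum_esum R S T D (fun=> E) F)// (@esum_esum R T S E (fun=> D) (fun j i => F i j))//.
rewrite (reindex_esum (D `*`` fun=> E) (E `*`` fun=> D) (fun k => (k.2, k.1)))//.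
split.
- by move=> [i j] [/= Di Ej]; split.
- by move=> [i j] [i' j'] _ _ /= [-> ->].
- by move=> [j i] [/= Ej Di]; exists (i, j).
Qed.

Section mass_properties.
Context {R : realType} {a b : \bar R} {f : \bar R -> \bar R} {P : set (\bar R)}.
Hypothesis hf : cpmm a b f P.
Hypothesis hmix : topologically_mixing `[a, b] f.
Variables (lam : R) (v : set (\bar R) -> R).
Hypothesis hlam : (1 < lam)%R.
Hypothesis hv : nonneg_eigenvector a b f P lam v.
Implicit Types (x y z t p q u w : \bar R) (A I J : set (\bar R)).
Local Open Scope ereal_scope.
Local Notation B := (basic_intervals a b P).
Local Notation mass := (@mass R a b f P lam v).

Let lam0 : (0 < lam)%R. Proof. exact: lt_trans hlam. Qed.
Let lamV0 : (0 <= lam^-1)%R. Proof. by rewrite invr_ge0 ltW. Qed.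
Let v0 I : B I -> (0 <= v I)%R.
Proof. by case: hv => h _ _; exact: h. Qed.
Let m0 A : 0 <= mass A.
Proof. exact: (mass_ge0 hlam hv A). Qed.
Local Hint Resolve m0 : core.

Lemma eigen_step I J x : B I -> B J -> I x -> J (f x) -> (v J <= lam * v I)%R.
Proof.
move=> BI BJ Ix Jfx; rewrite -lee_fin; have [_ _ <-] := hv => //.
have h K : B K -> 0 <= (transition_matrix f I K * v K)%:E.
  by move=> BK; rewrite lee_fin /transition_matrix; case: ifPn; rewrite ?mul1r ?mul0r ?v0.
apply: le_trans (esum_ge_term h BJ).
rewrite /transition_matrix asboolT ?mul1r//.
exact: (basic_image_sat hf hmix BI BJ Ix Jfx).
Qed.

(** As [P] is forward invariant and the orbit of [x] ends outside it, the orbit runs through basic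
    intervals, and [eigen_step] applies at each time. *)
Lemma eigen_iter n I J x : B I -> B J -> I x -> J (iter n f x) ->
  (v J <= lam ^+ n * v I)%R.
Proof.
elim: n I x => [|n IH] I x BI BJ Ix.
  by move=> /= Jx; rewrite mul1r (basic_disj hf BJ BI Jx Ix).
rewrite iterSr => Jx.
have xab := basic_icc hf BI Ix.
have [K BK Kfx] : exists2 K, B K & K (f x).
  apply: (basic_in hf); first exact: (cpmm_icc hf).
  by move=> /(cpmm_P_iter hf n); exact: (basic_notP hf BJ Jx).
apply: (le_trans (IH _ _ BK BJ Kfx Jx)).
rewrite exprSr -mulrA ler_wpM2l ?exprn_ge0 ?(ltW lam0)//.
exact: eigen_step Kfx.
Qed.

Lemma basic_hit I J : B I -> B J -> exists n x, I x /\ J (iter n f x).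
Proof.
move=> /(basic_gap hf)[p [q [g ->]]] /(basic_gap hf)[p' [q' [g' ->]]].
have [pab qab] := gap_icc hf g; have [pab' qab'] := gap_icc hf g'.
have [_ _ pq _] := g; have [_ _ pq' _] := g'.
have [n /(_ n (leqnn _))[x Ix Jx]] := mixing_ioo hmix pab qab pq pab' qab' pq'.
by exists n, x.
Qed.

Lemma eigen_gt0 J : B J -> (0 < v J)%R.
Proof.
move=> BJ; have [_ [I BI vI0] _] := hv.
have [n [x [Jx Ix]]] := basic_hit BJ BI.
have vI : (0 < v I)%R by rewrite lt_neqAle eq_sym vI0 v0.
have := lt_le_trans vI (eigen_iter BJ BI Jx Ix).
by rewrite pmulr_rgt0// exprn_gt0.
Qed.

(** This is the eigenvalue equation iterated: an interval visited at time [n.+1] lies in the image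
    of one visited at time [n], so the double sum over both counts it at least once. *)
Lemma eigen_visited n J : B J ->
  \esum_(K in B) (if `[< exists2 x, J x & K (iter n f x) >] then (v K)%:E else 0)
  <= (lam ^+ n * v J)%:E.
Proof.
move=> BJ; elim: n => [|n IH].
  rewrite (esum_single (i := J))//.
  - by rewrite mul1r; case: ifPn => // _; rewrite lee_fin v0.
  - by case: ifPn => // _; rewrite lee_fin v0.
  - move=> K BK KJ; case: ifPn => // /asboolP[x Jx /= Kx].
    by case: KJ; exact: (basic_disj hf BK BJ Kx Jx).
pose W K := if `[< exists2 x, J x & K (iter n f x) >] then (v K)%:E else 0.
have W0 K : B K -> 0 <= W K by move=> BK; rewrite /W; case: ifPn => // _; rewrite lee_fin v0.
apply: (@le_trans _ _ (lam%:E * \esum_(K in B) W K)); last first.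
  by rewrite exprS -mulrA EFinM; apply: lee_wpmul2l; rewrite // lee_fin ltW.
rewrite -ge0_esumZl//; last exact: ltW.
(* [Z I K] is the share of [K] in the equation at [I]. Below it is cut off at 0 because
   [esum_exchange] wants nonnegative terms for all pairs of indices, while [v] has a sign on basic
   intervals only. *)
pose Z I K := if `[< exists2 x, J x & I (iter n f x) >] then
  (transition_matrix f I K * v K)%:E else 0.
apply: (@le_trans _ _ (\esum_(I in B) \esum_(K in B) maxe 0 (Z I K))).
  rewrite esum_exchange; last by move=> i j; rewrite le_max lexx.
  apply: le_esum => K BK; case: ifPn => [/asboolP[x Jx Kx]|_]; last first.
    by apply: esum_ge0 => I BI; rewrite le_max lexx.
  have [I BI Ix] : exists2 I, B I & I (iter n f x).
    apply: (basic_in hf); first exact/(cpmm_iter_icc hf)/(basic_icc hf BJ Jx).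
    by move=> /(cpmm_P hf); exact: (basic_notP hf BK Kx).
  apply: le_trans (esum_ge_term _ BI); last by move=> j _; rewrite le_max lexx.
  rewrite /Z asboolT; last by exists x.
  rewrite /transition_matrix asboolT ?mul1r ?le_max ?lexx ?orbT//.
  exact: (basic_image_sat hf hmix BI BK Ix Kx).
apply: le_esum => I BI; rewrite /W; case: ifPn => hI; last first.
  by rewrite mule0 esum1// => K BK; rewrite /Z ifF ?maxxx//; exact/negbTE.
rewrite -EFinM; have [_ _ <-] := hv => //; apply: le_esum => K BK.
rewrite /Z hI ge_max lexx andbT lee_fin /transition_matrix.
by case: ifPn; rewrite ?mul1r ?mul0r ?v0.
Qed.

(** By mixing some iterate of a basic [J] covers [[u, w]], so every basic interval that meets []u,
    w[] is visited from [J], and [eigen_visited] bounds the sum of their weights. *)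
Lemma mass_fin u w : a < u -> u < w -> w < b -> mass (ioo u w) < +oo.
Proof.
move=> au uw wb; have [_ [J BJ _] _] := hv.
have [p [q [g JE]]] := basic_gap hf BJ.
have [pab qab] := gap_icc hf g; have [_ _ pq _] := g.
have [n /(_ n (leqnn _)) nP] := mixing_cover hf hmix pab qab pq au (ltW uw) wb.
apply: le_lt_trans (ltry (lam ^+ n * v J)%R).
apply: le_trans (eigen_visited n BJ).
rewrite (mass_decomp hf hmix hlam hv); apply: le_esum => I BI.
case: ifPn => [_|/asboolP h].
  rewrite -(mass_basic hf hmix hlam hv BI).
  by apply: (le_mass hlam hv) => x [].
rewrite (_ : _ `&` I = set0) ?(mass_set0 hf hlam hv)//.
apply/seteqP; split => // x [/andP[/ltW ux /ltW xw] Ix]; apply: h.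
by have [|z Jz zx] := nP x; [rewrite ux|exists z; rewrite ?JE ?zx].
Qed.

(* The mass is superadditive; [e] bounds how much ]x, z[ outweighs its two halves. *)
Definition split_defect y (e : R) := forall x z, icc a b x -> icc a b z ->
  x < y -> y < z -> mass (ioo x z) <= mass (ioo x y) + mass (ioo y z) + e%:E.

(** The whole and both halves are sums over basic intervals, and only the one that contains [y] is
    cut: the error arises there alone. *)
Lemma split_local y e : (0 <= e)%R ->
  (forall I, B I -> I y -> forall x z, icc a b x -> icc a b z -> x < y -> y < z ->
    mass (ioo x z `&` I) <= mass (ioo x y `&` I) + mass (ioo y z `&` I) + e%:E) ->
  split_defect y e.
Proof.
move=> e0 h x z xab zab xy yz.
pose E I := if `[< I y >] then e%:E else 0.
have E0 I : 0 <= E I by rewrite /E; case: ifPn => // _; rewrite lee_fin.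
have sE : \esum_(I in B) E I <= e%:E.
  have [[I BI Iy]|nI] := pselect (exists2 I, B I & I y).
    rewrite (esum_single (i := I))//; first by rewrite /E asboolT.
    move=> J BJ JI; rewrite /E asboolF// => Jy; apply: JI.
    exact: (basic_disj hf BJ BI Jy Iy).
  rewrite esum1 ?lee_fin// => I BI; rewrite /E asboolF// => Iy.
  by apply: nI; exists I.
rewrite (mass_decomp hf hmix hlam hv (ioo x z)) (mass_decomp hf hmix hlam hv (ioo x y))
  (mass_decomp hf hmix hlam hv (ioo y z)).
rewrite -esumD//; apply: le_trans (leeD2l _ sE).
rewrite -esumD//; last by move=> i _; rewrite adde_ge0.
apply: le_esum => I BI; rewrite /E; case: ifPn => [/asboolP Iy|/asboolP nIy].
  exact: h.
rewrite adde0.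
have [p [q [g IE]]] := basic_gap hf BI.
have [qy|yq] := leP q y.
  apply: (@le_trans _ _ (mass (ioo x y `&` I))); last by rewrite leeDl.
  apply: (le_mass hlam hv) => t [/andP[xt tz] It]; split => //.
  by move: It; rewrite IE => /andP[_ tq]; rewrite /ioo /= xt (lt_le_trans tq).
have yp : y <= p by rewrite leNgt; apply/negP => py; apply: nIy; rewrite IE /ioo /= py.
apply: (@le_trans _ _ (mass (ioo y z `&` I))); last by rewrite leeDr.
apply: (le_mass hlam hv) => t [/andP[xt tz] It]; split => //.
by move: It; rewrite IE => /andP[pt _]; rewrite /ioo /= tz (le_lt_trans yp).
Qed.

Lemma split_P y : P y -> split_defect y 0.
Proof. by move=> Py; apply: split_local => // I BI Iy; have := basic_notP hf BI Iy Py. Qed.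

Lemma split_basic I y : B I -> I y -> split_defect y (v I).
Proof.
move=> BI Iy; apply: split_local => [|J BJ Jy x z _ _ _ _]; first exact: v0.
rewrite (basic_disj hf BJ BI Jy Iy); apply: (@le_trans _ _ (v I)%:E).
  rewrite -(mass_basic hf hmix hlam hv BI).
  by apply: (le_mass hlam hv) => t [].
by rewrite leeDr// adde_ge0.
Qed.

(** Inside [I] the map is strictly monotone and multiplies masses by [lam], so a defect at [y] is
    carried to a defect at [f y] that is [lam] times as large. *)
Lemma split_step I y e : B I -> I y -> (0 <= e)%R -> split_defect (f y) e ->
  split_defect y (lam^-1 * e).
Proof.
move=> BI Iy e0 he; apply: split_local => [|J BJ Jy x z xab zab xy yz].
  by rewrite mulr_ge0.
have {J BJ Jy} -> := basic_disj hf BJ BI Jy Iy.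
have [p [q [g IE]]] := basic_gap hf BI; have [pab qab] := gap_icc hf g.
have [py yq] : p < y /\ y < q by move: Iy; rewrite IE => /andP[].
(* By [split_local] only the parts inside [I] matter, so [x] and [z] are cut back to the closure of
   [I]. *)
pose x' := Order.max x p; pose z' := Order.min z q.
have xy' : x' < y by rewrite gt_max xy py.
have yz' : y < z' by rewrite lt_min yz yq.
have px' : p <= x' by rewrite le_max lexx orbT.
have zq' : z' <= q by rewrite ge_min lexx orbT.
have x'ab : icc a b x' by rewrite /x'; case: leP.
have z'ab : icc a b z' by rewrite /z'; case: leP.
have -> : ioo x z `&` I = ioo x' z'.
  rewrite IE; apply/seteqP; split => t; rewrite /ioo /= gt_max lt_min.
    by move=> [/andP[-> ->] /andP[-> ->]].
  by move=> /andP[/andP[-> ->] /andP[-> ->]].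
have -> : ioo x y `&` I = ioo x' y.
  rewrite IE; apply/seteqP; split => t; rewrite /ioo /= gt_max.
    by move=> [/andP[-> ->] /andP[-> _]].
  by move=> /andP[/andP[-> ->] ty]; rewrite ty (lt_trans ty yq).
have -> : ioo y z `&` I = ioo y z'.
  rewrite IE; apply/seteqP; split => t; rewrite /ioo /= lt_min.
    by move=> [/andP[-> ->] /andP[_ ->]].
  by move=> /andP[yt /andP[-> ->]]; rewrite yt (lt_trans py yt).
have sub r s : p <= r -> s <= q -> ioo r s `<=` I.
  by move=> pr sq t /andP[rt ts]; rewrite IE /ioo /= (le_lt_trans pr rt) (lt_le_trans ts sq).
have im r s : p <= r -> r < s -> s <= q ->
    mass (ioo (Order.min (f r) (f s)) (Order.max (f r) (f s))) = lam%:E * mass (ioo r s).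
  move=> pr rs sq; rewrite -(gap_image hf hmix g pr rs sq).
  exact: (mass_image hf hmix hlam hv BI (sub _ _ pr sq)).
rewrite EFinM.
suff : lam%:E * mass (ioo x' z') <=
    lam%:E * mass (ioo x' y) + lam%:E * mass (ioo y z') + e%:E.
  rewrite -muleDr ?ge0_adde_def ?inE// => h.
  rewrite -lee_pdivlMl// in h; apply: (le_trans h).
  move: (adde_ge0 (m0 (ioo x' y)) (m0 (ioo y z'))); set X := mass _ + mass _ => X0.
  rewrite muleDr ?ge0_adde_def ?inE ?mule_ge0 ?lee_fin ?(ltW lam0)//.
  by rewrite (muleA (lam^-1)%:E lam%:E) -(EFinM lam^-1 lam) mulVf ?gt_eqF// mul1e.
rewrite -(im x' z')// ?(lt_trans xy')// -(im x' y)// ?(ltW yq)// -(im y z')// ?(ltW py)//.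
have [s sP] := gap_mono hf hmix g.
have h1 := sP _ _ px' xy' (ltW yq); have h2 := sP _ _ (ltW py) yz' zq'.
have fx'ab := cpmm_icc hf x'ab; have fz'ab := cpmm_icc hf z'ab.
case: s {sP} h1 h2 => h1 h2.
  rewrite !(min_l (ltW h1)) !(max_r (ltW h1)) !(min_l (ltW h2)) !(max_r (ltW h2)).
  rewrite (min_l (ltW (lt_trans h1 h2))) (max_r (ltW (lt_trans h1 h2))).
  exact: he.
(* A decreasing branch exchanges the two halves. *)
rewrite !(min_r (ltW h1)) !(max_l (ltW h1)) !(min_r (ltW h2)) !(max_l (ltW h2)).
rewrite (min_r (ltW (lt_trans h2 h1))) (max_l (ltW (lt_trans h2 h1))).
by rewrite [X in X + _]addeC; exact: he.
Qed.

Lemma split_preimage n y : icc a b y -> P (iter n f y) -> split_defect y 0.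
Proof.
elim: n y => [|n IH] y yab; first exact: split_P.
rewrite iterSr => Py; have [/split_P//|nPy] := pselect (P y).
have [I BI Iy] := basic_in hf yab nPy.
rewrite -(mulr0 (lam^-1)%R); apply: (split_step BI Iy) => //.
by apply: IH => //; exact: (cpmm_icc hf).
Qed.

(** At time [n] the crude bound [v J] of [split_basic] is available, and each of the [n] steps back
    divides it by [lam]. *)
Lemma split_iter n y J : icc a b y -> (forall i, (i <= n)%N -> ~ P (iter i f y)) ->
  B J -> J (iter n f y) -> split_defect y (lam ^- n * v J).
Proof.
elim: n y => [|n IH] y yab nP BJ.
  by move=> /= Jy; rewrite expr0 invr1 mul1r; exact: split_basic.
rewrite iterSr => Jy.
have [I BI Iy] := basic_in hf yab (nP 0%N isT).
rewrite exprS invfM -mulrA; apply: (split_step BI Iy).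
  by rewrite mulr_ge0 ?v0// invr_ge0 exprn_ge0 ?ltW.
apply: IH => //; first exact: (cpmm_icc hf).
by move=> i i_n; rewrite -iterSr; apply: nP.
Qed.

End mass_properties.

(** * One-sided atoms of the mass *)

Section germs.
Context {R : realType} {a b : \bar R} {f : \bar R -> \bar R} {P : set (\bar R)}.
Hypothesis hf : cpmm a b f P.
Hypothesis hmix : topologically_mixing `[a, b] f.
Variables (lam : R) (v : set (\bar R) -> R).
Hypothesis hlam : (1 < lam)%R.
Hypothesis hv : nonneg_eigenvector a b f P lam v.
Implicit Types (x y z t p q u w : \bar R) (A I J : set (\bar R)) (s : bool).
Local Open Scope ereal_scope.
Local Notation B := (basic_intervals a b P).
Local Notation mass := (@mass R a b f P lam v).

Let lam0 : (0 < lam)%R. Proof. exact: lt_trans hlam. Qed.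
Let m0 A : 0 <= mass A.
Proof. exact: (mass_ge0 hlam hv A). Qed.
Local Hint Resolve m0 : core.

(** Punctured one-sided neighbourhoods of [x]; the boolean lets both sides share the arguments
    below. *)
Definition germ s x w : set (\bar R) := if s then ioo x w else ioo w x.

Definition germ_end s x w : Prop := if s then x < w <= b else a <= w < x.

Lemma germ_endI s x w w' : germ_end s x w -> germ_end s x w' ->
  exists w'', [/\ germ_end s x w'', germ s x w'' `<=` germ s x w &
    germ s x w'' `<=` germ s x w'].
Proof.
case: s => /= /andP[h1 h2] /andP[h3 h4].
- exists (Order.min w w'); rewrite /germ_end /ioo /= lt_min h1 h3 ge_min h2; split => //.
    by move=> t /= /andP[-> ]; rewrite lt_min => /andP[].
  by move=> t /= /andP[-> ]; rewrite lt_min => /andP[].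
- exists (Order.max w w'); rewrite /germ_end /ioo /= gt_max h2 h4 le_max h1; split => //.
    by move=> t /= /andP[+ ->]; rewrite gt_max => /andP[->].
  by move=> t /= /andP[+ ->]; rewrite gt_max => /andP[_ ->].
Qed.

Lemma germ_nonempty s x w : germ_end s x w -> germ s x w !=set0.
Proof.
by case: s => /= /andP[h1 h2]; [have [t] := ereal_dense h1|have [t] := ereal_dense h2]; exists t.
Qed.

Lemma germ_avoid s x w I : icc a b x -> germ_end s x w -> B I ->
  (exists2 w', germ_end s x w' & germ s x w' `<=` I) \/
  (exists2 w', germ_end s x w' & germ s x w' `&` I = set0).
Proof.
move=> xab gw /(basic_gap hf)[p [q [g ->]]]; have [pab qab] := gap_icc hf g.
have [_ _ pq _] := g.
case: s gw => /= /andP[h1 h2].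
- have [qx|xq] := leP q x.
    right; exists w; first by rewrite /germ_end /= h1.
    apply/seteqP; split => // t [/andP[xt _] /andP[_ tq]].
    by have := lt_le_trans tq (le_trans qx (ltW xt)); rewrite ltxx.
  have [px|xp] := leP p x.
    left; exists q; first by rewrite /germ_end /= xq; case/andP: qab.
    by move=> t /andP[xt tq]; rewrite /ioo /= (le_lt_trans px xt).
  right; exists p; first by rewrite /germ_end /= xp; case/andP: pab.
  apply/seteqP; split => // t [/andP[_ tp] /andP[pt _]].
  by have := lt_trans tp pt; rewrite ltxx.
- have [qx|xq] := leP x p.
    right; exists w; first by rewrite /germ_end /= h1.
    apply/seteqP; split => // t [/andP[_ tx] /andP[pt _]].
    by have := lt_trans tx (le_lt_trans qx pt); rewrite ltxx.
  have [px|xp] := leP x q.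
    left; exists p; first by rewrite /germ_end /= xq andbT; case/andP: pab.
    by move=> t /andP[pt tx]; rewrite /ioo /= pt (lt_le_trans tx px).
  right; exists q; first by rewrite /germ_end /= xp andbT; case/andP: qab.
  apply/seteqP; split => // t [/andP[qt _] /andP[_ tq]].
  by have := lt_trans tq qt; rewrite ltxx.
Qed.

Lemma germ_image s x J w : icc a b x -> B J -> germ_end s x w -> germ s x w `<=` J ->
  exists s', forall w', germ_end s x w' -> germ s x w' `<=` germ s x w ->
    germ_end s' (f x) (f w') /\ f @` germ s x w' = germ s' (f x) (f w').
Proof.
move=> xab BJ gw gJ; have [p [q [g JE]]] := basic_gap hf BJ.
have [pab qab] := gap_icc hf g; have [r rP] := gap_mono hf hmix g.
have ext u z : u < z -> ioo u z `<=` ioo p q -> p <= u /\ z <= q.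
  move=> uz sub; split; rewrite leNgt; apply/negP => h.
    have [|t /andP[ut]] := @ereal_dense R u (Order.min p z); first by rewrite lt_min h uz.
    rewrite lt_min => /andP[tp tz]; have /sub/andP[pt _] : ioo u z t by rewrite /ioo /= ut.
    by have := lt_trans tp pt; rewrite ltxx.
  have [|t /andP[]] := @ereal_dense R (Order.max q u) z; first by rewrite gt_max h uz.
  rewrite gt_max => /andP[qt ut] tz; have /sub/andP[_ tq] : ioo u z t by rewrite /ioo /= ut.
  by have := lt_trans tq qt; rewrite ltxx.
(* An increasing branch ([r] true) keeps the side and a decreasing one reverses it; the test
   [r == s] encodes both. *)
exists (r == s) => w' gw' sub.
have {}sub : germ s x w' `<=` ioo p q by rewrite -JE; exact: subset_trans gJ.
case: s gw gJ gw' sub => /= /andP[h1 h2] gJ /andP[h3 h4] sub.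
- have [px wq] := ext _ _ h3 sub.
  rewrite (gap_image hf hmix g px h3 wq).
  have w'ab : icc a b w'.
    by rewrite /icc /= h4 (le_trans _ (ltW h3))//; case/andP: xab.
  have /andP[fa fb] := cpmm_icc hf w'ab.
  have := rP _ _ px h3 wq; case: r {rP} => /= h.
    by rewrite /germ_end /= h min_l ?max_r ?(ltW h).
  by rewrite /germ_end /= h andbT min_r ?max_l ?(ltW h).
- have [px wq] := ext _ _ h4 sub.
  rewrite (gap_image hf hmix g px h4 wq).
  have w'ab : icc a b w'.
    by rewrite /icc /= h3 (le_trans (ltW h4))//; case/andP: xab.
  have /andP[fa fb] := cpmm_icc hf w'ab.
  have := rP _ _ px h4 wq; case: r {rP} => /= h.
    by rewrite /germ_end /= h andbT min_l ?max_r ?(ltW h).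
  by rewrite /germ_end /= h min_r ?max_l ?(ltW h).
Qed.

(** By continuity the images of shrinking germs at [x] shrink to [f x], so a lower bound on the mass
    of all germs at [x] passes to all germs at [f x]. *)
Lemma germ_cont s s' x w w1 : icc a b x -> germ_end s x w ->
  (forall w', germ_end s x w' -> germ s x w' `<=` germ s x w ->
    germ_end s' (f x) (f w')) ->
  germ_end s' (f x) w1 ->
  exists w', [/\ germ_end s x w', germ s x w' `<=` germ s x w &
    germ s' (f x) (f w') `<=` germ s' (f x) w1].
Proof.
move=> xab gw ends gw1.
have [N Nfx NP] : exists2 N, nbhs (f x) N &
    forall y, N y -> germ_end s' (f x) y -> germ s' (f x) y `<=` germ s' (f x) w1.
  case: s' gw1 {ends} => /= /andP[h1 h2].
    exists [set y | y < w1]; first exact: ereal_nbhs_lt.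
    by move=> y /= yw _ t /andP[xt ty]; rewrite /ioo /= xt (lt_trans ty).
  exists [set y | w1 < y]; first exact: ereal_nbhs_gt.
  by move=> y /= yw _ t /andP[xt ty]; rewrite /ioo /= ty (lt_trans yw).
have [w2 gw2 w2N] : exists2 w2, germ_end s x w2 & forall t, germ s x w2 t -> N (f t).
  case: s gw {ends} => /= /andP[h1 h2]; case/andP: xab => ax xb.
    have [|w2 w2b w2N] := within_right (cpmm_within hf) _ Nfx.
      by rewrite ax (lt_le_trans h1).
    by exists w2 => // t /andP[/ltW xt tw]; apply: w2N; rewrite xt.
  have [|w2 w2b w2N] := within_left (cpmm_within hf) _ Nfx.
    by rewrite xb (le_lt_trans h1).
  by exists w2 => // t /andP[xt /ltW tw]; apply: w2N; rewrite xt.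
have [w3 [gw3 s1 s2]] := germ_endI gw gw2.
have [w' gw'] := germ_nonempty gw3.
have [e1 e2] : germ_end s x w' /\ germ s x w' `<=` germ s x w3.
  case: s gw gw3 gw' {ends gw2 w2N s1 s2} => /= /andP[h1 h2] /andP[h3 h4] /andP[h5 h6].
    rewrite /germ_end /= h5 (le_trans (ltW h6))//; split => // t /andP[xt tw].
    by rewrite /ioo /= xt (lt_trans tw).
  rewrite /germ_end /= h6 (le_trans _ (ltW h5))//; split => // t /andP[xt tw].
  by rewrite /ioo /= tw (lt_trans h5 xt).
exists w'; split => //; first exact: subset_trans s1.
apply: NP; first by apply: w2N; exact: s2.
by apply: ends => //; exact: subset_trans s1.
Qed.

(** By [germ_avoid] a small germ lies inside a given basic interval or misses it. With the first
    case excluded, finitely many intervals are missed by shrinking the germ. *)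
Lemma germ_avoid_seq s x w0 (l : seq (set (\bar R))) : icc a b x -> germ_end s x w0 ->
  ~ (exists J, B J /\ exists2 w, germ_end s x w & germ s x w `<=` J) ->
  (forall I, I \in l -> B I) ->
  exists w', [/\ germ_end s x w', germ s x w' `<=` germ s x w0 &
    germ s x w' `&` \bigcup_(I in [set` l]) I = set0].
Proof.
move=> xab gw0 nJ.
have avoid I : B I -> exists2 w', germ_end s x w' & germ s x w' `&` I = set0.
  by move=> BI; have [[w' ? ?]|//] := germ_avoid xab gw0 BI; case: nJ; exists I; split => //; exists w'.
elim: l => [|I l IH] lB.
  by exists w0; split => //; rewrite set_nil bigcup_set0 setI0.
have [|w1 [g1 s1 d1]] := IH; first by move=> J Jl; apply: lB; rewrite in_cons Jl orbT.
have [w2 g2 d2] := avoid I (lB I (mem_head _ _)).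
have [w3 [g3 s31 s32]] := germ_endI g1 g2.
exists w3; split => //; first exact: subset_trans s1.
apply/seteqP; split => // t [gt [J /=]]; rewrite in_cons => /predU1P[->|Jl] Jt.
  have : (germ s x w2 `&` I) t by split => //; exact: s32.
  by rewrite d2.
have : (germ s x w1 `&` \bigcup_(I in [set` l]) I) t by split; [exact: s31|exists J].
by rewrite d1.
Qed.

(* A one-sided atom of weight at least c at x, to the right of x when [s]. *)
Definition heavy_germ s x (c : R) :=
  [/\ icc a b x, exists2 w, germ_end s x w & mass (germ s x w) < +oo &
      forall w, germ_end s x w -> c%:E <= mass (germ s x w)].

(* Otherwise finitely many basic intervals carry almost all the mass of a small
   germ while a smaller germ, of mass at least c, avoids them all. *)
Lemma heavy_germ_in_basic s x c : (0 < c)%R -> heavy_germ s x c ->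
  exists J, B J /\ exists2 w, germ_end s x w & germ s x w `<=` J.
Proof.
move=> c0 [xab [w0 gw0 w0fin] hc]; apply: contrapT => nJ.
have : mass (germ s x w0) <= mass (germ s x w0) - c%:E.
  rewrite [X in X <= _](mass_decomp hf hmix hlam hv); apply: esum_le_seq => l ul lB.
  rewrite leeBrDr//; have [w' [gw' sw' dw']] := germ_avoid_seq xab gw0 nJ lB.
  apply: (le_trans (leeD (mass_super_seq hf hmix hlam hv _ ul lB) (hc _ gw'))).
  apply: (mass_super hf hmix hlam hv) => [t []//|//|].
  apply/seteqP; split => // t [[_ lt_] gt].
  by rewrite -dw'.
have fin : mass (germ s x w0) \is a fin_num by rewrite ge0_fin_numE.
by rewrite -(fineK fin) -EFinB lee_fin lerBrDr gerDl leNgt c0.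
Qed.

(** A heavy germ lies in one basic interval [J], where [f] multiplies masses by [lam] and maps germs
    at [x] to germs at [f x]. The last clause will make the image of [J] meet the next interval of
    the path. *)
Lemma heavy_germ_step s x c : (0 < c)%R -> heavy_germ s x c ->
  exists J s', [/\ B J, exists2 w, germ_end s x w & germ s x w `<=` J,
    heavy_germ s' (f x) (lam * c) & forall w, germ_end s' (f x) w ->
      exists2 t, J t & germ s' (f x) w (f t)].
Proof.
move=> c0 hg; have [J [BJ [w gw gJ]]] := heavy_germ_in_basic c0 hg.
have [xab [w0 gw0 w0fin] hc] := hg.
have [s' s'P] := germ_image xab BJ gw gJ.
have massE w' : germ_end s x w' -> germ s x w' `<=` germ s x w ->
    mass (germ s' (f x) (f w')) = lam%:E * mass (germ s x w').
  move=> gw' sw'; have [_ <-] := s'P _ gw' sw'.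
  by apply: (mass_image hf hmix hlam hv BJ); exact: subset_trans gJ.
have cont w1 : germ_end s' (f x) w1 -> exists w', [/\ germ_end s x w', germ s x w' `<=` germ s x w &
    germ s' (f x) (f w') `<=` germ s' (f x) w1].
  by apply: germ_cont => // w' h1 h2; have [] := s'P _ h1 h2.
exists J, s'; split => //; first by exists w.
  split; first exact: (cpmm_icc hf).
    have [w1 [gw1 s1 s2]] := germ_endI gw gw0.
    exists (f w1); first by have [] := s'P _ gw1 s1.
    rewrite massE//; apply: lte_mul_pinfty; rewrite ?lee_fin ?(ltW lam0)//.
    by apply: le_lt_trans w0fin; exact: (le_mass hlam hv).
  move=> w1 /cont[w' [gw' sw' sub]].
  apply: le_trans (le_mass hlam hv sub).
  by rewrite massE// EFinM; apply: lee_wpmul2l; rewrite ?lee_fin ?(ltW lam0) ?hc.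
move=> w1 /cont[w' [gw' sw' sub]]; have [t gt] := germ_nonempty gw'.
exists t; first exact/gJ/sw'.
by apply: sub; have [_ <-] := s'P _ gw' sw'; exists t.
Qed.

Definition growing_path (c : R) (J : nat -> set (\bar R)) :=
  forall n, [/\ B (J n), J n.+1 `<=` f @` J n & (c * lam ^+ n <= v (J n))%R].

Lemma heavy_germ_path s x c : (0 < c)%R -> heavy_germ s x c ->
  exists K, growing_path c K.
Proof.
move=> c0 hg.
pose St (y : bool * \bar R) n := heavy_germ y.1 y.2 (c * lam ^+ n).
have cn n : (0 < c * lam ^+ n)%R by rewrite mulr_gt0// exprn_gt0.
(* The existence is stated for every state, heavy or not, so that [choice] applies without dependent
   types; a state that is not heavy gets a dummy successor. *)
have step n (y : bool * \bar R) : exists yJ : (bool * \bar R) * set (\bar R), St y n ->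
    [/\ St yJ.1 n.+1, B yJ.2,
     exists2 w, germ_end y.1 y.2 w & germ y.1 y.2 w `<=` yJ.2 &
     forall w, germ_end yJ.1.1 yJ.1.2 w -> exists2 t, yJ.2 t & germ yJ.1.1 yJ.1.2 w (f t)].
  have [h|h] := pselect (St y n); last by exists (y, set0) => /h.
  have [J [s' [BJ h1 h2 h3]]] := heavy_germ_step (cn n) h.
  by exists ((s', f y.2), J) => _; split => //; rewrite /St/= exprS mulrCA.
have [F FP] := choice (fun ny : nat * (bool * \bar R) => step ny.1 ny.2).
pose Y := fix Y n := if n is n'.+1 then (F (n', Y n')).1 else (s, x).
have YS n : St (Y n) n.
  elim: n => [|n IH]; first by rewrite /St/= mulr1.
  by have [] := FP (n, Y n) IH.
pose J n := (F (n, Y n)).2; exists J => n.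
have [h1 BJ [w gw gJ] h4] := FP (n, Y n) (YS n).
have [_ BJ' [w' gw' gJ'] _] := FP (n.+1, Y n.+1) (YS n.+1).
have [xab _ hc] := YS n.
split => //.
  have [t Jt Jft] := h4 w' gw'.
  exact: (basic_image_sat hf hmix BJ BJ' Jt (gJ' _ Jft)).
rewrite -lee_fin -(mass_basic hf hmix hlam hv BJ).
by apply: (le_trans (hc _ gw)); exact: (le_mass hlam hv).
Qed.

End germs.

(** * A path cannot escape to a fixed end *)

Section no_escape.
Context {d : Order.disp_t} {T : orderType d} {R : realType}.
(** In the application [h] is the second iterate of [f], [L] is [lam ^+ 2], [b] is the fixed end,
    [p n] and [q n] bound every second interval of the path, [G] is the mass measured from [s], and
    [X] collects the points with image in [P]. *)
Variables (h : T -> T) (G : T -> R) (X : set T) (s b : T) (p q e : nat -> T) (L c : R).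
Hypotheses (L1 : 1 < L) (c0 : 0 < c).
Hypothesis pq : forall n, [/\ (s <= p n)%O, (p n < q n)%O & (q n < b)%O].
Hypothesis disj : forall n m,
  [\/ p n = p m /\ q n = q m, (q n <= p m)%O | (q m <= p n)%O].
Hypothesis escape : forall t, (t < b)%O -> exists N, forall n, (N <= n)%N -> (t <= p n)%O.
Hypothesis grow : forall n, c * L ^+ n <= G (q n) - G (p n).
Hypothesis eP : forall n, [/\ X (e n), (p n <= e n)%O, (e n <= q n)%O & (q n.+1 <= h (e n))%O].
Hypothesis G0 : forall x, 0 <= G x.
Hypothesis G_nd : forall x y, (x <= y)%O -> (y < b)%O -> G x <= G y.
Hypothesis Gh : forall u w, X u -> X w -> (s <= u)%O -> (u <= w)%O -> (w < b)%O ->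
  `|G (h w) - G (h u)| <= L * (G w - G u).
Hypothesis hb : forall x, X x -> (s <= x)%O -> (x < b)%O -> (h x < b)%O.
Hypotheses (Xs : X s) (hs : (h s <= s)%O) (sb : (s < b)%O).
Hypothesis dip : forall k, exists z, [/\ X z, (q k <= z)%O, (z < b)%O & (h z < q k)%O].

Let L0 : 0 < L. Proof. exact: lt_trans L1. Qed.

(** Apply the expansion bound between [s] and [e n]: the image of [e n] is beyond [q n.+1], and the
    term [G (h s)] is absorbed because [h s <= s] and [1 < L]. *)
Lemma no_escape_ratio n : G (q n.+1) <= L * G (q n).
Proof.
have [Xe pe eq he] := eP n; have [sp _ qb] := pq n.
have eb := le_lt_trans eq qb; have se := le_trans sp pe.
have h1 := G_nd he (hb Xe se eb).
have h2 : G (h s) <= G s by exact: G_nd.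
have := Gh Xs Xe (lexx s) se eb; rewrite ler_norml => /andP[_ h3].
have h4 := G_nd eq qb.
have h5 := G0 s.
have h6 : L * G (e n) <= L * G (q n) by rewrite ler_pM2l.
have h7 : G s <= L * G s by rewrite ler_peMl// ltW.
by rewrite mulrBr in h3; lra.
Qed.

(** As long as some later interval [j] begins before [q k0], restart from [j]. Disjointness gives
    [q j <= q k0], so the time [N] found for [k0] still serves and bounds the search. *)
Lemma no_escape_record k0 : exists2 k, (k0 <= k)%N & forall j, (k < j)%N -> (q k <= p j)%O.
Proof.
have [N NP] := escape (let: And3 _ _ qb := pq k0 in qb).
move mE : (N - k0)%N => m.
elim/ltn_ind: m k0 mE NP => m IH k0 mE NP.
have [hk|/existsNP[j /not_implyP[kj /negP]]] := pselect (forall j, (k0 < j)%N -> (q k0 <= p j)%O).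
  by exists k0.
rewrite -ltNge => hj.
have jN : (j < N)%N by rewrite ltnNge; apply/negP => /NP; rewrite leNgt hj.
have qj : (q j <= q k0)%O.
  have [[_ <-]//|h1|h1] := disj k0 j; first by rewrite leNgt hj in h1.
  by apply: (le_trans h1); have [_ /ltW] := pq k0.
have [|||k jk kP] := IH (N - j)%N _ j.
- by rewrite -mE; apply: ltn_sub2l => //; exact: ltn_trans jN.
- by [].
- by move=> n /NP; exact: le_trans.
- by exists k => //; apply: leq_trans jk; exact: ltnW.
Qed.

(* [beta] is nonnegative, nonincreasing, and drops by c / L infinitely often. *)
Let beta n := G (q n) / L ^+ n.

Let Ln n : 0 < L ^+ n. Proof. by rewrite exprn_gt0. Qed.

Let beta_noninc n m : (n <= m)%N -> beta m <= beta n.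
Proof.
move=> nm; rewrite -(subnK nm); elim: (m - n)%N => [|k IH]//.
apply: le_trans IH; rewrite addSn /beta ler_pdivrMr//.
suff -> : G (q (k + n)) / L ^+ (k + n) * L ^+ (k + n).+1 = L * G (q (k + n)) by exact: no_escape_ratio.
by rewrite exprSr mulrA divfK ?gt_eqF// mulrC.
Qed.

(* h sends s to its left, e j beyond q j.+1, and z, which lies beyond q j, back
   below q k: what lies between q k and q j.+1 is covered twice. This excess makes
   the next step fall short of the factor L by an increment of G along the path. *)
Lemma no_escape_drop k0 : exists2 n, (k0 < n)%N & beta n <= beta k0 - c / L.
Proof.
have [k k0k kP] := no_escape_record k0.
have [sp pqk qb] := pq k.
have [z [Xz qz zb hz]] := dip k.
have sz := le_trans (le_trans sp (ltW pqk)) qz.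
have ex : exists i, (k < i)%N && (z <= q i)%O.
  have [N NP] := escape zb; exists (maxn N k.+1); rewrite leq_maxr /=.
  have [_ /ltW pqN _] := pq (maxn N k.+1).
  exact: le_trans (NP _ (leq_maxl N k.+1)) pqN.
(* The index [j.+1] is the first one after [k] at which the path has passed [z], so that
   [q j <= z <= q j.+1]. *)
case: (ex_minnP ex) => i /andP[ki zq] imin.
case: i ki zq imin => // j kj zq imin.
have qjz : (q j <= z)%O.
  move: kj; rewrite ltnS leq_eqVlt => /predU1P[<-//|kj].
  have [//|zqj] := leP (q j) z.
  by have := imin j; rewrite kj (ltW zqj) ltnn => /(_ isT).
have [Xj pj ejq hj] := eP j; have [spj _ qbj] := pq j.
have sej := le_trans spj pj; have ejb := le_lt_trans ejq qbj.
have ejz := le_trans ejq qjz.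
have a1 := G_nd hj (hb Xj sej ejb).
have := Gh Xs Xj (lexx s) sej ejb; rewrite ler_norml => /andP[_ a2].
have := Gh Xj Xz sej ejz zb; rewrite ler_norml => /andP[a3 _].
have a4 := G_nd hs sb.
have a5 : G s <= L * G s by rewrite ler_peMl// ltW.
have a6 := G_nd (ltW hz) qb.
(* Sum of the expansion bounds on [[s, e j]] and on [[e j, z]]: along the image [G] climbs to at
   least [G (q j.+1)] and comes back to at most [G (q k)]. *)
have b1 : 2 * G (q j.+1) - G (q k) <= L * G z by rewrite !mulrBr in a2 a3; lra.
have [Xi pi eiq hi] := eP j.+1; have [spi _ qbi] := pq j.+1.
have sei := le_trans spi pi; have eib := le_lt_trans eiq qbi.
have c1 := G_nd hi (hb Xi sei eib).
have c2 : L * G (e j.+1) <= L * G (q j.+1) by rewrite ler_pM2l// G_nd.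
have c3 := G_nd (kP _ kj) (le_lt_trans pi eib).
have g1 := grow j.+1.
have [spi2 _ qbi2] := pq j.+2.
have c4 := G_nd (kP _ (leqW kj)) (lt_trans (let: And3 _ x _ := pq j.+2 in x) qbi2).
have g2 := grow j.+2.
(* If [z] precedes [e j.+1], the bound on [[z, e j.+1]] is added to [b1]. Otherwise the image climbs
   beyond [q j.+2] before it returns at [z], and the argument of [b1] is repeated with [e j.+1]. The
   gain is [G (q j.+1) - G (q k)] or [G (q j.+2) - G (q k)]; since no interval after [k] begins
   before [q k], it is bounded below by [grow]. *)
have key : G (q j.+2) <= L * G (q j.+1) - c * L ^+ j.+1.
  have [ze|ez] := leP z (e j.+1).
    have := Gh Xz Xi sz ze eib; rewrite ler_norml => /andP[_ a7].
    have g0 : 0 < c * L ^+ j.+1 by rewrite mulr_gt0.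
    by rewrite !mulrBr in a7; lra.
  have := Gh Xs Xi (lexx s) sei eib; rewrite ler_norml => /andP[_ a7].
  have := Gh Xi Xz sei (ltW ez) zb; rewrite ler_norml => /andP[a8 _].
  have a9 : L * G z <= L * G (q j.+1) by rewrite ler_pM2l// G_nd.
  have g3 : c * L ^+ j.+1 <= c * L ^+ j.+2.
    by rewrite ler_pM2l// [leRHS]exprS ler_peMl// ltW.
  by rewrite !mulrBr in a7 a8; lra.
exists j.+2; first by rewrite ltnS (leq_trans k0k)// ltnW.
have := beta_noninc (leq_trans k0k (ltnW kj)).
move=> h1; apply: le_trans (lerB h1 (lexx _)).
rewrite /beta ler_pdivrMr//; apply: (le_trans key).
have -> : (G (q j.+1) / L ^+ j.+1 - c / L) * L ^+ j.+2 = L * G (q j.+1) - c * L ^+ j.+1.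
  have x0 := Ln j.+1; rewrite [L ^+ j.+2]exprSr; move: x0; set x := L ^+ j.+1 => x0.
  by field; rewrite !gt_eqF.
by [].
Qed.

Lemma no_escape : False.
Proof.
have it N : exists n, beta n <= beta 0%N - N%:R * (c / L).
  elim: N => [|N [n nP]]; first by exists 0%N; rewrite mul0r subr0.
  have [m _ mP] := no_escape_drop n; exists m.
  by apply: (le_trans mP); rewrite -natr1 mulrDl mul1r; lra.
have cL : 0 < c / L by rewrite divr_gt0.
have [n] := it (Num.truncn (beta 0%N / (c / L))).+1.
have b0 : 0 <= beta n by rewrite divr_ge0// exprn_ge0// ltW.
move=> /(le_trans b0); rewrite subr_ge0 -ler_pdivlMr// leNgt => /negP; apply.
by rewrite truncnS_gt.
Qed.

End no_escape.

(** * Expansion of the mass by f *)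

Lemma expr_unbounded (R : realType) (L c M : R) : 1 < L -> 0 < c ->
  exists N, forall n, (N <= n)%N -> M < c * L ^+ n.
Proof.
move=> L1 c0.
have bern n : n%:R * (L - 1) < L ^+ n.
  elim: n => [|n IH]; first by rewrite mul0r expr0.
  rewrite exprS -natr1 mulrDl mul1r.
  have h : 1 <= L ^+ n by rewrite exprn_ege1// ltW.
  have : (L - 1) <= (L - 1) * L ^+ n by rewrite ler_peMr// subr_ge0 ltW.
  by rewrite mulrBl mul1r; lra.
have cL : 0 < c * (L - 1) by rewrite mulr_gt0// subr_gt0.
exists (Num.truncn (M / (c * (L - 1)))).+1 => n Nn.
apply: (@lt_trans _ _ (c * (n%:R * (L - 1)))); last by rewrite ltr_pM2l.
rewrite mulrCA -ltr_pdivrMr//; apply: lt_le_trans (truncnS_gt _) _.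
by rewrite ler_nat.
Qed.

Section no_path.
Context {R : realType} {a b : \bar R} {f : \bar R -> \bar R} {P : set (\bar R)}.
Hypothesis hf : cpmm a b f P.
Hypothesis hmix : topologically_mixing `[a, b] f.
Variables (lam : R) (v : set (\bar R) -> R).
Hypothesis hlam : (1 < lam)%R.
Hypothesis hv : nonneg_eigenvector a b f P lam v.
Implicit Types (x y z t p q u w : \bar R) (A I : set (\bar R)) (s : bool).
Local Open Scope ereal_scope.
Local Notation B := (basic_intervals a b P).
Local Notation mass := (@mass R a b f P lam v).

Let lam0 : (0 < lam)%R. Proof. exact: lt_trans hlam. Qed.
Let m0 A : 0 <= mass A.
Proof. exact: (mass_ge0 hlam hv A). Qed.
Local Hint Resolve m0 : core.

Definition hull x y : set (\bar R) := ioo (Order.min x y) (Order.max x y).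

Lemma hullC x y : hull x y = hull y x.
Proof. by rewrite /hull minC maxC. Qed.

(* Every basic interval between f u and f w is the image of an interval between
   u and w, by the intermediate value theorem. *)
Lemma mass_lipschitz u w : icc a b u -> icc a b w -> P (f u) -> P (f w) ->
  mass (hull (f u) (f w)) <= lam%:E * mass (hull u w).
Proof.
wlog uw : u w / u <= w.
  move=> H uab wab Pu Pw; have [uw|/ltW wu] := leP u w; first exact: H.
  by rewrite hullC (hullC u); apply: H.
move=> uab wab Pu Pw.
have [<-|nuw] := eqVneq u w.
  rewrite {1}/hull minxx maxxx (_ : ioo _ _ = set0) ?(mass_set0 hf hlam hv) ?mule_ge0 ?lee_fin ?(ltW lam0)//.
  by apply/seteqP; split => // t /andP[h1 h2]; have := lt_trans h1 h2; rewrite ltxx.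
have {nuw}uw : u < w by rewrite lt_neqAle nuw.
rewrite [hull u w]/hull min_l ?max_r ?(ltW uw)//.
set H := hull _ _.
have PH1 : P (Order.min (f u) (f w)) by case: leP.
have PH2 : P (Order.max (f u) (f w)) by case: leP.
(* The ends of [H] are in [P], so no basic interval is cut and level 0 already gives the whole
   mass. *)
apply: (@le_trans _ _ (@lmass R a b f P lam v 0 H)).
  rewrite (mass_decomp hf hmix hlam hv); apply: le_esum => J BJ.
  case: ifPn => [_|/asboolP h].
    by rewrite -(mass_basic hf hmix hlam hv BJ); apply: (le_mass hlam hv) => t [].
  rewrite (_ : H `&` J = set0) ?(mass_set0 hf hlam hv)//.
  apply/seteqP; split => // t [Ht Jt]; apply: h.
  have [p [q [g JE]]] := basic_gap hf BJ; rewrite JE in Jt *.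
  have [h1 h2] := gap_sat g PH1 PH2 Jt Ht.
  by move=> r /andP[pr rq]; rewrite /H /hull /ioo /= (le_lt_trans h1 pr) (lt_le_trans rq h2).
rewrite [X in _ <= _ * X](mass_decomp hf hmix hlam hv) -ge0_esumZl ?(ltW lam0)//.
(* [Z I J] is the weight of [J] if the part of [I] between [u] and [w] covers it; the maximum with 0
   is for [esum_exchange]. *)
pose Z I J := if `[< J `<=` f @` (ioo u w `&` I) >] then Order.max 0 (v J)%:E else 0.
have Z0 I J : 0 <= Z I J by rewrite /Z; case: ifPn => // _; rewrite le_max lexx.
apply: (@le_trans _ _ (\esum_(I in B) \esum_(J in B) Z I J)); last first.
  apply: le_esum => I BI; rewrite -(mass_image hf hmix hlam hv BI); last by move=> t [].
  apply: le_trans (le_lmass_mass _ _ 0 _); apply: le_esum => J BJ.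
  rewrite /Z; case: ifPn => // _; rewrite ge_max lexx andbT lee_fin.
  exact/ltW/(eigen_gt0 hf hmix hlam hv).
rewrite esum_exchange//; apply: le_esum => J BJ.
case: ifPn => [/asboolP JH|_]; last by apply: esum_ge0.
have [y Jy] := basic_nonempty hf BJ.
have [x /andP[ux xw] fxy] : exists2 x, u <= x <= w & f x = y.
  have /andP[au _] := uab; have /andP[_ wb] := wab.
  apply: (ereal_ivt (cpmm_continuous hf)) => //; first exact: ltW.
  have /andP := JH _ Jy; case: (leP (f u) (f w)) => _ [/ltW -> /ltW ->] //.
  by rewrite orbT.
have nPy := basic_notP hf BJ Jy.
have ux' : u < x by rewrite lt_neqAle ux andbT; apply: contra_notN nPy => /eqP e; rewrite -fxy -e.
have xw' : x < w by rewrite lt_neqAle xw andbT; apply: contra_notN nPy => /eqP e; rewrite -fxy e.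
have xab : icc a b x by apply: (icc_iccW uab wab); rewrite /icc /= ux.
have [I BI Ix] : exists2 I, B I & I x.
  by apply: (basic_in hf) => // /(cpmm_P hf); rewrite fxy.
apply: le_trans (esum_ge_term _ BI) => //.
rewrite /Z asboolT ?le_max ?lexx ?orbT//.
have [p [q [g IE]]] := basic_gap hf BI; have [pab qab] := gap_icc hf g.
have [Pp Pq pq _] := g; have [px xq] : p < x /\ x < q by move: Ix; rewrite IE => /andP[].
have -> : ioo u w `&` I = ioo (Order.max u p) (Order.min w q).
  rewrite IE; apply/seteqP; split => t; rewrite /ioo /= gt_max lt_min.
    by move=> [/andP[-> ->] /andP[-> ->]].
  by move=> /andP[/andP[-> ->] /andP[-> ->]].
have x1 : Order.max u p < x by rewrite gt_max ux' px.
have x2 : x < Order.min w q by rewrite lt_min xw' xq.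
have im := gap_image hf hmix g (_ : p <= Order.max u p) (lt_trans x1 x2) (_ : Order.min w q <= q).
rewrite im; [|by rewrite le_max lexx orbT|by rewrite ge_min lexx orbT].
have P1 : P (f (Order.max u p)) by case: leP => _ //; exact: (cpmm_P hf).
have P2 : P (f (Order.min w q)) by case: leP => _ //; exact: (cpmm_P hf).
have Pm1 : P (Order.min (f (Order.max u p)) (f (Order.min w q))).
  by case: (leP (f (Order.max u p)) (f (Order.min w q))).
have Pm2 : P (Order.max (f (Order.max u p)) (f (Order.min w q))).
  by case: (leP (f (Order.max u p)) (f (Order.min w q))).
have [p' [q' [g' JE]]] := basic_gap hf BJ; rewrite JE in Jy *.
have yin : ioo (Order.min (f (Order.max u p)) (f (Order.min w q)))
               (Order.max (f (Order.max u p)) (f (Order.min w q))) y.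
  rewrite -im; [|by rewrite le_max lexx orbT|by rewrite ge_min lexx orbT].
  by exists x => //; rewrite /ioo /= x1.
have [h1 h2] := gap_sat g' Pm1 Pm2 Jy yin.
by move=> r /andP[pr rq]; rewrite /ioo /= (le_lt_trans h1 pr) (lt_le_trans rq h2).
Qed.

Lemma mass_lipschitz2 u w : icc a b u -> icc a b w -> P (f u) -> P (f w) ->
  mass (hull (f (f u)) (f (f w))) <= (lam ^+ 2)%:E * mass (hull u w).
Proof.
move=> uab wab Pu Pw.
apply: (@le_trans _ _ (lam%:E * mass (hull (f u) (f w)))).
  by apply: mass_lipschitz; try exact: (cpmm_icc hf); exact: (cpmm_P hf).
rewrite expr2 EFinM -muleA; apply: lee_wpmul2l; rewrite ?lee_fin ?(ltW lam0)//.
exact: mass_lipschitz.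
Qed.

(** A monotone branch takes its extreme values at [p] and [q], which are in [P]; the last clause is
    the intermediate value theorem. It serves to pull points of [P] back along the path. *)
Lemma gap_cover p q p' q' : gap P p q -> gap P p' q' -> ioo p' q' `<=` f @` ioo p q ->
  [/\ exists2 e, p <= e <= q & P e /\ q' <= f e,
      exists2 e, p <= e <= q & P e /\ f e <= p' &
      forall r, p' <= r <= q' -> exists2 e, p <= e <= q & f e = r].
Proof.
move=> g g'; have [Pp Pq pq _] := g; have [_ _ pq' _] := g'.
rewrite (gap_image hf hmix g)// => cov.
have [pab qab] := gap_icc hf g.
have [y ypq'] := ereal_dense pq'.
have Pm1 : P (Order.min (f p) (f q)) by case: leP => _; exact: (cpmm_P hf).
have Pm2 : P (Order.max (f p) (f q)) by case: leP => _; exact: (cpmm_P hf).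
have [h1 h2] := gap_sat g' Pm1 Pm2 ypq' (cov _ ypq').
split.
- move: h2; case: (leP (f p) (f q)) => _ h2; [exists q|exists p] => //; rewrite ?lexx ?(ltW pq)//.
- move: h1; case: (leP (f p) (f q)) => _ h1; [exists p|exists q] => //; rewrite ?lexx ?(ltW pq)//.
- move=> r /andP[p'r rq'].
  have /andP[ap _] := pab; have /andP[_ qb] := qab.
  apply: (ereal_ivt (cpmm_continuous hf)) => //; first exact: ltW.
  move: h1 h2; case: (leP (f p) (f q)) => _ h1 h2.
    by rewrite (le_trans h1 p'r) (le_trans rq' h2).
  by rewrite (le_trans h1 p'r) (le_trans rq' h2) orbT.
Qed.

Lemma gap_extrema p q x : gap P p q -> ioo p q x ->
  (exists2 e, p <= e <= q & P e /\ f e <= f x) /\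
  (exists2 e, p <= e <= q & P e /\ f x <= f e).
Proof.
move=> g /andP[px xq]; have [s sP] := gap_mono hf hmix g; have [Pp Pq pq _] := g.
have h1 := sP _ _ (lexx p) px (ltW xq); have h2 := sP _ _ (ltW px) xq (lexx q).
case: s {sP} h1 h2 => /ltW h1 /ltW h2; split.
- by exists p; rewrite ?lexx ?(ltW pq).
- by exists q; rewrite ?lexx ?(ltW pq).
- by exists q; rewrite ?lexx ?(ltW pq).
- by exists p; rewrite ?lexx ?(ltW pq).
Qed.

End no_path.

(** * Paths of basic intervals with growing weight *)

Section growing_path.
Context {R : realType} {a b : \bar R} {f : \bar R -> \bar R} {P : set (\bar R)}.
Hypothesis hf : cpmm a b f P.
Hypothesis hmix : topologically_mixing `[a, b] f.
Variables (lam : R) (v : set (\bar R) -> R).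
Hypothesis hlam : (1 < lam)%R.
Hypothesis hv : nonneg_eigenvector a b f P lam v.
Implicit Types (x y z t u w : \bar R) (A I : set (\bar R)) (s : bool).
Local Open Scope ereal_scope.
Local Notation B := (basic_intervals a b P).
Local Notation mass := (@mass R a b f P lam v).

Variables (c : R) (p q : nat -> \bar R).
Hypothesis c0 : (0 < c)%R.
Hypothesis pqP : forall n, [/\ gap P (p n) (q n),
  ioo (p n.+1) (q n.+1) `<=` f @` ioo (p n) (q n) &
  (c * lam ^+ n <= v (ioo (p n) (q n)))%R].

Let lam0 : (0 < lam)%R. Proof. exact: lt_trans hlam. Qed.
Let m0 A : 0 <= mass A.
Proof. exact: (mass_ge0 hlam hv A). Qed.
Local Hint Resolve m0 : core.
Let gapn n : gap P (p n) (q n). Proof. by have [] := pqP n. Qed.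
Let ltpq n : p n < q n. Proof. by have [] := gapn n. Qed.

Lemma path_mass n : (c * lam ^+ n)%:E <= mass (ioo (p n) (q n)).
Proof.
have [g _ h] := pqP n.
by rewrite (mass_basic hf hmix hlam hv (gap_basic hf g)) lee_fin.
Qed.

(** The masses of the intervals of the path tend to infinity. *)
Lemma path_bounded A : mass A < +oo ->
  exists N, forall n, (N <= n)%N -> ~ (ioo (p n) (q n) `<=` A).
Proof.
move=> Afin; have [N NP] := expr_unbounded (fine (mass A)) hlam c0.
exists N => n /NP h sub.
have := le_trans (path_mass n) (le_mass hlam hv sub).
by rewrite -[mass A]fineK ?ge0_fin_numE// lee_fin leNgt h.
Qed.

Lemma path_leaves_point y : exists N, forall n, (N <= n)%N -> ~ ioo (p n) (q n) y.
Proof.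
have [[I BI Iy]|nI] := pselect (exists2 I, B I & I y); last first.
  by exists 0%N => n _ Iy; apply: nI; exists (ioo (p n) (q n)) => //; exact: (gap_basic hf).
have [|N NP] := @path_bounded I.
  by rewrite (mass_basic hf hmix hlam hv BI) ltry.
exists N => n /NP h Jy; apply: h.
by rewrite (basic_disj hf BI (gap_basic hf (gapn n)) Iy Jy).
Qed.

Lemma path_escape u w : a < u -> u <= w -> w < b ->
  exists N, forall n, (N <= n)%N -> q n <= u \/ w <= p n.
Proof.
move=> au uw wb.
(* The room around [[u, w]] is needed: an interval of the path that avoids [u'] and [w'] but reaches
   between [u] and [w] lies inside []u', w'[], whose mass is finite. *)
have [u' /andP[au' uu']] := ereal_dense au; have [w' /andP[ww' wb']] := ereal_dense wb.
have [|N1 N1P] := @path_bounded (ioo u' w').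
  by apply: (mass_fin hf hmix hlam hv) => //; apply: (lt_trans uu'); exact: le_lt_trans ww'.
have [N2 N2P] := path_leaves_point u'; have [N3 N3P] := path_leaves_point w'.
exists (maxn N1 (maxn N2 N3)) => n; rewrite !geq_max => /and3P[/N1P h1 /N2P h2 /N3P h3].
have [?|uq] := leP (q n) u; first by left.
have [?|pw] := leP w (p n); first by right.
have u'p : u' <= p n.
  by rewrite leNgt; apply/negP => pu'; apply: h2; rewrite /ioo /= pu' (lt_trans uu' uq).
have qw' : q n <= w'.
  by rewrite leNgt; apply/negP => pu'; apply: h3; rewrite /ioo /= pu' (lt_trans pw ww').
case: h1 => t /andP[pt tq]; rewrite /ioo /=.
by rewrite (le_lt_trans u'p pt) (lt_le_trans tq qw').
Qed.

(* [s] selects the end of [a, b]: the right one, b, when [s]. *)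
Definition near_end s n t := if s then t <= p n else q n <= t.
Definition endpt s := if s then b else a.

(** In the long run it does not matter which interior point is used to tell the two ends apart. *)
Lemma path_near s t t' : ioo a b t -> ioo a b t' ->
  exists N, forall n, (N <= n)%N -> near_end s n t -> near_end s n t'.
Proof.
move=> /andP[at_ tb] /andP[at' tb'].
have [|||N NP] := @path_escape (Order.min t t') (Order.max t t').
- by rewrite lt_min at_.
- by rewrite ge_min !le_max lexx.
- by rewrite gt_max tb.
exists N => n /NP; rewrite le_min ge_max /near_end; case: s => -[|] /andP[h1 h2] // h3.
- by have := lt_le_trans (ltpq n) (le_trans h1 h3); rewrite ltxx.
- by have := lt_le_trans (ltpq n) (le_trans h3 h1); rewrite ltxx.
Qed.

Lemma path_side t : ioo a b t -> exists N, forall n, (N <= n)%N ->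
  exists s, near_end s n t.
Proof.
move=> /andP[at_ tb]; have [N NP] := path_escape at_ (lexx t) tb.
by exists N => n /NP[h|h]; [exists false|exists true].
Qed.

Lemma near_end_uniq s s' n t : near_end s n t -> near_end s' n t -> s = s'.
Proof.
case: s s' => [] [] //= h1 h2.
  by have := lt_le_trans (ltpq n) (le_trans h2 h1); rewrite ltxx.
by have := lt_le_trans (ltpq n) (le_trans h1 h2); rewrite ltxx.
Qed.

Lemma path_cont s (N : set (\bar R)) : nbhs (f (endpt s)) N ->
  exists2 t, ioo a b t & forall n, near_end s n t -> ioo (p n.+1) (q n.+1) `<=` N.
Proof.
have ab := cpmm_lt hf.
have key t : (forall n, near_end s n t -> forall z, ioo (p n) (q n) z -> N (f z)) ->
    forall n, near_end s n t -> ioo (p n.+1) (q n.+1) `<=` N.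
  by move=> h n nt y yn; have [_ sub _] := pqP n; have [z zn <-] := sub _ yn; apply: h nt _ zn.
move=> fN; suff [t tab h] : exists2 t, ioo a b t &
    forall n, near_end s n t -> forall z, ioo (p n) (q n) z -> N (f z).
  by exists t => //; exact: key.
case: s fN {key} => /= fN.
- have [|w /andP[aw wb] wN] := within_left (cpmm_within hf) _ fN; first by rewrite ab lexx.
  have [t /andP[wt tb]] := ereal_dense wb; exists t; first by rewrite /ioo /= tb (le_lt_trans aw).
  move=> n tp z /andP[pz zq]; apply: wN; rewrite (lt_trans (lt_le_trans wt tp) pz).
  by have [_ /andP[_ qb]] := gap_icc hf (gapn n); rewrite (le_trans (ltW zq)).
- have [|w /andP[aw wb] wN] := within_right (cpmm_within hf) _ fN; first by rewrite ab lexx.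
  have [t /andP[at_ tw]] := ereal_dense aw; exists t; first by rewrite /ioo /= at_ (lt_le_trans tw).
  move=> n qt z /andP[pz zq]; apply: wN; rewrite (lt_trans zq (le_lt_trans qt tw)) andbT.
  by have [/andP[ap _] _] := gap_icc hf (gapn n); rewrite (le_trans ap (ltW pz)).
Qed.

Variable x0 : \bar R.
Hypothesis x0ab : ioo a b x0.

Definition infinitely_near s := forall N, exists2 n, (N <= n)%N & near_end s n x0.

(** Were the end mapped into []a, b[], continuity would bring infinitely many intervals of the path
    into a compact part of []a, b[], which the path leaves. *)
Lemma infinitely_near_end s : infinitely_near s -> exists s', f (endpt s) = endpt s'.
Proof.
move=> io; apply: contrapT => ns.
have /andP[af fb] : icc a b (f (endpt s)).
  by apply: (cpmm_icc hf); case: s {io ns}; [exact: (icc_b hf)|exact: (icc_a hf)].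
have af' : a < f (endpt s).
  by rewrite lt_neqAle af andbT; apply: contra_notN ns => /eqP e; exists false.
have fb' : f (endpt s) < b.
  by rewrite lt_neqAle fb andbT; apply: contra_notN ns => /eqP e; exists true.
have [u /andP[au uf]] := ereal_dense af'; have [w /andP[fw wb]] := ereal_dense fb'.
have [|t tab tP] := @path_cont s (ioo u w).
  by apply: open_nbhs_nbhs; split; [exact: ioo_open|rewrite /ioo /= uf].
have [N1 N1P] := path_escape au (ltW (lt_trans uf fw)) wb.
have [N2 N2P] := path_near s x0ab tab.
have [n] := io (maxn N1 N2); rewrite geq_max => /andP[n1 /N2P h /h /tP sub].
have [z znn] := ereal_dense (ltpq n.+1); have /andP[uz zw] := sub _ znn.
case/andP: znn => pz zq; have [h1|h1] := N1P n.+1 (leqW n1).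
  by have := lt_trans uz (lt_le_trans zq h1); rewrite ltxx.
by have := lt_trans zw (le_lt_trans h1 pz); rewrite ltxx.
Qed.

Lemma near_end_step s s' : f (endpt s) = endpt s' ->
  exists N, forall n, (N <= n)%N -> near_end s n x0 -> near_end s' n.+1 x0.
Proof.
move=> fs; have /andP[ax xb] := x0ab.
have [|t tab tP] := @path_cont s (if s' then [set y | x0 < y] else [set y | y < x0]).
  by rewrite fs; case: s' {fs} => /=; [exact: ereal_nbhs_gt|exact: ereal_nbhs_lt].
have [N NP] := path_near s x0ab tab; exists N => n /NP h /h /tP {h}.
case: s' {fs tP} => /= sub; rewrite leNgt; apply/negP => h.
- have [|z /andP[pz]] := @ereal_dense R (p n.+1) (Order.min x0 (q n.+1)); first by rewrite lt_min h ltpq.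
  rewrite lt_min => /andP[zx zq]; have /= := sub z; rewrite /ioo /= pz zq => /(_ isT) xz.
  by have := lt_trans zx xz; rewrite ltxx.
- have [|z /andP[]] := @ereal_dense R (Order.max x0 (p n.+1)) (q n.+1); first by rewrite gt_max h ltpq.
  rewrite gt_max => /andP[zx zq] pz; have /= := sub z; rewrite /ioo /= pz zq => /(_ isT) xz.
  by have := lt_trans zx xz; rewrite ltxx.
Qed.

Lemma infinitely_near_step s s' : f (endpt s) = endpt s' -> infinitely_near s -> infinitely_near s'.
Proof.
move=> /near_end_step[N NP] io M; have [n] := io (maxn M N).
by rewrite geq_max => /andP[Mn /NP h /h ns]; exists n.+1 => //; exact: leqW.
Qed.

(** The ends [s], [s'], [s''] follow each other under [f]. If [s''] differed from [s], it would
    equal [s'], and the path would stay near [s'] from some time on, against its returns to [s]. *)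
Lemma infinitely_near_fix s : infinitely_near s -> f (f (endpt s)) = endpt s /\
  exists N, forall n, (N <= n)%N -> near_end s n x0 -> near_end s n.+2 x0.
Proof.
move=> io; have [s' fs] := infinitely_near_end io.
have io' := infinitely_near_step fs io.
have [s'' fs'] := infinitely_near_end io'.
have [N1 N1P] := near_end_step fs; have [N2 N2P] := near_end_step fs'.
suff e : s'' = s.
  rewrite fs fs' e; split => //; exists (maxn N1 N2) => n.
  by rewrite geq_max => /andP[/N1P h1 n2] /h1 h; rewrite -e; apply: N2P => //; exact: leqW.
have [ss|ss'] := eqVneq s s'.
  have e : endpt s'' = endpt s by rewrite -fs' -ss fs ss.
  by move: e; rewrite /endpt; case: s'' s {io ss fs fs' io' N1P N2P} => [] [] // e;
    have := cpmm_lt hf; rewrite e ltxx.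
apply: contrapT => ns.
have e : s'' = s' by move: ss' ns; case: (s) (s') (s'') => [] [] [].
have [n1 n1N n1s] := io' N2.
have stay n : (n1 <= n)%N -> near_end s' n x0.
  move=> n1n; rewrite -(subnK n1n); elim: (n - n1)%N => [|k IH] //.
  rewrite addSn -{1}e; apply: N2P => //; exact: (leq_trans n1N (leq_addl _ _)).
have [n /stay h1 h2] := io n1.
by rewrite (near_end_uniq h2 h1) eqxx in ss'.
Qed.

Lemma infinitely_near_some : exists s, infinitely_near s.
Proof.
have [io|nio] := pselect (infinitely_near true); first by exists true.
exists false => N; move/existsNP : nio => [M MP].
have [N1 N1P] := path_side x0ab.
exists (maxn N (maxn M N1)); first exact: leq_maxl.
have [|[] h //] := N1P (maxn N (maxn M N1)).
  by rewrite (leq_trans (leq_maxr M N1))// leq_maxr.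
case: MP; exists (maxn N (maxn M N1)) => //.
by rewrite (leq_trans (leq_maxl M N1))// leq_maxr.
Qed.

(** Comparisons oriented towards the end [s], so that one argument serves both ends. *)
Definition les s x y := if s then x <= y else y <= x.
Definition lts s x y := if s then x < y else y < x.

Lemma lesNlt s x y : ~ les s x y <-> lts s y x.
Proof. by case: s => /=; split=> [/negP|h]; try apply/negP; rewrite -ltNge. Qed.

Lemma les_lt_trans s x y z : les s x y -> lts s y z -> lts s x z.
Proof. by case: s => /= h1 h2; [exact: le_lt_trans h2|exact: lt_le_trans h1]. Qed.

Lemma lts_le_trans s x y z : lts s x y -> les s y z -> lts s x z.
Proof. by case: s => /= h1 h2; [exact: lt_le_trans h2|exact: le_lt_trans h1]. Qed.

Lemma les_trans s x y z : les s x y -> les s y z -> les s x z.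
Proof. by case: s => /= h1 h2; [exact: le_trans h2|exact: le_trans h1]. Qed.

Lemma ltsW s x y : lts s x y -> les s x y.
Proof. by case: s => /ltW. Qed.

Lemma lts_neq s x y : les s x y -> x <> y -> lts s x y.
Proof. by case: s => /= h /eqP n; rewrite lt_neqAle h ?andbT// eq_sym. Qed.

Lemma ltsxx s x : ~ lts s x x.
Proof. by case: s => /=; rewrite ltxx. Qed.

Lemma les_endpt s x : icc a b x -> les s x (endpt s).
Proof. by move=> /andP[]; case: s. Qed.

(* Without such a point the part of [a, b] beyond t would be invariant under the
   second iterate. *)
Lemma dip_point s t : f (f (endpt s)) = endpt s -> P t -> ioo a b t ->
  exists z, [/\ icc a b z, P (f z), les s t z, lts s z (endpt s) & lts s (f (f z)) t].
Proof.
move=> fix2 Pt tab; have /andP[at_ tb] := tab.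
have [z0 [z0ab tz0 hz0]] : exists z0, [/\ icc a b z0, les s t z0 & ~ les s t (f (f z0))].
  apply: contrapT => nz.
  have inv z : icc a b z -> les s t z -> les s t (f (f z)).
    by move=> zab tz; apply: contrapT => h; apply: nz; exists z.
  have [aab bab] := (icc_a hf, icc_b hf); have tab' := ioo_icc hf tab.
  case: s fix2 inv {nz} => /= fix2 inv.
  - apply: (mixing_inv2 hf hmix inv tab' bab tb _ aab tab' at_).
      by move=> z /andP[/ltW].
    by move=> z /andP[_ zt] /= tz; have := lt_le_trans zt tz; rewrite ltxx.
  - apply: (mixing_inv2 hf hmix inv aab tab' at_ _ tab' bab tb).
      by move=> z /andP[_ /ltW].
    by move=> z /andP[tz _] /= zt; have := lt_le_trans tz zt; rewrite ltxx.
have tend : lts s t (endpt s) by case: (s).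
have z0end : lts s z0 (endpt s).
  apply: lts_neq; first exact: les_endpt.
  by move=> e; apply: hz0; rewrite e fix2; exact: ltsW.
have {}hz0 : lts s (f (f z0)) t by exact/lesNlt.
have [Pfz0|nPfz0] := pselect (P (f z0)); first by exists z0.
have nPz0 : ~ P z0 by move=> /(cpmm_P hf).
(* To arrange [P (f z)], replace [f z0] by an end [r] of its basic interval whose image is no closer
   to the end [s], and lift [r] to the closure of the basic interval of [z0]. *)
have [p1 [q1 [g z0pq _]]] := gap_around (cpmm_closed hf) (cpmm_left hf) (cpmm_right hf) z0ab nPz0.
have [p2 [q2 [g' fz0pq _]]] :=
  gap_around (cpmm_closed hf) (cpmm_left hf) (cpmm_right hf) (cpmm_icc hf z0ab) nPfz0.
have cov : ioo p2 q2 `<=` f @` ioo p1 q1.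
  exact: (basic_image_sat hf hmix (gap_basic hf g) (gap_basic hf g') z0pq fz0pq).
have [r r2 [Pr fr]] : exists2 r, p2 <= r <= q2 & P r /\ les s (f r) (f (f z0)).
  by have [h1 h2] := gap_extrema hf hmix g' fz0pq; case: (s).
have [_ _ /(_ _ r2)[z1 z1pq fz1]] := gap_cover hf hmix g g' cov.
have [p1ab q1ab] := gap_icc hf g.
have z1ab : icc a b z1 by apply: (icc_iccW p1ab q1ab).
have ht : lts s (f (f z1)) t by rewrite fz1; exact: les_lt_trans hz0.
exists z1; split => //; first by rewrite fz1.
(* As [t] is in [P], it does not cut the basic interval of [z0], whose closure therefore stays
   beyond [t]. *)
- have [Pp1 Pq1 _ gp] := g; move: z0pq z1pq => /andP[pz zq] /andP[pz1 zq1].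
  case: (s) tz0 => /= tz0.
    apply: le_trans pz1; rewrite leNgt; apply/negP => pt; apply: (gp t) => //.
    by rewrite pt (le_lt_trans tz0 zq).
  apply: (le_trans zq1); rewrite leNgt; apply/negP => pt; apply: (gp t) => //.
  by rewrite pt (lt_le_trans pz tz0).
- apply: lts_neq; first exact: les_endpt.
  move=> e; rewrite e fix2 in ht; apply: (@ltsxx s t); exact: lts_le_trans tend (ltsW ht).
Qed.

(** At most one basic interval abuts the end, and the path leaves each of its points for good. *)
Lemma path_avoids_endpt s : exists N, forall n, (N <= n)%N ->
  (if s then q n else p n) <> endpt s.
Proof.
have [[n1 n1P]|nn] := pselect (exists n1, (if s then q n1 else p n1) = endpt s); last first.
  by exists 0%N => n _ e; apply: nn; exists n.
have [y ypq] := ereal_dense (ltpq n1).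
have [N NP] := path_leaves_point y; exists N => n /NP ny e; apply: ny.
have [Pp Pq _ _] := gapn n.
case: s n1P e => /= n1P e.
- have [|z /andP[]] := @ereal_dense R (Order.max (p n) y) b.
    by rewrite gt_max -{1}e ltpq /= -n1P; case/andP: ypq.
  rewrite gt_max => /andP[pz yz] zb; have [] := @gap_sat _ P (p n1) (q n1) (p n) (q n) z (gapn n1) Pp Pq.
  + by rewrite /ioo /= n1P zb andbT; apply: lt_trans yz; case/andP: ypq.
  + by rewrite /ioo /= e pz.
  + by move=> h _; rewrite /ioo /= e -n1P (le_lt_trans h); case/andP: ypq.
- have [|z /andP[az]] := @ereal_dense R a (Order.min (q n) y).
    by rewrite lt_min -{1}e ltpq /= -n1P; case/andP: ypq.
  rewrite lt_min => /andP[pz yz]; have [] := @gap_sat _ P (p n1) (q n1) (p n) (q n) z (gapn n1) Pp Pq.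
  + by rewrite /ioo /= n1P az /=; apply: (lt_trans yz); case/andP: ypq.
  + by rewrite /ioo /= e pz andbT.
  + by move=> _ h; rewrite /ioo /= e -n1P (lt_le_trans _ h) ?andbT; case/andP: ypq.
Qed.

Lemma germ_mass_fin s y x : ioo a b y -> lts s x (endpt s) -> mass (germ s y x) < +oo.
Proof.
move=> /andP[ay yb]; case: s => /= h.
- have [yx|xy] := ltP y x; first exact: (mass_fin hf hmix hlam hv).
  rewrite (_ : ioo _ _ = set0) ?(mass_set0 hf hlam hv)//.
  by apply/seteqP; split => // t /andP[h1 h2]; have := lt_trans h1 (lt_le_trans h2 xy); rewrite ltxx.
- have [yx|xy] := ltP x y; first exact: (mass_fin hf hmix hlam hv).
  rewrite (_ : ioo _ _ = set0) ?(mass_set0 hf hlam hv)//.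
  by apply/seteqP; split => // t /andP[h1 h2]; have := lt_trans h1 (lt_le_trans h2 xy); rewrite ltxx.
Qed.

(** At this stage a mass can be cut at a point of [P] by [split_P], hence the condition on [x1]. *)
Lemma germ_mass_triangle s y x1 x2 : icc a b y -> icc a b x2 -> P x1 ->
  mass (germ s y x2) <= mass (germ s y x1) + mass (hull x1 x2).
Proof.
move=> yab x2ab Px1; have x1ab := cpmm_P_icc hf Px1.
have sp := split_P hf hmix hlam hv Px1.
case: s => /=.
- have [x21|x12] := leP x2 x1.
    apply: (@le_trans _ _ (mass (ioo y x1))); last by rewrite leeDl.
    by apply: (le_mass hlam hv) => t /andP[h1 h2]; rewrite /ioo /= h1 (lt_le_trans h2).
  rewrite /hull min_l ?max_r ?(ltW x12)//.
  have [x1y|yx1] := leP x1 y.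
    apply: (@le_trans _ _ (mass (ioo x1 x2))); last by rewrite leeDr.
    by apply: (le_mass hlam hv) => t /andP[h1 h2]; rewrite /ioo /= h2 (le_lt_trans x1y).
  by have := sp _ _ yab x2ab yx1 x12; rewrite adde0.
- have [x21|x12] := leP x1 x2.
    apply: (@le_trans _ _ (mass (ioo x1 y))); last by rewrite leeDl.
    by apply: (le_mass hlam hv) => t /andP[h1 h2]; rewrite /ioo /= h2 (le_lt_trans x21).
  rewrite /hull min_r ?max_l ?(ltW x12)//.
  have [x1y|yx1] := leP y x1.
    apply: (@le_trans _ _ (mass (ioo x2 x1))); last by rewrite leeDr.
    by apply: (le_mass hlam hv) => t /andP[h1 h2]; rewrite /ioo /= h1 (lt_le_trans h2).
  by have := sp _ _ x2ab yab x12 yx1; rewrite adde0 addeC.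
Qed.

Lemma germ_mass_super s y x1 x2 : les s y x1 -> les s x1 x2 ->
  mass (germ s y x1) + mass (hull x1 x2) <= mass (germ s y x2).
Proof.
case: s => /= h1 h2; apply: (mass_super hf hmix hlam hv).
- by move=> t /andP[yt tx]; rewrite /ioo /= yt (lt_le_trans tx).
- rewrite /hull min_l// max_r// => t /andP[yt tx]; by rewrite /ioo /= tx (le_lt_trans h1).
- rewrite /hull min_l// max_r//; apply/seteqP; split => // t [/andP[_ h] /andP[h' _]].
  by have := lt_trans h h'; rewrite ltxx.
- by move=> t /andP[yt tx]; rewrite /ioo /= tx (le_lt_trans h2).
- rewrite /hull min_r// max_l// => t /andP[yt tx]; by rewrite /ioo /= yt (lt_le_trans tx).
- rewrite /hull min_r// max_l//; apply/seteqP; split => // t [/andP[h _] /andP[_ h']].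
  by have := lt_trans h h'; rewrite ltxx.
Qed.

End growing_path.

(** * Additivity of the mass and absence of atoms *)

(* [no_escape] and its mirror image, the latter in the dual order. *)
Lemma no_escape_side (R : realType) (s : bool) (h : \bar R -> \bar R) (G : \bar R -> R)
    (X : set (\bar R)) (y z : \bar R) (p q e : nat -> \bar R) (L c : R) :
  1 < L -> 0 < c ->
  (forall n, [/\ les s y (p n), lts s (p n) (q n) & lts s (q n) z]) ->
  (forall n m, [\/ p n = p m /\ q n = q m, les s (q n) (p m) | les s (q m) (p n)]) ->
  (forall t, lts s t z -> exists N, forall n, (N <= n)%N -> les s t (p n)) ->
  (forall n, c * L ^+ n <= G (q n) - G (p n)) ->
  (forall n, [/\ X (e n), les s (p n) (e n), les s (e n) (q n) & les s (q n.+1) (h (e n))]) ->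
  (forall x, 0 <= G x) ->
  (forall x x', les s x x' -> lts s x' z -> G x <= G x') ->
  (forall u w, X u -> X w -> les s y u -> les s u w -> lts s w z ->
    `|G (h w) - G (h u)| <= L * (G w - G u)) ->
  (forall x, X x -> les s y x -> lts s x z -> lts s (h x) z) ->
  X y -> les s (h y) y -> lts s y z ->
  (forall k, exists x, [/\ X x, les s (q k) x, lts s x z & lts s (h x) (q k)]) ->
  False.
Proof.
case: s => /=; first exact: (@no_escape _ (\bar R) R h G X y z p q e L c).
exact: (@no_escape _ ((\bar R)^d)%type R h G X y z p q e L c).
Qed.

Section no_growing_path.
Context {R : realType} {a b : \bar R} {f : \bar R -> \bar R} {P : set (\bar R)}.
Hypothesis hf : cpmm a b f P.
Hypothesis hmix : topologically_mixing `[a, b] f.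
Variables (lam : R) (v : set (\bar R) -> R).
Hypothesis hlam : (1 < lam)%R.
Hypothesis hv : nonneg_eigenvector a b f P lam v.
Implicit Types (x y z t u w : \bar R) (A I : set (\bar R)) (s : bool).
Local Open Scope ereal_scope.
Local Notation B := (basic_intervals a b P).
Local Notation mass := (@mass R a b f P lam v).

Local Notation ept := (@endpt R a b).

Let lam0 : (0 < lam)%R. Proof. exact: lt_trans hlam. Qed.
Let m0 A : 0 <= mass A.
Proof. exact: (mass_ge0 hlam hv A). Qed.
Local Hint Resolve m0 : core.

(** The conditions of [no_escape_side] are checked for the second iterate, along every second
    interval of the path. *)
Lemma no_gap_path (c : R) (p q : nat -> \bar R) : (0 < c)%R ->
  ~ (forall n, [/\ gap P (p n) (q n),
      ioo (p n.+1) (q n.+1) `<=` f @` ioo (p n) (q n) &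
      (c * lam ^+ n <= v (ioo (p n) (q n)))%R]).
Proof.
move=> c0 pqP.
have gapn n : gap P (p n) (q n) by have [] := pqP n.
have ltpq n : p n < q n by have [] := gapn n.
have [p0 Pp0 p0ab] := P_interior hf hmix.
have [s io] := infinitely_near_some hf hmix hlam hv c0 pqP p0ab.
have [fix2 [N1 N1P]] := infinitely_near_fix hf hmix hlam hv c0 pqP p0ab io.
(* The point [s0] serves as origin: its image is in [P], and its second image lies behind [p0],
   hence behind [s0]. *)
have [s0 [s0icc Ps0 p0s0 s0e hs0]] := dip_point hf hmix fix2 Pp0 p0ab.
have s0ab : ioo a b s0.
  case/andP: p0ab => ap0 p0b; case: (s) p0s0 s0e => /= h1 h2; rewrite /ioo /= h2 ?andbT.
    exact: lt_le_trans h1.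
  exact: le_lt_trans p0b.
have hs0' : les s (f (f s0)) s0 := ltsW (lts_le_trans hs0 p0s0).
have [N2 N2P] := path_near hf hmix hlam hv c0 pqP s p0ab s0ab.
have [N3 N3P] := path_avoids_endpt hf hmix hlam hv c0 pqP s.
have [n0] := io (maxn N1 (maxn N2 N3)); rewrite !geq_max => /and3P[n01 n02 n03] near0.
(* Start at a time [n0] at which the path is near the fixed end; [infinitely_near_fix] then keeps
   every second interval there. *)
pose idx k := (k.*2 + n0)%N.
have idx0 k : (n0 <= idx k)%N by rewrite leq_addl.
have stay k : near_end p q s (idx k) p0.
  elim: k => [|k IH]; first by rewrite /idx.
  by apply: N1P IH; apply: leq_trans n01 (idx0 k).
pose lo k := if s then p (idx k) else q (idx k).
pose hi k := if s then q (idx k) else p (idx k).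
have hull_lohi k : hull (lo k) (hi k) = ioo (p (idx k)) (q (idx k)).
  rewrite /hull /lo /hi; case: (s); first by rewrite min_l ?max_r// ltW.
  by rewrite min_r ?max_l// ltW.
have lohi k : lts s (lo k) (hi k) by rewrite /lo /hi; case: (s); exact: ltpq.
have s0lo k : les s s0 (lo k).
  have : near_end p q s (idx k) s0 by apply: N2P => //; exact: leq_trans n02 (idx0 k).
  by rewrite /near_end /lo; case: (s).
have hi_icc k : icc a b (hi k).
  by rewrite /hi; have [h1 h2] := gap_icc hf (gapn (idx k)); case: (s).
have hiend k : lts s (hi k) (ept s).
  apply: lts_neq; first exact: les_endpt.
  by rewrite /hi; apply: N3P; exact: leq_trans n03 (idx0 k).
pose G x := fine (mass (germ s s0 x)).
pose X : set (\bar R) := [set x | icc a b x /\ P (f x)].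
have Gfin x : lts s x (ept s) -> mass (germ s s0 x) = (G x)%:E.
  by move=> xe; rewrite fineK// ge0_fin_numE//; exact: germ_mass_fin.
have Gsuper u w : les s s0 u -> les s u w -> lts s w (ept s) ->
    mass (hull u w) <= (G w - G u)%:E.
  move=> s0u uw we; have := germ_mass_super hf hmix hlam hv s0u uw.
  rewrite (Gfin u (les_lt_trans uw we)) (Gfin w we).
  by rewrite addeC -leeBrDr// EFinB.
have hicc x : icc a b x -> icc a b (f (f x)) by move=> xab; exact: (cpmm_iter_icc hf 2).
(* Were the end reached at [x], [mass_lipschitz2] would make the mass up to the end finite, although
   that part contains intervals of the path of arbitrarily large mass. *)
have hb x : X x -> les s s0 x -> lts s x (ept s) -> lts s (f (f x)) (ept s).
  move=> [xab Px] s0x xe; apply: lts_neq; first exact/les_endpt/hicc.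
  move=> e.
  have fin : mass (hull (f (f s0)) (ept s)) < +oo.
    rewrite -e; apply: le_lt_trans (mass_lipschitz2 hf hmix hlam hv s0icc xab Ps0 Px) _.
    apply: lte_mul_pinfty; rewrite ?lee_fin ?exprn_ge0 ?(ltW lam0)//.
    by apply: le_lt_trans (Gsuper _ _ _ s0x xe) (ltry _); case: (s) => /=.
  have [N NP] := path_bounded hf hmix hlam hv c0 pqP fin.
  apply: (NP (idx N)); first by rewrite /idx -addnn -addnA leq_addr.
  rewrite -hull_lohi => t; have := s0lo N; have := hiend N; have := lohi N.
  rewrite /hull; move: hs0' s0e; case: (s) => /= h1 h2 h3 h4 h5.
    rewrite !min_l ?max_r ?(ltW h3) ?(ltW h4) ?(ltW (le_lt_trans h1 h2))// => /andP[lt_ th].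
    by rewrite /ioo /= (lt_trans th h4) (le_lt_trans (le_trans h1 h5) lt_).
  rewrite !min_r ?max_l ?(ltW h3) ?(ltW h4) ?(ltW (lt_le_trans h2 h1))// => /andP[lt_ th].
  by rewrite /ioo /= (lt_trans h4 lt_) (lt_le_trans th (le_trans h5 h1)).
(* Take an end of the interval at time [n.+1] whose image is beyond [hi k.+1], and pull it back to
   the closure of the interval at time [n]. *)
have /choice[e eP] : forall k, exists e, [/\ X e, les s (lo k) e, les s e (hi k) &
    les s (hi k.+1) (f (f e))].
  move=> k; set n := idx k.
  have [_ sub1 _] := pqP n; have [_ sub2 _] := pqP n.+1.
  have [c1 c2 _] := gap_cover hf hmix (gapn n.+1) (gapn n.+2) sub2.
  have [e1 e1pq [Pe1 he1]] : exists2 e1, p n.+1 <= e1 <= q n.+1 & P e1 /\ les s (hi k.+1) (f e1).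
    by rewrite /hi /idx doubleS !addSn -/(idx k) -/n; case: (s).
  have [_ _ /(_ _ e1pq)[e0 e0pq fe0]] := gap_cover hf hmix (gapn n) (gapn n.+1) sub1.
  have [pab qab] := gap_icc hf (gapn n).
  exists e0; rewrite fe0; split => //.
  - by split; [exact: (icc_iccW pab qab)|rewrite fe0].
  - by rewrite /lo -/n; case/andP: e0pq; case: (s).
  - by rewrite /hi -/n; case/andP: e0pq; case: (s).
apply: (@no_escape_side R s (fun x => f (f x)) G X s0 (ept s) lo hi e (lam ^+ 2) (c * lam ^+ n0)).
- by rewrite exprn_egt1.
- by rewrite mulr_gt0// exprn_gt0.
- by move=> n; split.
- move=> n m; have [Pp Pq _ _] := gapn (idx n); have [Pp' Pq' _ _] := gapn (idx m).
  have [qp|pq] := leP (q (idx n)) (p (idx m)).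
    by move: qp; rewrite /lo /hi; case: (s) => /= qp; [constructor 2|constructor 3].
  have [qp|pq'] := leP (q (idx m)) (p (idx n)).
    by move: qp; rewrite /lo /hi; case: (s) => /= qp; [constructor 3|constructor 2].
  have [|z /andP[]] := @ereal_dense R (Order.max (p (idx n)) (p (idx m))) (Order.min (q (idx n)) (q (idx m))).
    by rewrite gt_max !lt_min pq pq' !ltpq.
  rewrite gt_max lt_min => /andP[pz pz'] /andP[qz qz'].
  have zn : ioo (p (idx n)) (q (idx n)) z by rewrite /ioo /= pz.
  have zm : ioo (p (idx m)) (q (idx m)) z by rewrite /ioo /= pz'.
  have [h1 h2] := gap_sat (gapn _) Pp Pq zm zn; have [h3 h4] := gap_sat (gapn _) Pp' Pq' zn zm.
  have e1 : p (idx n) = p (idx m) by apply/le_anti; rewrite h1 h3.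
  have e2 : q (idx n) = q (idx m) by apply/le_anti; rewrite h2 h4.
  by constructor 1; rewrite /lo /hi; case: (s).
- move=> t te; pose t' := if s then Order.max t s0 else Order.min t s0.
  have t'ab : ioo a b t'.
    move: s0ab te; rewrite /t' => /andP[as0 s0b]; case: (s) => /= te; rewrite /ioo /=.
      by rewrite lt_max gt_max as0 s0b te orbT.
    by rewrite lt_min gt_min as0 s0b te orbT.
  have [N NP] := path_near hf hmix hlam hv c0 pqP s p0ab t'ab.
  exists N => n Nn; have : near_end p q s (idx n) t'.
    by apply: NP => //; rewrite /idx -addnn -addnA (leq_trans Nn)// leq_addr.
  rewrite /near_end /lo /t'; case: (s) => /=; first by rewrite ge_max => /andP[].
  by rewrite le_min => /andP[].
- move=> n; have := le_trans (path_mass hf hmix hlam hv pqP (idx n)) (_ : _ <= (G (hi n) - G (lo n))%:E).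
  rewrite -hull_lohi => /(_ (Gsuper _ _ (s0lo n) (ltsW (lohi n)) (hiend n))).
  by rewrite lee_fin /idx exprD -exprM mul2n -mulrA (mulrC (lam ^+ n0)%R).
- exact: eP.
- by move=> x; rewrite fine_ge0.
- move=> x x' xx' xe; rewrite -lee_fin -!Gfin//; last exact: les_lt_trans xe.
  apply: (le_mass hlam hv); case: (s) xx' => /= xx' t /andP[h1 h2]; rewrite /ioo /=.
    by rewrite h1 (lt_le_trans h2).
  by rewrite h2 (le_lt_trans xx').
- move=> u w Xu Xw s0u uw we.
  have ue := les_lt_trans uw we; have s0w := les_trans s0u uw.
  have hue := hb _ Xu s0u ue; have hwe := hb _ Xw s0w we.
  have [uab Pu] := Xu; have [wab Pw] := Xw.
  have lip := mass_lipschitz2 hf hmix hlam hv uab wab Pu Pw.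
  have {}lip : mass (hull (f (f u)) (f (f w))) <= (lam ^+ 2 * (G w - G u))%:E.
    apply: (le_trans lip); rewrite (EFinM (lam ^+ 2)); apply: lee_wpmul2l; last exact: Gsuper.
    by rewrite lee_fin exprn_ge0// ltW.
  have PPu := cpmm_P hf Pu; have PPw := cpmm_P hf Pw.
  have t1 := germ_mass_triangle hf hmix hlam hv s s0icc (hicc _ wab) PPu.
  have t2 := germ_mass_triangle hf hmix hlam hv s s0icc (hicc _ uab) PPw.
  rewrite (hullC (f (f w))) in t2; rewrite !Gfin// in t1 t2.
  have := le_trans t1 (leeD2l _ lip); have := le_trans t2 (leeD2l _ lip).
  by rewrite -!EFinD !lee_fin ler_norml => h1 h2; apply/andP; split; lra.
- exact: hb.
- by split.
- exact: hs0'.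
- exact: s0e.
- move=> k; have Phi : P (hi k) by have [] := gapn (idx k); rewrite /hi; case: (s).
  have hiab : ioo a b (hi k).
    have h1 := s0lo k; have h2 := lohi k; have h3 := hiend k.
    case/andP: s0ab => as0 s0b; case: (s) h1 h2 h3 => /= h1 h2 h3; rewrite /ioo /= h3 ?andbT.
      by rewrite (lt_trans (lt_le_trans as0 h1) h2).
    by rewrite (lt_trans h2 (le_lt_trans h1 s0b)).
  by have [z [zab Pz hz ze hhz]] := dip_point hf hmix fix2 Phi hiab; exists z; split.
Qed.

Lemma no_growing_path (c : R) (K : nat -> set (\bar R)) : (0 < c)%R ->
  ~ @growing_path R a b f P lam v c K.
Proof.
move=> c0 hK.
have /choice[p pP] : forall n, exists p, exists q, gap P p q /\ K n = ioo p q.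
  by move=> n; have [/(basic_gap hf)] := hK n.
have [q qP] := choice pP.
apply: (@no_gap_path c p q c0) => n.
have [g <-] := qP n; have [_ <-] := qP n.+1.
by have [_ h1 h2] := hK n.
Qed.

(** If the orbit of [y] meets [P], [split_preimage] applies. Otherwise it runs through basic
    intervals [J n], the defect is at most [lam ^- n * v (J n)], and unless this becomes arbitrarily
    small the [J n] form a growing path. *)
Lemma mass_split x y z : icc a b x -> icc a b z -> x < y -> y < z ->
  mass (ioo x z) <= mass (ioo x y) + mass (ioo y z).
Proof.
move=> xab zab xy yz.
have yab : icc a b y by apply: (icc_iccW xab zab); rewrite /icc /= !ltW.
suff : @split_defect R a b f P lam v y 0 by move=> /(_ x z xab zab xy yz); rewrite adde0.
have [[n Pn]|nP] := pselect (exists n, P (iter n f y)).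
  exact: (split_preimage hf hmix hlam hv yab Pn).
have /choice[J JP] : forall n, exists J, B J /\ J (iter n f y).
  move=> n; have [|I BI Iy] := basic_in hf (cpmm_iter_icc hf n yab) _; last by exists I.
  by move=> Pn; apply: nP; exists n.
have small c : (0 < c)%R -> exists n, (lam ^- n * v (J n) < c)%R.
  move=> c0; apply: contrapT => nn; apply: (@no_growing_path c J c0) => n.
  have [BJ Jn] := JP n; have [BJ' Jn'] := JP n.+1; split => //.
    exact: (basic_image_sat hf hmix BJ BJ' Jn Jn').
  rewrite leNgt; apply/negP => h; apply: nn; exists n.
  by rewrite mulrC ltr_pdivrMr// exprn_gt0.
move=> x' z' xab' zab' xy' yz'; rewrite adde0.
apply/lee_addgt0Pr => e e0; have [n ne] := small e e0; have [BJ Jn] := JP n.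
apply: le_trans (split_iter hf hmix hlam hv yab _ BJ Jn xab' zab' xy' yz') _.
  by move=> i _ Pi; apply: nP; exists i.
by apply: leeD2l; rewrite lee_fin ltW.
Qed.

Lemma mass_add x y z : icc a b x -> icc a b z -> x <= y -> y <= z ->
  mass (ioo x z) = mass (ioo x y) + mass (ioo y z).
Proof.
move=> xab zab xy yz.
have e0 u : mass (ioo u u) = 0.
  rewrite (_ : ioo u u = set0) ?(mass_set0 hf hlam hv)//.
  by apply/seteqP; split => // t /andP[h1 h2]; have := lt_trans h1 h2; rewrite ltxx.
have [->|nxy] := eqVneq x y; first by rewrite e0 add0e.
have [->|nyz] := eqVneq y z; first by rewrite e0 adde0.
have {nxy} xy : x < y by rewrite lt_neqAle nxy.
have {nyz} yz : y < z by rewrite lt_neqAle nyz.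
apply/le_anti; rewrite mass_split//=.
apply: (mass_super hf hmix hlam hv).
- by move=> t /andP[h1 h2]; rewrite /ioo /= h1 (lt_trans h2).
- by move=> t /andP[h1 h2]; rewrite /ioo /= h2 (lt_trans xy).
- by apply/seteqP; split => // t [/andP[_ h1] /andP[h2 _]]; have := lt_trans h1 h2; rewrite ltxx.
Qed.

Lemma germ_small s x w0 (c : R) :
  icc a b x -> germ_end (a := a) (b := b) s x w0 -> mass (germ s x w0) < +oo ->
  (0 < c)%R -> exists2 w, germ_end (a := a) (b := b) s x w & mass (germ s x w) < c%:E.
Proof.
move=> xab gw0 fin c0; apply: contrapT => nw.
have : @heavy_germ R a b f P lam v s x c.
  split => //; first by exists w0.
  by move=> w gw; rewrite leNgt; apply/negP => h; apply: nw; exists w.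
by move=> /(heavy_germ_path hf hmix hlam hv c0)[K /(no_growing_path c0)].
Qed.

(** At time [n] the points [u] and [w] are in [P] while [y] has not met it, so []u, w[] contains the
    branch of the [n]-th iterate around [y] that maps onto [J]. Each step divides the mass by
    [lam]. *)
Lemma mass_cylinder n u w y J : icc a b u -> icc a b w -> u < y -> y < w ->
  P (iter n f u) -> P (iter n f w) -> (forall i, (i <= n)%N -> ~ P (iter i f y)) ->
  B J -> J (iter n f y) -> (lam ^- n * v J)%:E <= mass (ioo u w).
Proof.
elim: n u w y => [|n IH] u w y uab wab uy yw.
  move=> /= Pu Pw _ BJ Jy; rewrite expr0 invr1 mul1r -(mass_basic hf hmix hlam hv BJ).
  apply: (le_mass hlam hv); have [p [q [g JE]]] := basic_gap hf BJ; rewrite JE in Jy *.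
  have [|h1 h2] := gap_sat g Pu Pw Jy; first by rewrite /ioo /= uy.
  by move=> t /andP[pt tq]; rewrite /ioo /= (le_lt_trans h1 pt) (lt_le_trans tq h2).
rewrite !iterSr => Pu Pw nP BJ Jy.
have yab : icc a b y by apply: (icc_iccW uab wab); rewrite /icc /= !ltW.
have [I BI Iy] := basic_in hf yab (nP 0%N isT).
have [p [q [g IE]]] := basic_gap hf BI; have [pab qab] := gap_icc hf g.
have [Pp Pq pq _] := g.
have [py yq] : p < y /\ y < q by move: Iy; rewrite IE => /andP[].
pose u' := Order.max u p; pose w' := Order.min w q.
have uy' : u' < y by rewrite gt_max uy py.
have yw' : y < w' by rewrite lt_min yw yq.
have pu' : p <= u' by rewrite le_max lexx orbT.
have wq' : w' <= q by rewrite ge_min lexx orbT.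
have u'ab : icc a b u' by rewrite /u'; case: leP.
have w'ab : icc a b w' by rewrite /w'; case: leP.
have Pu' : P (iter n f (f u')).
  by rewrite /u'; case: leP => _ //; apply: (cpmm_P_iter hf); exact: (cpmm_P hf).
have Pw' : P (iter n f (f w')).
  by rewrite /w'; case: leP => _ //; apply: (cpmm_P_iter hf); exact: (cpmm_P hf).
apply: (@le_trans _ _ (mass (ioo u' w'))); last first.
  apply: (le_mass hlam hv) => t /andP[]; rewrite gt_max lt_min => /andP[h1 _] /andP[h2 _].
  by rewrite /ioo /= h1.
have sub : ioo u' w' `<=` I.
  by move=> t /andP[ut tw]; rewrite IE /ioo /= (le_lt_trans pu' ut) (lt_le_trans tw wq').
rewrite exprS invfM -mulrA EFinM lee_pdivrMl// -(mass_image hf hmix hlam hv BI sub).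
rewrite (gap_image hf hmix g pu' (lt_trans uy' yw') wq').
have fy : ioo (Order.min (f u') (f w')) (Order.max (f u') (f w')) (f y).
  rewrite -(gap_image hf hmix g pu' (lt_trans uy' yw') wq'); exists y => //.
  by rewrite /ioo /= uy'.
have fu'ab := cpmm_icc hf u'ab; have fw'ab := cpmm_icc hf w'ab.
case/andP: fy => h1 h2; apply: (IH _ _ (f y)) => //.
- by case: (leP (f u') (f w')).
- by case: (leP (f u') (f w')).
- by case: (leP (f u') (f w')).
- by case: (leP (f u') (f w')).
- by move=> i i_n; rewrite -iterSr; apply: nP.
Qed.

(** Between two points whose orbits enter [P] lies one whose orbit is still outside [P] when both
    have entered; [mass_cylinder] applies to it. *)
Lemma mass_gt0 x y : icc a b x -> icc a b y -> x < y -> 0 < mass (ioo x y).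
Proof.
move=> xab yab xy.
have [e1 /andP[xe1 e1y] [n1 Pe1]] := Piter_dense hf hmix xab yab xy.
have e1ab : icc a b e1 by apply: (icc_iccW xab yab); rewrite /icc /= !ltW.
have [e2 /andP[e12 e2y] [n2 Pe2]] := Piter_dense hf hmix e1ab yab e1y.
have e2ab : icc a b e2 by apply: (icc_iccW e1ab yab); rewrite /icc /= !ltW.
have [z /andP[ez ze] nPz] := Piter_nowhere hf hmix (maxn n1 n2) e1ab e2ab e12.
have zab : icc a b z by apply: (icc_iccW e1ab e2ab); rewrite /icc /= !ltW.
have [J BJ Jz] := basic_in hf (cpmm_iter_icc hf _ zab) nPz.
have h : (0 < lam ^- maxn n1 n2 * v J)%R.
  by rewrite mulr_gt0 ?invr_gt0 ?exprn_gt0// (eigen_gt0 hf hmix hlam hv).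
rewrite -lte_fin in h; apply: (lt_le_trans h).
apply: (@le_trans _ _ (mass (ioo e1 e2))).
  apply: (mass_cylinder e1ab e2ab ez ze _ _ _ BJ Jz).
  - by rewrite -(subnK (leq_maxl n1 n2)) iterD; exact: (cpmm_P_iter hf).
  - by rewrite -(subnK (leq_maxr n1 n2)) iterD; exact: (cpmm_P_iter hf).
  - move=> i /subnK e Pi; apply: nPz; rewrite -e iterD; exact: (cpmm_P_iter hf).
by apply: (le_mass hlam hv) => t /andP[h1 h2]; rewrite /ioo /= (lt_trans xe1 h1) (lt_trans h2 e2y).
Qed.

End no_growing_path.

(** * The conjugacy defined by an eigenvector *)

Section linearization.
Context {R : realType} {a b : \bar R} {f : \bar R -> \bar R} {P : set (\bar R)}.
Hypothesis hf : cpmm a b f P.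
Hypothesis hmix : topologically_mixing `[a, b] f.
Variables (lam : R) (v : set (\bar R) -> R).
Hypothesis hlam : (1 < lam)%R.
Hypothesis hv : nonneg_eigenvector a b f P lam v.
Implicit Types (x y z t u w : \bar R) (A I : set (\bar R)) (s : bool).
Local Open Scope ereal_scope.
Local Notation B := (basic_intervals a b P).
Local Notation mass := (@mass R a b f P lam v).
Local Notation gend := (@germ_end R a b).
Local Notation ept := (@endpt R a b).

Let lam0 : (0 < lam)%R. Proof. exact: lt_trans hlam. Qed.
Let m0 A : 0 <= mass A.
Proof. exact: (mass_ge0 hlam hv A). Qed.
Local Hint Resolve m0 : core.

Variable o : \bar R.
Hypothesis oab : ioo a b o.
Let oicc : icc a b o. Proof. exact: (ioo_icc hf). Qed.

Definition psi x := if o <= x then mass (ioo o x) else - mass (ioo x o).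

Let sgn s (y : \bar R) := if s then y else - y.

Let ltsgn s x y : lts s x y <-> sgn s x < sgn s y.
Proof. by case: s => //=; rewrite lteN2. Qed.

Let mass_ioo_id x : mass (ioo x x) = 0.
Proof.
rewrite (_ : ioo x x = set0) ?(mass_set0 hf hlam hv)//.
by apply/seteqP; split => // t /andP[h1 h2]; have := lt_trans h1 h2; rewrite ltxx.
Qed.

Lemma psi_outward s x : les s o x -> sgn s (psi x) = mass (germ s o x).
Proof.
rewrite /psi; case: s => /= h; first by rewrite h.
case: leP => [h'|_]; last by rewrite oppeK.
by rewrite (@le_anti _ _ x o) ?h ?h'// mass_ioo_id oppe0.
Qed.

Lemma psi_inward s x : les s x o -> sgn s (psi x) = - mass (germ s x o).
Proof.
rewrite /psi; case: s => /= h; last by rewrite h.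
case: leP => [h'|//].
by rewrite (@le_anti _ _ x o) ?h ?h'// mass_ioo_id oppe0.
Qed.

Lemma germ_mass_add s x y z : icc a b x -> icc a b z -> les s x y -> les s y z ->
  mass (germ s x z) = mass (germ s x y) + mass (germ s y z).
Proof.
case: s => /= xab zab xy yz; first exact: (mass_add hf hmix hlam hv).
by rewrite (mass_add hf hmix hlam hv zab xab yz xy) addeC.
Qed.

Lemma mass_lt_fin x y : a < x -> x < y -> y < b -> mass (ioo x y) \is a fin_num.
Proof. by move=> ax xy yb; rewrite ge0_fin_numE//; exact: (mass_fin hf hmix hlam hv). Qed.

Lemma mass_fin_num x y : ioo a b x -> ioo a b y -> mass (ioo x y) \is a fin_num.
Proof.
move=> /andP[ax _] /andP[_ yb]; have [xy|yx] := ltP x y; first exact: mass_lt_fin.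
rewrite (_ : ioo x y = set0) ?(mass_set0 hf hlam hv)//.
by apply/seteqP; split => // t /andP[h1 h2]; have := lt_le_trans (lt_trans h1 h2) yx; rewrite ltxx.
Qed.

Lemma psi_lt x y : icc a b x -> icc a b y -> x < y -> psi x < psi y.
Proof.
move=> xab yab xy; have /andP[ao ob] := oab.
have /andP[ax _] := xab; have /andP[_ yb] := yab.
have mxy := mass_gt0 hf hmix hlam hv xab yab xy.
rewrite /psi; have [ox|xo] := leP o x.
  rewrite (le_trans ox (ltW xy)) (mass_add hf hmix hlam hv oicc yab ox (ltW xy)).
  rewrite lteDl// mass_fin_num// /ioo /= (lt_le_trans ao ox) (lt_le_trans xy yb)//.
have mxo := mass_gt0 hf hmix hlam hv xab oicc xo.
have [oy|yo] := leP o y.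
  by apply: (@lt_le_trans _ _ 0) => //; rewrite oppe_lt0.
rewrite lteN2 (mass_add hf hmix hlam hv xab oicc (ltW xy) (ltW yo)).
by rewrite lteDr// mass_fin_num// /ioo /= (le_lt_trans ax xy) (lt_trans yo ob).
Qed.

Lemma psi_fin x : ioo a b x -> psi x \is a fin_num.
Proof.
by move=> xab; rewrite /psi; case: leP => _; rewrite ?fin_numN mass_fin_num.
Qed.

Lemma psi_diff x y : ioo a b x -> ioo a b y -> x <= y ->
  (fine (psi y) - fine (psi x))%R = fine (mass (ioo x y)).
Proof.
move=> xab yab xy; rewrite -fineB ?psi_fin//; congr fine.
have xicc := ioo_icc hf xab; have yicc := ioo_icc hf yab.
rewrite /psi; have [ox|xo] := leP o x.
  rewrite (le_trans ox xy) (mass_add hf hmix hlam hv oicc yicc ox xy).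
  by rewrite addeAC subee ?add0e// mass_fin_num.
have [oy|yo] := leP o y.
  by rewrite oppeK addeC -(mass_add hf hmix hlam hv xicc yicc (ltW xo) oy).
rewrite oppeK (mass_add hf hmix hlam hv xicc oicc xy (ltW yo)).
by rewrite addeC -addeA subee ?adde0// mass_fin_num.
Qed.

(** With infinite mass no germ at [x] fits into one basic interval, so any finite family of basic
    intervals is avoided by a small germ. If the part outside small germs had mass at most [r], so
    would every finite partial sum, and hence the whole. *)
Lemma germ_exhaust s x w0 (r : R) : icc a b x -> gend s x w0 -> ioo a b w0 ->
  mass (germ s x w0) = +oo -> exists2 w, gend s x w & les s w w0 /\ r%:E < mass (germ s w w0).
Proof.
move=> xab gw0 w0ab minf.
have w0icc := ioo_icc hf w0ab.
have inside w : gend s x w -> germ s x w `<=` germ s x w0 -> exists w',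
    [/\ gend s x w', ioo a b w', les s w' w0 & germ s x w w'].
  move=> gw sub; have [w' gw'] := germ_nonempty gw; exists w'; have gw0' := sub _ gw'.
  have /andP[ax xb] := xab; have /andP[aw0 w0b] := w0ab.
  case: s gw gw' gw0' {gw0 minf sub} => /= /andP[h1 h2] /andP[h3 h4] /andP[h5 h6].
    split; [by rewrite /germ_end /= h3 (le_trans (ltW h4) h2)|
      by rewrite /ioo /= (le_lt_trans ax h3) (lt_le_trans h4 h2)|exact: ltW|].
    by rewrite /ioo /= h3.
  split; [by rewrite /germ_end /= h4 (le_trans h1 (ltW h3))|
    by rewrite /ioo /= (le_lt_trans h1 h3) (lt_le_trans h4 xb)|exact: ltW|].
  by rewrite /ioo /= h3.
have subg w w' : germ s x w w' -> germ s x w' `<=` germ s x w.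
  case: (s) => /= /andP[h1 h2] t /andP[h3 h4]; rewrite /ioo /=.
    by rewrite h3 (lt_trans h4).
  by rewrite h4 (lt_trans h1).
have gles w : gend s x w -> les s x w by case: (s) => /= /andP[h1 h2]; exact: ltW.
have nJ : ~ (exists J, B J /\ exists2 w, gend s x w & germ s x w `<=` J).
  move=> [J [BJ [w1 gw1 w1J]]]; have [w2 [gw2 s1 s2]] := germ_endI gw1 gw0.
  have [w [gw wab ww0 /subg sub]] := inside _ gw2 s2.
  have := germ_mass_add xab w0icc (gles _ gw) ww0; rewrite minf.
  have h1 : mass (germ s x w) \is a fin_num.
    rewrite ge0_fin_numE//; apply: le_lt_trans (ltry (v J)).
    rewrite -(mass_basic hf hmix hlam hv BJ); apply: (le_mass hlam hv).
    by move=> t /sub/s1/w1J.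
  have h2 : mass (germ s w w0) \is a fin_num.
    by case: (s) => /=; exact: mass_fin_num.
  by rewrite -(fineK h1) -(fineK h2).
apply: contrapT => nw.
have : mass (germ s x w0) <= r%:E; last by rewrite minf.
rewrite (mass_decomp hf hmix hlam hv); apply: esum_le_seq => l ul lB.
have [w1 [gw1 sw1 dw1]] := germ_avoid_seq hf xab gw0 nJ lB.
have [w [gw wab ww0 w1w]] := inside _ gw1 sw1.
rewrite leNgt; apply/negP => h; apply: nw; exists w => //; split => //.
apply: (lt_le_trans h); apply: (le_trans (mass_super_seq hf hmix hlam hv _ ul lB)).
apply: (le_mass hlam hv) => t [tw0 tl].
have nt : ~ germ s x w1 t.
  by move=> h'; have : (germ s x w1 `&` \bigcup_(I in [set` l]) I) t by []; rewrite dw1.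
case: (s) w1w tw0 nt => /= /andP[h1 h2] /andP[h3 h4] nt; rewrite /ioo /=.
  by rewrite h4 andbT ltNge; apply/negP => h5; apply: nt; rewrite /ioo /= h3 (le_lt_trans h5).
by rewrite h3 /= ltNge; apply/negP => h5; apply: nt; rewrite /ioo /= h4 (lt_le_trans h1).
Qed.

(** There is no jump at [x] towards the end [s]. Beyond [o] this is [germ_small]; before [o] it is
    [germ_small] when the mass from [x] to [o] is finite, and [germ_exhaust] when [x] is the
    opposite end and that mass is infinite. *)
Lemma psi_side s x t : icc a b x -> lts s x (ept s) -> lts s (psi x) t ->
  exists2 w, gend s x w & lts s (psi w) t.
Proof.
move=> xab xe /ltsgn pt.
have lesP y z : les s y z \/ les s z y by case: (s) => /=; apply/orP; rewrite le_total.
have gw0 : gend s x (ept s) by case: (s) xe => /= h; rewrite /germ_end /= h lexx.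
have gles w : gend s x w -> les s x w by case: (s) => /= /andP[h1 h2]; exact: ltW.
have gicc w : gend s x w -> icc a b w.
  by case/andP: xab => ax xb; case: (s) => /= /andP[h1 h2]; rewrite /icc /= ?h1 ?h2 ?andbT;
    [exact: le_trans (ltW h1)|exact: le_trans (ltW h2) xb].
have eps (y : \bar R) : y \is a fin_num -> y < sgn s t -> exists2 e : R, (0 < e)%R & y + e%:E <= sgn s t.
  move=> yf yt; have [z /andP[yz zt]] := ereal_dense yt.
  have zf : z \is a fin_num by apply: fin_between yz zt.
  exists (fine z - fine y)%R; first by rewrite subr_gt0 -lte_fin !fineK.
  by rewrite -[in leLHS](fineK yf) -EFinD addrC subrK fineK// ltW.
have [ox|/lesNlt xo'] := pselect (les s o x).
  have xab' : ioo a b x.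
    case/andP: oab => ao ob; case: (s) ox xe => /= h1 h2; rewrite /ioo /= h2 ?andbT.
      exact: lt_le_trans h1.
    exact: le_lt_trans ob.
  rewrite psi_outward// in pt.
  have fin : mass (germ s o x) \is a fin_num by case: (s) => /=; exact: mass_fin_num.
  have [e e0 he] := eps _ fin pt.
  have [w1 [gw1 w1ab]] : exists w1, gend s x w1 /\ ioo a b w1.
    case/andP: xab' => ax xb; case: (s) xe => /= /ereal_dense[w1 /andP[h1 h2]]; exists w1.
      by rewrite /germ_end /= h1 /ioo /= h2 (lt_trans ax h1) ltW.
    by rewrite /germ_end /= h2 /ioo /= h1 (lt_trans h2 xb) ltW.
  have fin1 : mass (germ s x w1) < +oo.
    by rewrite -ge0_fin_numE//; case: (s) => /=; exact: mass_fin_num.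
  have [w gw wsmall] := germ_small hf hmix hlam hv xab gw1 fin1 e0.
  exists w => //; apply/ltsgn; rewrite psi_outward; last exact: les_trans ox (gles _ gw).
  rewrite (germ_mass_add oicc (gicc _ gw) ox (gles _ gw)).
  by apply: lt_le_trans he; rewrite lteD2lE.
have xo := ltsW xo'.
have gxo : gend s x o.
  by case/andP: oicc => ao ob; case: (s) xo' => /= h; rewrite /germ_end /= h ?ob ?ao.
rewrite psi_inward// in pt.
have [fin|inf] := ltP (mass (germ s x o)) +oo; last first.
  have {}inf : mass (germ s x o) = +oo by apply/eqP; rewrite eq_le leey.
  have [r rt] : exists r : R, (- r)%:E <= sgn s t.
    move: pt; rewrite inf; case: (sgn s t) => [r _|_|//].
      by exists (- r)%R; rewrite opprK.
    by exists 0%R; rewrite leey.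
  have [w gw [wo rw]] := germ_exhaust r xab gxo oab inf.
  exists w => //; apply/ltsgn; rewrite psi_inward//; apply: lt_le_trans rt.
  by rewrite EFinN lteN2.
have finn : mass (germ s x o) \is a fin_num by rewrite ge0_fin_numE.
have [|e e0 he] := eps _ _ pt; first by rewrite fin_numN.
have [w1 gw1 wsmall] := germ_small hf hmix hlam hv xab gxo fin e0.
have [w [gw sw1 swo]] := germ_endI gw1 gxo.
have wo : les s w o.
  have [//|h] := lesP w o; have [->|nwo] := eqVneq w o; first by case: (s) => /=.
  have {}h : lts s o w by apply: lts_neq => // e'; rewrite e' eqxx in nwo.
  have : germ s x w o by case: (s) xo' h => /= h1 h2; rewrite /ioo /= h1 h2.
  by move/swo; case: (s) => /= /andP[]; rewrite ltxx.
exists w => //; apply/ltsgn; rewrite psi_inward//.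
have eM := germ_mass_add xab oicc (gles _ gw) wo.
have f1 : mass (germ s x w) \is a fin_num.
  rewrite ge0_fin_numE//; apply: le_lt_trans fin; exact: (le_mass hlam hv).
have f2 : mass (germ s w o) \is a fin_num.
  by rewrite ge0_fin_numE//; apply: le_lt_trans fin; rewrite eM leeDr.
apply: lt_le_trans he; rewrite eM.
have : mass (germ s x w) < e%:E by apply: le_lt_trans wsmall; exact: (le_mass hlam hv).
move: f1 f2; case: (mass (germ s x w)) => // m1; case: (mass (germ s w o)) => // m2 _ _.
rewrite lte_fin => h; change ((- m2)%:E < (- (m1 + m2) + e)%:E); rewrite lte_fin; lra.
Qed.

Let c := psi a.
Let d := psi b.

Lemma psi_le x y : icc a b x -> icc a b y -> x <= y -> psi x <= psi y.
Proof.
by move=> xab yab; rewrite le_eqVlt => /predU1P[->//|/(psi_lt xab yab)/ltW].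
Qed.

Lemma psi_icc x : icc a b x -> icc c d (psi x).
Proof.
move=> xab; have /andP[ax xb] := xab.
by rewrite /icc /= !psi_le//; [exact: (icc_b hf)|exact: (icc_a hf)].
Qed.

(** At the supremum of the points with value at most [t], [psi_side] excludes a jump on either
    side. *)
Lemma psi_surj t : icc c d t -> exists2 x, icc a b x & psi x = t.
Proof.
move=> /andP[ct td]; have [aab bab] := (icc_a hf, icc_b hf).
pose S := [set u | icc a b u /\ psi u <= t].
have Sa : S a by split.
pose x := ereal_sup S.
have xab : icc a b x.
  rewrite /icc /=; apply/andP; split; first exact: ereal_sup_ubound.
  by apply: ge_ereal_sup => u [/andP[]].
exists x => //; apply/eqP; rewrite eq_le; apply/andP; split; rewrite leNgt; apply/negP => h.
- have [|w gw tw] := @psi_side false x t xab _ h.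
    rewrite /= lt_neqAle; case/andP: (xab) => -> _; rewrite andbT.
    by apply: contraTneq h => <-; rewrite -leNgt.
  move: gw => /= /andP[aw wx].
  have wab : icc a b w by case/andP: xab => _ xb; rewrite /icc /= aw (le_trans (ltW wx)).
  have : x <= w.
    apply: ge_ereal_sup => u [uab ut]; rewrite leNgt; apply/negP => /ltW /(psi_le wab uab) h'.
    by have := lt_le_trans tw (le_trans h' ut); rewrite ltxx.
  by rewrite leNgt wx.
- have [|w gw tw] := @psi_side true x t xab _ h.
    rewrite /= lt_neqAle; case/andP: (xab) => _ ->; rewrite andbT.
    by apply: contraTneq h => ->; rewrite -leNgt.
  move: gw => /= /andP[xw wb].
  have : w <= x.
    apply: ereal_sup_ubound; split; last exact: ltW.
    by case/andP: xab => ax _; rewrite /icc /= wb (le_trans ax (ltW xw)).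
  by rewrite leNgt xw.
Qed.

Lemma within_comp (g h : \bar R -> \bar R) (A C : set (\bar R)) :
  {within A, continuous g} -> (forall x, A x -> C (g x)) ->
  {within C, continuous h} -> {within A, continuous (h \o g)}.
Proof.
move=> /subspace_continuousP cg gAC /subspace_continuousP ch.
apply/subspace_continuousP => x Ax N /(ch _ (gAC _ Ax)) /= CN.
have H : nbhs x [set y | A y -> C (g y) -> N (h (g y))] := cg x Ax _ CN.
suff : nbhs x [set y | A y -> N (h (g y))] by [].
by apply: filterS H => y h1 Ay; exact: h1 Ay (gAC _ Ay).
Qed.

Let incE x y : icc a b x -> icc a b y -> psi x < psi y -> x < y.
Proof.
by move=> xab yab; apply: contraTT; rewrite -!leNgt; exact: psi_le.
Qed.

Let psi_inj x y : icc a b x -> icc a b y -> psi x = psi y -> x = y.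
Proof.
move=> xab yab e; case: (ltgtP x y) => // h.
  by have := psi_lt xab yab h; rewrite e ltxx.
by have := psi_lt yab xab h; rewrite e ltxx.
Qed.

(** Increments of [psi] are masses, which [f] multiplies by [lam] on a basic interval; the reference
    point [x1] fixes the constant term. *)
Lemma psi_slope p q : gap P p q -> exists s m : R, `|s|%R = lam /\
  forall y, ioo p q y -> psi (f y) = (s * fine (psi y) + m)%:E.
Proof.
move=> g; have [r rP] := gap_mono hf hmix g; have [_ _ pq _] := g.
have [pab qab] := gap_icc hf g.
have inab y : ioo p q y -> ioo a b y /\ ioo a b (f y).
  move=> /andP[py yq]; have /andP[ap _] := pab; have /andP[_ qb] := qab.
  split; first by rewrite /ioo /= (le_lt_trans ap py) (lt_le_trans yq qb).
  have /andP[afp fpb] := cpmm_icc hf pab; have /andP[afq fqb] := cpmm_icc hf qab.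
  have := rP _ _ (lexx p) py (ltW yq); have := rP _ _ (ltW py) yq (lexx q).
  case: (r) => h1 h2; rewrite /ioo /=.
    by rewrite (le_lt_trans afp h2) (lt_le_trans h1 fqb).
  by rewrite (le_lt_trans afq h1) (lt_le_trans h2 fpb).
pose eps : R := (if r then 1 else -1)%R.
have step u w : ioo p q u -> ioo p q w -> u < w ->
    (fine (psi (f w)) - fine (psi (f u)) = eps * lam * (fine (psi w) - fine (psi u)))%R.
  move=> upq wpq uw; have [uab fuab] := inab _ upq; have [wab fwab] := inab _ wpq.
  case/andP: upq wpq => pu uq /andP[pw wq].
  have sub : ioo u w `<=` ioo p q.
    by move=> t /andP[ut tw]; rewrite /ioo /= (lt_trans pu ut) (lt_trans tw wq).
  rewrite (psi_diff uab wab (ltW uw)).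
  have := mass_image hf hmix hlam hv (gap_basic hf g) sub.
  rewrite (gap_image hf hmix g (ltW pu) uw (ltW wq)).
  have := rP _ _ (ltW pu) uw (ltW wq); rewrite /eps; case: (r) => h.
    rewrite min_l ?max_r ?(ltW h)// => e.
    by rewrite (psi_diff fuab fwab (ltW h)) e fineM ?mass_fin_num// mul1r.
  rewrite min_r ?max_l ?(ltW h)// => e.
  rewrite -[LHS]opprB (psi_diff fwab fuab (ltW h)) e fineM ?mass_fin_num//=.
  by rewrite mulN1r mulNr.
have [x1 x1pq] := ereal_dense pq.
exists (eps * lam)%R, (fine (psi (f x1)) - eps * lam * fine (psi x1))%R; split.
  by rewrite normrM /eps (gtr0_norm lam0); case: (r); rewrite ?normrN normr1 mul1r.
move=> y ypq; have [_ fyab] := inab _ ypq.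
rewrite -[LHS]fineK ?psi_fin//; congr (_%:E).
case: (ltgtP x1 y) => [h|h|<-]; last by rewrite addrC subrK.
  by have := step _ _ x1pq ypq h; rewrite mulrBr; lra.
by have := step _ _ ypq x1pq h; rewrite mulrBr; lra.
Qed.

Lemma eigenvector_conjugate : exists (c d : \bar R) (g psi : \bar R -> \bar R) (Q : set (\bar R)),
  [/\ cpmm c d g Q, constant_slope c d g Q lam & conjugate_via a b f c d g psi].
Proof.
have [aab bab] := (icc_a hf, icc_b hf).
(* [phi] is the inverse of [psi] on [[c, d]], with arbitrary values elsewhere. *)
have /choice[phi phiP] : forall y, exists x, icc c d y -> icc a b x /\ psi x = y.
  move=> y; have [/psi_surj[x xab xy]|ny] := pselect (icc c d y); first by exists x.
  by exists a => /ny.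
have phiab y : icc c d y -> icc a b (phi y) by move=> /phiP[].
have psiK y : icc c d y -> psi (phi y) = y by move=> /phiP[].
have phiK x : icc a b x -> phi (psi x) = x.
  by move=> xab; have [h1 h2] := phiP _ (psi_icc xab); apply: psi_inj.
have cpsi : {within icc a b, continuous psi}.
  apply: (@incr_surj_continuous R a b c d).
  - by move=> x y; rewrite !inE; exact: psi_lt.
  - exact: psi_icc.
  - exact: psi_surj.
have phi_lt x y : icc c d x -> icc c d y -> x < y -> phi x < phi y.
  move=> xcd ycd xy; apply: incE; rewrite ?psiK//; exact: phiab.
have cphi : {within icc c d, continuous phi}.
  apply: (@incr_surj_continuous R c d a b).
  - by move=> x y; rewrite !inE; exact: phi_lt.
  - exact: phiab.
  - by move=> x xab; exists (psi x); [exact: psi_icc|exact: phiK].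
pose g := psi \o f \o phi; pose Q := psi @` P.
have Qcd : Q `<=` icc c d by move=> _ [x Px <-]; apply/psi_icc/(cpmm_P_icc hf).
have phiQ y : Q y -> P (phi y) by move=> [x Px <-]; rewrite phiK//; exact: (cpmm_P_icc hf).
have Qphi y : icc c d y -> P (phi y) -> Q y by move=> ycd Py; exists (phi y) => //; exact: psiK.
(* Inside [[c, d]], [Q] is the preimage of the closed set [P] under the continuous [phi]. *)
have cQ : closed Q.
  move=> y yQ.
  have ycd : icc c d y.
    suff : `[c, d]%classic y by rewrite set_itvcc.
    apply: itv_closed; apply: closureS yQ.
    by rewrite set_itvcc.
  apply: Qphi => //; apply: contrapT => nP.
  have N : nbhs (phi y) (~` P).
    by apply: open_nbhs_nbhs; split => //; apply: closed_openC; exact: (cpmm_closed hf).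
  have /subspace_continuousP/(_ y ycd _ N) := cphi.
  by move=> /yQ[z [Qz /(_ (Qcd _ Qz))]]; apply; exact: phiQ.
have Qc : Q c by exists a => //; exact: (cpmm_left hf).
have Qd : Q d by exists b => //; exact: (cpmm_right hf).
have Qgap p' q' : gap Q p' q' -> gap P (phi p') (phi q').
  move=> [Qp Qq pq nQ]; split; [exact: phiQ|exact: phiQ|exact: phi_lt (Qcd _ Qp) (Qcd _ Qq) pq|].
  move=> x /andP[px xq] Px; have xab := cpmm_P_icc hf Px.
  apply: (nQ (psi x)); last by exists x.
  rewrite -(psiK p' (Qcd _ Qp)) -(psiK q' (Qcd _ Qq)).
  by rewrite !psi_lt//; exact/phiab/Qcd.
have Qcd' : Q `<=` `[c, d] by rewrite set_itvcc.
have Qbasic I : basic_intervals c d Q I -> exists p' q', gap Q p' q' /\ I = ioo p' q'.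
  by move/(basic_intervalsP I Qcd' cQ Qc Qd).
have inphi p' q' y : Q p' -> Q q' -> ioo p' q' y -> icc c d y /\ ioo (phi p') (phi q') (phi y).
  move=> /Qcd p'cd /Qcd q'cd ypq; have ycd : icc c d y by exact: icc_ioo ypq.
  by case/andP: ypq => py yq; split => //; rewrite /ioo /= !phi_lt.
have cpmmg : cpmm c d g Q.
  split.
  - exact: psi_lt (cpmm_lt hf).
  - rewrite set_itvcc => y ycd; exact/psi_icc/(cpmm_icc hf)/phiab.
  - rewrite set_itvcc; apply: (within_comp cphi phiab).
    apply: (within_comp (cpmm_within hf) _ cpsi) => x; exact: (cpmm_icc hf).
  - exact: Qcd'.
  - exact: cQ.
  - exact: sub_countable (card_image_le psi P) (cpmm_countable hf).
  - exact: Qc.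
  - exact: Qd.
  - move=> _ [_ [x Px <-] <-]; rewrite /g /= phiK; last exact: (cpmm_P_icc hf).
    by exists (f x) => //; exact: (cpmm_P hf).
  - move=> I /Qbasic[p' [q' [gQ ->]]]; have [Qp Qq _ _] := gQ.
    have gP := Qgap _ _ gQ; have [r rP] := gap_mono hf hmix gP.
    case: r rP => rP; [left|right] => x y xpq ypq;
      have [xcd /andP[/ltW px xq]] := inphi _ _ _ Qp Qq xpq;
      have [ycd /andP[py /ltW yq]] := inphi _ _ _ Qp Qq ypq;
      rewrite le_eqVlt => /predU1P[-> //|xy]; apply: psi_le; try exact/(cpmm_icc hf)/phiab;
      by apply/ltW/(rP _ _ px _ yq); exact: phi_lt.
exists c, d, g, psi, Q; split => //.
- move=> I /Qbasic[p' [q' [gQ ->]]]; have [Qp Qq _ _] := gQ.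
  have [s [m [sl h]]] := psi_slope (Qgap _ _ gQ); exists s, m; split => // x xpq.
  have [xcd xpq'] := inphi _ _ _ Qp Qq xpq.
  by rewrite /g /= h// psiK.
- split; last first.
    by move=> x; rewrite in_itv /= => xab; rewrite /g /= phiK.
  rewrite !set_itvcc; split => //; last by exists phi.
  split; first exact: psi_icc.
    by move=> x y; rewrite !inE; exact: psi_inj.
  by move=> y ycd; have [x xab xy] := psi_surj ycd; exists x.
Qed.

End linearization.

(** * The eigenvector defined by a conjugacy *)

Section lebesgue_complements.
Context {R : realType}.
Implicit Types (s m : R).

Let bnd_aff s m (b : itv_bound R) := match b with
  | BSide c l => BSide c (s * l + m) | BInfty c => BInfty R c end.

Let bnd_opp (b : itv_bound R) := match b with
  | BSide c l => BSide (~~ c) (- l) | BInfty c => BInfty R (~~ c) end.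

Lemma image_affine_itv s m l u : 0 < s ->
  (fun x => s * x + m) @` [set` Interval l u] = [set` Interval (bnd_aff s m l) (bnd_aff s m u)].
Proof.
move=> s0.
have e x : s * x + m \in Interval (bnd_aff s m l) (bnd_aff s m u) = (x \in Interval l u).
  rewrite !itv_boundlr; congr (_ && _).
    by case: l => [[] l|[]] //=; rewrite !bnd_simp ?lerD2r ?ltrD2r ?ler_pM2l ?ltr_pM2l.
  by case: u => [[] u|[]] //=; rewrite !bnd_simp ?lerD2r ?ltrD2r ?ler_pM2l ?ltr_pM2l.
apply/seteqP; split => [_ [x /= xi <-]|y /= yi]; first by rewrite e.
exists ((y - m) / s); last by field; rewrite gt_eqF.
by rewrite /= -e; have -> : s * ((y - m) / s) + m = y by field; rewrite gt_eqF.
Qed.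

Lemma image_opp_itv l u :
  -%R @` [set` Interval l u] = [set` Interval (bnd_opp u) (bnd_opp l)].
Proof.
have e (x : R) : - x \in Interval (bnd_opp u) (bnd_opp l) = (x \in Interval l u).
  rewrite !itv_boundlr andbC; congr (_ && _).
    by case: l => [[] l|[]] //=; rewrite !bnd_simp ?lerN2 ?ltrN2.
  by case: u => [[] u|[]] //=; rewrite !bnd_simp ?lerN2 ?ltrN2.
apply/seteqP; split => [_ [x /= xi <-]|y /= yi]; first by rewrite e.
by exists (- y); rewrite /= -?e opprK.
Qed.

Lemma lebesgue_measure_affine s m (i : interval R) : s != 0 ->
  lebesgue_measure ((fun x => s * x + m) @` [set` i]) = (`|s|%:E * lebesgue_measure [set` i])%E.
Proof.
have pos t (j : interval R) : 0 < t ->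
    lebesgue_measure ((fun x => t * x + m) @` [set` j]) = (t%:E * lebesgue_measure [set` j])%E.
  move=> t0; case: j => l u; rewrite image_affine_itv//.
  rewrite (lebesgue_measure_itv (Interval (bnd_aff t m l) (bnd_aff t m u))).
  rewrite (lebesgue_measure_itv (Interval l u)).
  case: l u => [c l|[]] [c' u|[]] //=;
    rewrite ?lte_fin ?ltrD2r ?ltr_pM2l// ?ltxx ?ltry ?ltNyr ?ltNy0 ?mule0//.
  - case: ifP => _; rewrite ?mule0// -!EFinD -EFinM; congr (_%:E); ring.
  - by rewrite addye// addye// gt0_muley// lte_fin.
  - by rewrite addey// addey// gt0_muley// lte_fin.
  - by rewrite addey// gt0_muley// lte_fin.
case: (ltgtP s 0) => // s0 _; last by rewrite pos// gtr0_norm.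
have -> : (fun x => s * x + m) = (fun x => - s * x + m) \o -%R.
  by apply/funext => x /=; rewrite mulrN mulNr opprK.
case: i => l u; rewrite -image_comp image_opp_itv pos ?oppr_gt0// ltr0_norm//; congr (_ * _)%E.
rewrite (lebesgue_measure_itv (Interval (bnd_opp u) (bnd_opp l))) (lebesgue_measure_itv (Interval l u)).
case: l u => [c l|[]] [c' u|[]] //=; rewrite ?lte_fin ?ltrN2//.
- by case: ifP => _; rewrite // -!EFinD; congr (_%:E); ring.
- by rewrite ltNyr ltry addye// addey.
- by rewrite ltNyr ltry addye// addey.
Qed.

Section countable_union.
Context {T : choiceType} {D : set T} {F : T -> set R}.
Hypothesis cD : countable D.
Hypothesis mF : forall i, D i -> measurable (F i).

(** An injection into the naturals re-indexes the family, with empty sets off its range, so that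
    sigma-additivity applies to unordered sums. *)
Lemma lebesgue_measure_countable : exists G : nat -> set R,
  [/\ forall n, measurable (G n), \bigcup_n G n = \bigcup_(i in D) F i,
    trivIset D F -> trivIset setT G &
    (\sum_(n <oo) lebesgue_measure (G n))%E = \esum_(i in D) lebesgue_measure (F i)].
Proof.
have [e einj] := countable_injP _ cD.
have einj' i j : D i -> D j -> e i = e j -> i = j.
  by move=> Di Dj; apply: einj; rewrite inE.
pose G n := \bigcup_(i in [set i | D i /\ e i = n]) F i.
have GE i : D i -> G (e i) = F i.
  move=> Di; apply/seteqP; split => [x [j [Dj ej] Fx]|x Fx]; last by exists i.
  by rewrite -(einj' _ _ Dj Di ej).
have G0 n : ~ (e @` D) n -> G n = set0.
  by move=> nn; apply/seteqP; split => // x [j [Dj ej] _]; apply: nn; exists j.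
exists G; split.
- move=> n; have [[i Di <-]|/G0 ->] := pselect ((e @` D) n); last exact: measurable0.
  by rewrite GE//; exact: mF.
- apply/seteqP; split => [x [n _ [i [Di _] Fx]]|x [i Di Fx]]; first by exists i.
  by exists (e i) => //; rewrite GE.
- move=> tF n k _ _ [x [[i [Di <-] Fx] [j [Dj <-] Fx']]].
  by congr e; apply: tF => //; exists x.
- rewrite nneseries_esumT; last by move=> n; exact: measure_ge0.
  have -> : \esum_(i in D) lebesgue_measure (F i) = \esum_(n in e @` D) lebesgue_measure (G n).
    rewrite esum_image; last by move=> i j; rewrite !inE => Di Dj; exact: einj'.
    by apply: eq_esum => i Di; rewrite GE.
  rewrite [RHS]esum_mkcond; apply: eq_esum => n _; case: ifPn => //.
  by rewrite notin_setE => /G0 ->; rewrite measure0.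
Qed.

End countable_union.

End lebesgue_complements.

(** * Length of the finite part of a set *)

Section real_length.
Context {R : realType}.
Implicit Types (A B N : set (\bar R)).

Definition reals_of A : set R := [set r | A r%:E].

Definition len A : \bar R := lebesgue_measure (reals_of A).

Lemma len_ge0 A : (0 <= len A)%E.
Proof. exact: measure_ge0. Qed.

Lemma interval_connectedI A B : connected A -> connected B -> is_interval (reals_of (A `&` B)).
Proof.
move=> cA cB x y [Ax Bx] [Ay By] z /andP[xz zy]; split.
  by apply: (connected_mid cA Ax Ay); rewrite !lee_fin xz.
by apply: (connected_mid cB Bx By); rewrite !lee_fin xz.
Qed.

Lemma connected_measurable A : connected A -> measurable (reals_of A).
Proof.
move=> cA; apply: measurable_realfun.is_interval_measurable.
by rewrite -(setIid A); exact: interval_connectedI.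
Qed.

Lemma countable_reals_of A : countable A -> countable (reals_of A).
Proof.
move=> cA; apply: (@sub_countable _ _ _ A _ cA).
apply: (card_le_trans _ (card_image_le (@fine R) A)).
by apply: subset_card_le => r Ar; exists r%:E.
Qed.

Lemma len_le A B : connected A -> connected B -> A `<=` B -> (len A <= len B)%E.
Proof.
move=> cA cB AB; apply: le_measure; rewrite ?inE; try exact: connected_measurable.
by move=> r /AB.
Qed.

Lemma len_ioo (r t : R) : r < t -> len (ioo r%:E t%:E) = (t - r)%:E.
Proof.
move=> rt; have := lebesgue_measure_itv (Interval (BRight r) (BLeft t)).
rewrite /= lte_fin rt EFinB => <-; congr (lebesgue_measure _).
Qed.

Lemma len_gt0 A x y : connected A -> A x -> A y -> (x < y)%E -> (0 < len A)%E.
Proof.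
move=> cA Ax Ay xy.
have [z1 /andP[xz1 z1y]] := ereal_dense xy.
have [z2 /andP[z12 z2y]] := ereal_dense z1y.
have z1E : z1 = (fine z1)%:E by rewrite fineK// (fin_between xz1 z1y).
have z2E : z2 = (fine z2)%:E by rewrite fineK// (fin_between z12 z2y).
have fz : (fine z1 < fine z2)%R by rewrite -lte_fin -z1E -z2E.
apply: (@lt_le_trans _ _ (len (ioo z1 z2))).
  by rewrite z1E z2E len_ioo// lte_fin subr_gt0.
apply: len_le => //; first exact: ioo_connected.
move=> z /andP[z1z zz2]; apply: (connected_mid cA Ax Ay).
by rewrite (ltW (lt_trans xz1 z1z)) (ltW (lt_trans zz2 z2y)).
Qed.

Section pieces.
Context {T : choiceType} {D : set T} {F : T -> set (\bar R)} {A N : set (\bar R)}.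
Hypotheses (cD : countable D) (cN : countable N).
Hypothesis mF : forall i, D i -> measurable (reals_of (F i)).
Hypothesis mA : measurable (reals_of A).
Hypothesis AF : A `<=` N `|` \bigcup_(i in D) F i.

Lemma len_bigcup_le : (len A <= \esum_(i in D) len (F i))%E.
Proof.
have [G [mG GE _ <-]] := lebesgue_measure_countable cD mF.
have cN' := countable_reals_of cN.
have mN : measurable (reals_of N).
  by apply: countable_measurable => // t; exact: measurable_set1.
have mU : measurable (\bigcup_n G n) by apply: bigcupT_measurable.
apply: (@le_trans _ _ (lebesgue_measure (reals_of N `|` \bigcup_n G n))).
  apply: le_measure; rewrite ?inE//; first exact: measurableU.
  by rewrite GE => r /AF[|[i Di Fi]]; [left|right; exists i].
apply: (le_trans (measureU2 _ _ _)) => //.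
rewrite [X in (X + _)%E](countable_lebesgue_measure0 cN') add0e.
exact: measure_sigma_subadditive.
Qed.

Lemma len_bigcup : trivIset D F -> \bigcup_(i in D) F i `<=` A ->
  len A = (\esum_(i in D) len (F i))%E.
Proof.
move=> tF FA; apply/eqP; rewrite eq_le len_bigcup_le/=.
have [G [mG GE tG <-]] := lebesgue_measure_countable cD mF.
have mU : measurable (\bigcup_n G n) by apply: bigcupT_measurable.
have -> : (\sum_(n <oo) lebesgue_measure (G n))%E = lebesgue_measure (\bigcup_n G n).
  have tG' : trivIset setT G.
    by apply: tG => i j Di Dj [x [Fx Fx']]; apply: tF => //; exists x%:E.
  rewrite measure_bigcup//; last by move=> n _; exact: mG.
  by apply: eq_eseriesl => n; rewrite in_setT.
apply: le_measure; rewrite ?inE// GE => r [i Di Fr].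
by apply: FA; exists i.
Qed.

End pieces.

Lemma is_interval_affine (s m : R) (X : set R) : s != 0 -> is_interval X ->
  is_interval ((fun x => s * x + m) @` X).
Proof.
move=> s0 iX _ _ [x Xx <-] [y Xy <-] z /andP[xz zy].
exists ((z - m) / s); last by field.
case: (ltgtP s 0) s0 => // s0 _.
  apply: (iX y x Xy Xx); rewrite ler_ndivlMr// ler_ndivrMr//; apply/andP; split; lra.
apply: (iX x y Xx Xy); rewrite ler_pdivlMr// ler_pdivrMr//; apply/andP; split; lra.
Qed.

End real_length.

Section countable_basic.
Context {R : realType} {a b : \bar R} {f : \bar R -> \bar R} {P : set (\bar R)}.
Hypothesis hf : cpmm a b f P.

Lemma basic_countable : countable (basic_intervals a b P).
Proof.
have cPP := countableX (cpmm_countable hf) (cpmm_countable hf).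
apply: (@sub_countable _ _ _ _ _ cPP).
apply: (card_le_trans _ (card_image_le (fun z => ioo z.1 z.2) (P `*` P))).
apply: subset_card_le => I /(basic_gap hf)[p [q [[Pp Pq _ _] ->]]].
by exists (p, q).
Qed.

Lemma basic_connected I : basic_intervals a b P I -> connected I.
Proof. by move=> /(basic_gap hf)[p [q [_ ->]]]; exact: ioo_connected. Qed.

Lemma basic_real I x : basic_intervals a b P I -> I x -> x \is a fin_num.
Proof. by move=> /(basic_gap hf)[p [q [_ ->]]] /andP[]; exact: fin_between. Qed.

Lemma basic_cover A : A `<=` icc a b ->
  A `<=` (A `&` P) `|` \bigcup_(I in basic_intervals a b P) (A `&` I).
Proof.
move=> Aab x Ax; have [Px|Px] := pselect (P x); first by left.
by right; have [I BI Ix] := basic_in hf (Aab _ Ax) Px; exists I.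
Qed.

End countable_basic.

(** * Lengths under a map of constant slope *)

Section constant_slope_length.
Context {R : realType} {c d : \bar R} {g : \bar R -> \bar R} {Q : set (\bar R)} {lam : R}.
Hypotheses (hg : cpmm c d g Q) (cs : constant_slope c d g Q lam) (lam0 : (0 < lam)%R).
Implicit Types (C J : set (\bar R)).
Local Notation BQ := (basic_intervals c d Q).
Local Open Scope ereal_scope.

Lemma len_affine J C : BQ J -> C `<=` J -> is_interval (reals_of C) ->
  measurable (reals_of (g @` C)) /\ len (g @` C) = lam%:E * len C.
Proof.
move=> BJ CJ iC; have [s [m [slam gE]]] := cs BJ.
have s0 : s != 0%R by rewrite -normr_gt0 slam.
have E : reals_of (g @` C) = [set (s * x + m)%R | x in reals_of C].
  apply/seteqP; split => [r [x Cx gr]|_ [x Cx <-]]; last first.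
    by exists x%:E => //; rewrite gE//; exact: CJ.
  have xE := fineK (basic_real hg BJ (CJ _ Cx)).
  exists (fine x); first by rewrite /reals_of /= xE.
  have := gE (fine x); rewrite xE => /(_ (CJ _ Cx)).
  by rewrite gr => -[].
split; first by rewrite E; apply: measurable_realfun.is_interval_measurable; exact: is_interval_affine.
rewrite /len E; have /is_intervalP -> := iC.
by rewrite (lebesgue_measure_affine m (Rhull (reals_of C)) s0) slam.
Qed.

(** Cut [C] along [Q]: on each piece [g] is affine with slope of modulus [lam], and the countable
    set [Q] and its image have no length. The images of the pieces may overlap, which leaves an
    inequality unless [g] is injective on [C]. *)
Lemma len_image C : connected C -> C `<=` icc c d ->
  len (g @` C) <= lam%:E * len C /\
  ({in C &, injective g} -> len (g @` C) = lam%:E * len C).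
Proof.
move=> cC Ccd.
have iCJ J : BQ J -> is_interval (reals_of (C `&` J)).
  by move=> BJ; apply: interval_connectedI => //; exact: (basic_connected hg BJ).
have aff J (BJ : BQ J) := len_affine BJ (@subIsetr _ C J) (iCJ J BJ).
have cB := basic_countable hg.
have cCQ : countable (C `&` Q) by apply: sub_countable (cpmm_countable hg); exact: subset_card_le.
have cgCQ : countable (g @` (C `&` Q)) by apply: sub_countable cCQ; exact: card_image_le.
have mgC : measurable (reals_of (g @` C)).
  apply: connected_measurable; apply: connected_continuous_connected => //.
  exact: continuous_subspaceW (cpmm_within hg).
have cover := basic_cover hg Ccd.
have gcover : g @` C `<=` g @` (C `&` Q) `|` \bigcup_(J in BQ) (g @` (C `&` J)).
  move=> _ [x Cx <-]; have [h|[J BJ h]] := cover _ Cx; first by left; exists x.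
  by right; exists J => //; exists x.
have lenC : lam%:E * len C = \esum_(J in BQ) len (g @` (C `&` J)).
  rewrite (len_bigcup cB cCQ _ (connected_measurable cC) cover).
  - rewrite -ge0_esumZl; [|exact: ltW|by move=> J _; exact: len_ge0].
    by apply: eq_esum => J BJ; have [_ ->] := aff J BJ.
  - by move=> J BJ; apply: measurable_realfun.is_interval_measurable; exact: iCJ.
  - move=> I J BI BJ [x [[_ Ix] [_ Jx]]]; exact: (basic_disj hg BI BJ Ix Jx).
  - by move=> x [J _ []].
rewrite lenC; split.
  by apply: (len_bigcup_le cB cgCQ) => // J BJ; have [] := aff J BJ.
move=> gi; apply: (len_bigcup cB cgCQ) => //.
- by move=> J BJ; have [] := aff J BJ.
- move=> I J BI BJ [_ [[x [Cx Ix] <-] [y [Cy Jy] e]]].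
  have xy : y = x by apply: gi; rewrite ?inE.
  by apply: (basic_disj hg BI BJ Ix); rewrite -xy.
- by move=> _ [J _ [x [Cx _] <-]]; exists x.
Qed.

End constant_slope_length.

(** * Lengths of the images of the basic intervals *)

Section conjugate_eigenvector.
Context {R : realType} {a b : \bar R} {f : \bar R -> \bar R} {P : set (\bar R)}.
Context {c d : \bar R} {g : \bar R -> \bar R} {Q : set (\bar R)} {lam : R} {psi : \bar R -> \bar R}.
Hypotheses (hf : cpmm a b f P) (hmix : topologically_mixing `[a, b] f).
Hypotheses (hg : cpmm c d g Q) (cs : constant_slope c d g Q lam) (hlam : (1 < lam)%R).
Hypothesis hpsi : conjugate_via a b f c d g psi.
Implicit Types (A I J : set (\bar R)).
Local Notation B := (basic_intervals a b P).
Local Open Scope ereal_scope.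

Let lam0 : (0 < lam)%R. Proof. exact: lt_trans hlam. Qed.

Let psi_within : {within icc a b, continuous psi}.
Proof. by have [[_ h _] _] := hpsi; rewrite set_itvcc in h. Qed.

Let psi_icc x : icc a b x -> icc c d (psi x).
Proof. by have [[[h _ _] _ _] _] := hpsi; rewrite !set_itvcc in h; exact: h. Qed.

Let psi_inj x y : icc a b x -> icc a b y -> psi x = psi y -> x = y.
Proof.
have [[[_ h _] _ _] _] := hpsi; rewrite !set_itvcc in h => xab yab e.
by apply: h => //; exact: mem_set.
Qed.

Let psi_surj y : icc c d y -> exists2 x, icc a b x & psi x = y.
Proof. by have [[[_ _ h] _ _] _] := hpsi; rewrite !set_itvcc in h; exact: h. Qed.

Let psi_conj x : icc a b x -> psi (f x) = g (psi x).
Proof. by have [_ h] := hpsi => xab; apply: h; rewrite in_itv. Qed.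

Let ell A := len (psi @` A).

Let psi_connected A : A `<=` icc a b -> connected A -> connected (psi @` A).
Proof.
move=> Aab cA; apply: connected_continuous_connected => //.
exact: continuous_subspaceW psi_within.
Qed.

Let f_connected A : A `<=` icc a b -> connected A -> connected (f @` A).
Proof. by move=> Aab cA; exact: (@image_iter_connected _ _ _ _ _ hf 1 A). Qed.

Let f_sub A : A `<=` icc a b -> f @` A `<=` icc a b.
Proof. by move=> Aab _ [x Ax <-]; apply: (cpmm_icc hf); exact: Aab. Qed.

Let ell_le A A' : A' `<=` icc a b -> connected A -> connected A' -> A `<=` A' -> ell A <= ell A'.
Proof.
move=> A'ab cA cA' AA'; apply: len_le; last exact: image_subset.
  by apply: psi_connected => // x /AA'; exact: A'ab.
exact: psi_connected.
Qed.

Lemma len_conjugate_image A : A `<=` icc a b -> connected A ->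
  ell (f @` A) <= lam%:E * ell A /\
  ({in A &, injective f} -> ell (f @` A) = lam%:E * ell A).
Proof.
move=> Aab cA.
have E : psi @` (f @` A) = g @` (psi @` A).
  rewrite !image_comp; apply/seteqP; split => _ [x Ax <-]; exists x => //=; rewrite psi_conj//; exact: Aab.
have [|h1 h2] := len_image hg cs lam0 (psi_connected Aab cA).
  by move=> _ [x Ax <-]; apply: psi_icc; exact: Aab.
rewrite /ell E; split => // fi; apply: h2 => _ _ /set_mem[x Ax <-] /set_mem[y Ay <-].
rewrite -!psi_conj; try exact: Aab.
move=> /psi_inj e; congr psi; apply: fi; rewrite ?inE//; apply: e; apply: (cpmm_icc hf); exact: Aab.
Qed.

Let basic_sub I : B I -> I `<=` icc a b.
Proof. by move=> BI x; exact: (basic_icc hf BI). Qed.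

(** Up to points of [P], the image of [I] is the disjoint union of the basic intervals in it, and
    [psi] sends [P] to a countable set. Nothing relates that set to [Q]; both are merely without
    length. *)
Lemma len_transition I : B I ->
  \esum_(J in B) (if `[< J `<=` f @` I >] then ell J else 0) = lam%:E * ell I.
Proof.
move=> BI; have cI := basic_connected hf BI; have Iab := basic_sub BI.
have [_ <-] := len_conjugate_image Iab cI; last first.
  by move=> x y /set_mem Ix /set_mem Iy; exact: (basic_inj hf hmix BI).
pose D := [set J | B J /\ J `<=` f @` I].
have DB : D `<=` B by move=> J [].
have cP (A : set (\bar R)) : countable (psi @` (A `&` P)).
  apply: sub_countable (cpmm_countable hf).
  by apply: card_le_trans (card_image_le _ _) _; exact: subset_card_le.
rewrite /ell [RHS](@len_bigcup _ _ D (fun J => psi @` J) _ (psi @` (f @` I `&` P))).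
- rewrite esum_mkcond [RHS]esum_mkcond; apply: eq_esum => J _.
  case: (boolP (J \in D)) => [/set_mem[BJ JI]|/negP JD]; first by rewrite mem_set// asboolT.
  case: ifPn => // /set_mem BJ; rewrite asboolF// => JI.
  by apply: JD; apply/mem_set.
- by apply: sub_countable (basic_countable hf); exact: subset_card_le.
- exact: cP.
- move=> J /DB BJ; apply: connected_measurable; apply: psi_connected; first exact: basic_sub.
  exact: (basic_connected hf BJ).
- apply: connected_measurable; apply: psi_connected; first exact: f_sub.
  exact: f_connected.
- move=> _ [y fIy <-]; have [[]|[J BJ [_ Jy]]] := basic_cover hf (f_sub Iab) fIy.
    by left; exists y.
  right; exists J; last by exists y.
  split => //; have [x Ix xy] := fIy.
  by apply: (basic_image_sat hf hmix BI BJ Ix); rewrite xy.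
- move=> J K /DB BJ /DB BK [_ [[x Jx <-] [y Ky e]]].
  have xy : y = x by apply: psi_inj e; [exact: (basic_sub BK)|exact: (basic_sub BJ)].
  by apply: (basic_disj hf BJ BK Jx); rewrite -xy.
- by move=> _ [J [_ JI] [x Jx <-]]; exists x => //; exact: JI.
Qed.

Let mul_fin x : x < +oo -> lam%:E * x < +oo.
Proof. by move=> h; apply: lte_mul_pinfty; rewrite ?lee_fin ?ltW. Qed.

Let ell_iter_fin n A : A `<=` icc a b -> connected A -> ell A < +oo -> ell (iter n f @` A) < +oo.
Proof.
move=> Aab cA Afin; elim: n => [|n IH] /=; first by rewrite image_id.
rewrite (_ : _ @` _ = f @` (iter n f @` A)); last by rewrite -image_comp.
have nab : iter n f @` A `<=` icc a b by move=> _ [x Ax <-]; apply: (cpmm_iter_icc hf); exact: Aab.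
have [h _] := len_conjugate_image nab (image_iter_connected hf Aab cA).
by apply: (le_lt_trans h); exact: mul_fin.
Qed.

(** Follow an orbit from [I] to [J]: each basic interval on the way lies in the image of the
    preceding one, so lengths grow at most by the factor [lam] per step. *)
Let ell_basic_fin I J : B I -> B J -> ell I < +oo -> ell J < +oo.
Proof.
move=> BI BJ; have [n [x [Ix Jx]]] := basic_hit hf hmix BI BJ.
elim: n I x BI Ix Jx => [|n IH] I x BI Ix Jx Ifin.
  by rewrite (basic_disj hf BJ BI Jx Ix).
rewrite iterSr in Jx.
have nP : ~ P (f x) by move=> /(cpmm_P_iter hf n); exact: (basic_notP hf BJ Jx).
have fxab : icc a b (f x) by apply: (cpmm_icc hf); exact: (basic_icc hf BI).
have [K BK Kfx] := basic_in hf fxab nP.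
apply: (IH K (f x)) => //.
have Iab := basic_sub BI; have cI := basic_connected hf BI.
have [h _] := len_conjugate_image Iab cI.
apply: le_lt_trans (mul_fin Ifin); apply: (le_trans _ h).
apply: ell_le; [exact: f_sub|exact: (basic_connected hf BK)|exact: f_connected|].
exact: (basic_image_sat hf hmix BI BK Ix Kfx).
Qed.

Let ioo_fin : exists x w, [/\ icc a b x, icc a b w, x < w & ell (ioo x w) < +oo].
Proof.
have [y1 /andP[cy1 y1d]] := ereal_dense (cpmm_lt hg).
have [y2 /andP[y12 y2d]] := ereal_dense y1d.
have [x1 x1ab x1E] : exists2 x, icc a b x & psi x = y1.
  by apply: psi_surj; rewrite /icc /= !ltW.
have [x2 x2ab x2E] : exists2 x, icc a b x & psi x = y2.
  by apply: psi_surj; rewrite /icc /= !ltW// (lt_trans cy1).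
(* Two points with finite value are at hand because one of them might be [b]; the interval is built
   to the right of the other. *)
have [x [/andP[ax xb] [r rE]]] : exists x, a <= x < b /\ exists r, psi x = r%:E.
  have fin1 := fin_between cy1 y1d.
  have fin2 := fin_between y12 y2d.
  have [h1|h1] := ltP x1 b.
    by exists x1; split; [have /andP[-> _] := x1ab|exists (fine y1); rewrite fineK].
  exists x2; split; last by exists (fine y2); rewrite fineK.
  have /andP[-> x2b] := x2ab; rewrite lt_neqAle x2b andbT; apply/eqP => e.
  have e1 : x1 = b by apply/eqP; rewrite eq_le h1; have /andP[_ ->] := x1ab.
  by move: y12; rewrite -x1E -x2E e1 e ltxx.
have [||w /andP[xw wb] wP] := @within_right _ a b psi x (ioo (r - 1)%:E (r + 1)%:E) psi_within.
- by rewrite ax.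
- rewrite rE; apply: open_nbhs_nbhs; split; first exact: ioo_open.
  by rewrite /ioo /= !lte_fin; apply/andP; split; lra.
have xab : icc a b x by rewrite /icc /= ax ltW.
have wab : icc a b w by rewrite /icc /= wb (le_trans ax (ltW xw)).
exists x, w; split => //.
apply: (@le_lt_trans _ _ (len (ioo (r - 1)%:E (r + 1)%:E))); last by rewrite len_ioo ?ltry//; lra.
apply: len_le; [|exact: ioo_connected|].
  by apply: psi_connected; [exact: icc_ioo|exact: ioo_connected].
by move=> _ [z /andP[/ltW xz zw] <-]; apply: wP; rewrite xz.
Qed.

(* Otherwise each image of an interval of finite length would contain at most
   one point of P; by mixing P would have a single interior point, a fixed one,
   and a side of it would be invariant under the second iterate. *)
Lemma basic_len_fin : exists2 I, B I & ell I < +oo.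
Proof.
have [x [w [xab wab xw Ufin]]] := ioo_fin.
have Uab : ioo x w `<=` icc a b by exact: icc_ioo.
apply: contrapT => nfin.
(* Two points of [P] in one image would enclose a basic interval, of finite length like the
   image. *)
have uniqP n p p' : P p -> P p' -> (iter n f @` ioo x w) p -> (iter n f @` ioo x w) p' -> ~ p < p'.
  move=> Pp Pp' Up Up' pp'; apply: nfin.
  have [z zpp' nPz] := P_nowhere hf pp'.
  have zab : icc a b z by apply: icc_ioo zpp'; exact: (cpmm_P_icc hf).
  have [I BI Iz] := basic_in hf zab nPz; exists I => //.
  have cU : connected (iter n f @` ioo x w).
    by apply: (image_iter_connected hf); [exact: Uab|exact: ioo_connected].
  apply: le_lt_trans (@ell_iter_fin n _ Uab (@ioo_connected _ x w) Ufin).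
  apply: ell_le => //; [|exact: (basic_connected hf BI)|].
    by move=> _ [y Uy <-]; apply: (cpmm_iter_icc hf); exact: Uab.
  have [q [q' [gq IE]]] := basic_gap hf BI; rewrite IE in Iz *.
  have [h1 h2] := gap_sat gq Pp Pp' Iz zpp'.
  move=> y /andP[qy yq]; apply: (connected_mid cU Up Up').
  by rewrite (le_trans h1 (ltW qy)) (le_trans (ltW yq) h2).
have uniqP' n p p' : P p -> P p' -> (iter n f @` ioo x w) p -> (iter n f @` ioo x w) p' -> p = p'.
  move=> Pp Pp' Up Up'; have h1 := uniqP n _ _ Pp Pp' Up Up'; have h2 := uniqP n _ _ Pp' Pp Up' Up.
  by case: (ltgtP p p').
have hit p : a < p < b -> exists N, forall n, (N <= n)%N -> (iter n f @` ioo x w) p.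
  move=> /andP[ap pb]; have [N NP] := mixing_cover hf hmix xab wab xw ap (lexx p) pb.
  by exists N => n /NP/(_ p)[|z zU zE]; [rewrite lexx|exists z].
have [p Pp pab] := P_interior hf hmix.
have [N NP] := hit p pab.
(* The image at time [N] contains [p], so the image at time [N.+1] contains both [f p] and [p]. *)
have fp : f p = p.
  apply: (uniqP' N.+1) => //; [exact: (cpmm_P hf)| |exact: NP].
  by have [z Uz zE] := NP _ (leqnn N); exists z => //=; rewrite zE.
have onlyP q : a < q < b -> P q -> q = p.
  move=> qab Pq; have [M MP] := hit q qab.
  by apply: (uniqP' (maxn M N)) => //; [apply: MP; exact: leq_maxl|apply: NP; exact: leq_maxr].
have /andP[ap pb] := pab.
have gl : gap P a p.
  split => //; first exact: cpmm_left hf.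
  by move=> q /andP[aq qp] Pq; move: (qp); rewrite (onlyP q) ?ltxx// aq (lt_trans qp pb).
have gr : gap P p b.
  split => //; first exact: cpmm_right hf.
  by move=> q /andP[pq qb] Pq; move: (pq); rewrite (onlyP q) ?ltxx// qb (lt_trans ap pq).
have [sl hl] := gap_mono hf hmix gl; have [sr hr] := gap_mono hf hmix gr.
have aab := icc_a hf; have bab := icc_b hf; have pab' := cpmm_P_icc hf Pp.
have fl z : icc a p z -> if sl then f z <= p else p <= f z.
  move=> /andP[az]; rewrite le_eqVlt => /orP[/eqP ->|zp]; first by rewrite fp lexx; case: (sl).
  by have := hl _ _ az zp (lexx p); rewrite fp; case: (sl) => /ltW.
have fr z : icc p b z -> if sr then p <= f z else f z <= p.
  move=> /andP[]; rewrite le_eqVlt => /orP[/eqP <-|pz] zb; first by rewrite fp lexx; case: (sr).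
  by have := hr _ _ (lexx p) pz zb; rewrite fp; case: (sr) => /ltW.
have disj u v s t : v <= s -> ioo u v `<=` ~` icc s t.
  by move=> vs z /andP[_ zv] /andP[sz _]; move: (lt_le_trans zv (le_trans vs sz)); rewrite ltxx.
have disj' u v s t : t <= u -> ioo u v `<=` ~` icc s t.
  by move=> tu z /andP[uz _] /andP[_ zt]; move: (lt_le_trans uz (le_trans zt tu)); rewrite ltxx.
have ii u v : ioo u v `<=` icc u v by move=> z /andP[uz zv]; rewrite /icc /= !ltW.
have fab z : icc a b z -> icc a b (f z) := cpmm_icc hf (x := z).
have [slT|slF] := boolP sl.
- apply: (@mixing_inv2 _ a b f P hf hmix (icc a p) a p p b) => //; last exact: disj'.
  have inv z : icc a b z -> icc a p z -> icc a p (f z).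
    move=> zab /fl; rewrite slT /icc /= => ->.
    by have /andP[-> _] := fab _ zab.
  by move=> z zab zS; exact: (inv _ (fab _ zab) (inv _ zab zS)).
have [srT|srF] := boolP sr.
- apply: (@mixing_inv2 _ a b f P hf hmix (icc p b) p b a p) => //; last exact: disj.
  have inv z : icc a b z -> icc p b z -> icc p b (f z).
    move=> zab /fr; rewrite srT /icc /= => ->.
    by have /andP[_ ->] := fab _ zab.
  by move=> z zab zS; exact: (inv _ (fab _ zab) (inv _ zab zS)).
(* In the remaining case [f] exchanges the two sides of [p], so two steps lead back to [[a, p]]. *)
apply: (@mixing_inv2 _ a b f P hf hmix (icc a p) a p p b) => //; last exact: disj'.
move=> z zab /fl; rewrite (negbTE slF) => h1.
have /andP[_ h2] := fab _ zab.
have := @fr (f z); rewrite /icc /= h1 h2 (negbTE srF) => /(_ isT) ->.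
by have /andP[-> _] := fab _ (fab _ zab).
Qed.

Lemma conjugate_eigenvector : nonneg_eigenvector a b f P lam (fun I => fine (ell I)).
Proof.
have [I0 BI0 fin0] := basic_len_fin.
have fin I : B I -> (fine (ell I))%:E = ell I.
  move=> BI; rewrite fineK// ge0_fin_numE ?len_ge0//.
  exact: ell_basic_fin fin0.
split.
- by move=> I BI; rewrite fine_ge0// len_ge0.
- exists I0 => //; rewrite gt_eqF// -lte_fin fin//.
  have [p [q [g0 IE]]] := basic_gap hf BI0; have [_ _ pq _] := g0.
  have [x /andP[px xq]] := ereal_dense pq; have [y /andP[xy yq]] := ereal_dense xq.
  have Ix : I0 x by rewrite IE /ioo /= px.
  have Iy : I0 y by rewrite IE /ioo /= yq (lt_trans px xy).
  have cI := psi_connected (basic_sub BI0) (basic_connected hf BI0).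
  have Ipx : (psi @` I0) (psi x) by exists x.
  have Ipy : (psi @` I0) (psi y) by exists y.
  case: (ltgtP (psi x) (psi y)) => h.
  + exact: (len_gt0 cI Ipx Ipy).
  + exact: (len_gt0 cI Ipy Ipx).
  + have e : x = y by apply: psi_inj => //; exact: (basic_sub BI0).
    by move: xy; rewrite e ltxx.
- move=> I BI; rewrite EFinM fin// -len_transition//.
  apply: eq_esum => J BJ; rewrite EFinM fin// /transition_matrix.
  by case: ifP => _; rewrite ?mul1e ?mul0e.
Qed.

End conjugate_eigenvector.

Theorem theorem3p1 (R : realType) (a b : \bar R) (f : \bar R -> \bar R)
    (P : set (\bar R)) (lam : R)
    (hf : cpmm a b f P) (hlam : 1 < lam)
    (hmix : topologically_mixing `[a, b] f) :
  (exists (c d : \bar R) (g psi : \bar R -> \bar R) (Q : set (\bar R)),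
      [/\ cpmm c d g Q, constant_slope c d g Q lam &
          conjugate_via a b f c d g psi]) <->
  (exists v : set (\bar R) -> R, nonneg_eigenvector a b f P lam v).
Proof.
split=> [[c [d [g [psi [Q [hg cs hpsi]]]]]]|[v hv]].
  by eexists; exact: conjugate_eigenvector hf hmix hg cs hlam hpsi.
have [p _ abp] := P_interior hf hmix.
exact: (eigenvector_conjugate hf hmix hlam hv (o := p) abp).
Qed.
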